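(* Let $\Sigma$ be a closed surface of genus $\ge 2$, let $\Gamma\le SO^\circ(2,1)$ be a lattice isomorphic to $\pi_1(\Sigma)$, and let $\mathcal{T}$ be the open solid timelike cone of dimension $2+1$. Let $\widetilde B(\Sigma)$ be the set of Riemannian metrics on $\Sigma$ of negative curvature that can be smoothly isometrically embedded in $\mathcal{T}/\Gamma$. Then there exists a constant $C>1$ that depends only on $\Gamma$, such that for any metric $g\in\widetilde B(\Sigma)$, up to scaling $g$ by a constant factor, we have $$\frac1C\,h_\Gamma\le g\le C\,h_\Gamma,$$ where $h_\Gamma$ is the hyperbolic metric on $\Sigma$ realized as the quotient of the hyperboloid $\mathbb{H}^2$ by $\Gamma$.
   Context: $\mathbb{R}^{2,1}$ is Minkowski space, i.e. $\mathbb{R}^3$ with the Lorentzian metric $dx^2+dy^2-dz^2$; $SO^\circ(2,1)$ is the identity component of its group of orientation-preserving linear isometries. $\mathcal{T}=\{(x,y,z)\in\mathbb{R}^{2,1} : x^2+y^2<z^2,\ z>0\}$ with the induced Lorentzian metric; $\Gamma$ acts on it by isometries and $\mathcal{T}/\Gamma$ carries the quotient Lorentzian metric. $\mathbb{H}^2=\{x^2+y^2-z^2=-1,\ z>0\}$, with the induced metric, is the hyperbolic plane; it is preserved by $\Gamma$. The quotient $S=\mathbb{H}^2/\Gamma$ is a closed hyperbolic surface, $\Sigma$ denotes its supporting topological surface, and $h_\Gamma$ is its hyperbolic metric, a fixed metric on $\Sigma$. A metric $g$ on $\Sigma$ can be smoothly isometrically embedded in $\mathcal{T}/\Gamma$ if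 there is a smooth embedding $\Sigma\to\mathcal{T}/\Gamma$ for which the pullback of the Lorentzian metric equals $g$. Inequalities between metrics are inequalities of quadratic forms at every point of $\Sigma$.
   Formalization: As printed, the claim fails for pullbacks of the hyperbolic metric by diffeomorphisms of Σ; the theorem bounds ψ*g instead, where ψ is the diffeomorphism of Σ making the embedding composed with ψ a radial graph over the quotient of the hyperboloid. *)

(* Defs.v *)
From HB Require Import structures.
From mathcomp Require Import all_boot all_order all_algebra.
From mathcomp Require Import all_classical all_reals all_analysis.

Set Implicit Arguments.
Unset Strict Implicit.
Unset Printing Implicit Defensive.

Import Order.TTheory GRing.Theory Num.Theory.
Import numFieldNormedType.Exports.

Local Open Scope classical_set_scope.
Local Open Scope ring_scope.

(* Vectors are rows and matrices act on the right. The analysis library's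
   [jacobian f x] follows the same convention: its rows are the images under
   df_x of the standard basis vectors. *)

(* [Ck k U f]: all iterated directional derivatives of f of order <= k exist
   and are continuous on the open set U. Directions are constant vectors, so in
   finite dimension this is the usual class C^k. *)
Fixpoint Ck (R : realType) (V W : normedModType R) (k : nat) (U : set V)
    (f : V -> W) : Prop :=
  (forall x, U x -> {for x, continuous f}) /\
  match k with
  | 0%N => True
  | k'.+1 => forall v : V,
      (forall x, U x -> derivable f x v) /\ Ck k' U (fun x => 'D_v f x)
  end.

Definition smooth_on (R : realType) (V W : normedModType R) (U : set V)
    (f : V -> W) : Prop := forall k, Ck k U f.

Definition qform (R : realType) (n : nat) (b : 'M[R]_n) (v : 'rV[R]_n) : R :=
  (v *m b *m v^T) 0 0.

(* A field of bilinear forms on R^m is given by its Gram matrices in the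
   standard basis. *)
Definition pullback (R : realType) (n m : nat) (f : 'rV[R]_n -> 'rV[R]_m)
    (b : 'rV[R]_m -> 'M[R]_m) (x : 'rV[R]_n) : 'M[R]_n :=
  jacobian f x *m b (f x) *m (jacobian f x)^T.

(* ---- Minkowski space R^{2,1}, its isometries and the timelike cone ---- *)

Definition eta (R : realType) : 'M[R]_3 :=
  diag_mx (\row_i (if i == ord_max then -1 else 1)).

Definition SO21 (R : realType) : set 'M[R]_3 :=
  [set A | A *m eta R *m A^T = eta R /\ \det A = 1].

Definition SO21_id (R : realType) : set 'M[R]_3 :=
  connected_component (@SO21 R) 1%:M.

Definition timelike_cone (R : realType) : set 'rV[R]_3 :=
  [set p | qform (eta R) p < 0 /\ 0 < p 0 ord_max].

(* ---- The hyperboloid H^2, in the global chart (x, y) ---- *)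

(* The chart identifies R^2 with H^2, so points of H^2 are written below as
   points of R^2. *)
Definition hyperboloid (R : realType) (x : 'rV[R]_2) : 'rV[R]_3 :=
  row_mx x (Num.sqrt (1 + x 0 ord0 ^+ 2 + x 0 ord_max ^+ 2))%:M.

Definition hyperboloid_coord (R : realType) (p : 'rV[R]_3) : 'rV[R]_2 :=
  @lsubmx R 1 2 1 p.

Definition act (R : realType) (A : 'M[R]_3) (x : 'rV[R]_2) : 'rV[R]_2 :=
  hyperboloid_coord (hyperboloid x *m A).

(* The lift of h_Gamma to H^2. *)
Definition hyp_metric (R : realType) : 'rV[R]_2 -> 'M[R]_2 :=
  pullback (@hyperboloid R) (fun=> eta R).

(* ---- The group Gamma ---- *)

Definition is_subgroup (R : realType) (Gamma : set 'M[R]_3) : Prop :=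
  [/\ Gamma 1%:M,
      forall A B, Gamma A -> Gamma B -> Gamma (A *m B) &
      forall A, Gamma A -> Gamma (invmx A)].

(* A discrete subgroup of SO°(2,1) whose quotient H^2 / Gamma is compact. *)
Definition cocompact_lattice (R : realType) (Gamma : set 'M[R]_3) : Prop :=
  [/\ is_subgroup Gamma,
      Gamma `<=` @SO21_id R,
      Gamma `<=` isolated Gamma &
      exists2 K : set 'rV[R]_2, compact K &
        forall x, exists2 A, Gamma A & K (act A x)].

Definition acts_freely (R : realType) (Gamma : set 'M[R]_3) : Prop :=
  forall A x, Gamma A -> act A x = x -> A = 1%:M.

(* pi_1 of the closed orientable surface of genus n, by its presentation
   < a_i, b_i (i < n) | prod_i a_i b_i a_i^-1 b_i^-1 >. A letter (i, c, e) is
   a_i if c = false and b_i if c = true, inverted when e = true. *)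
Definition letter (n : nat) : Type := ('I_n * bool * bool)%type.

Definition letter_inv (n : nat) (l : letter n) : letter n := (l.1, ~~ l.2).

Definition surface_relator (n : nat) : seq (letter n) :=
  flatten [seq [:: (i, false, false); (i, true, false);
                   (i, false, true); (i, true, true)] | i <- enum 'I_n].

Inductive surface_eq (n : nat) : seq (letter n) -> seq (letter n) -> Prop :=
| surface_eq_refl u : surface_eq u u
| surface_eq_sym u v : surface_eq u v -> surface_eq v u
| surface_eq_trans u v w :
    surface_eq u v -> surface_eq v w -> surface_eq u w
| surface_eq_cancel u v l :
    surface_eq (u ++ [:: l; letter_inv l] ++ v) (u ++ v)
| surface_eq_relator u v :
    surface_eq (u ++ surface_relator n ++ v) (u ++ v).

(* [e] induces an isomorphism from words modulo [surface_eq] onto Gamma. *)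
Definition iso_surface_group (R : realType) (n : nat)
    (Gamma : set 'M[R]_3) : Prop :=
  exists e : seq (letter n) -> 'M[R]_3,
    [/\ e [::] = 1%:M,
        forall u v, e (u ++ v) = e u *m e v,
        forall u v, e u = e v <-> surface_eq u v &
        range e = Gamma].

(* ---- Riemannian metrics on Sigma = H^2 / Gamma ---- *)

(* A metric on Sigma is given by its Gamma-invariant lift to H^2. *)
Definition riemannian_metric (R : realType) (Gamma : set 'M[R]_3)
    (g : 'rV[R]_2 -> 'M[R]_2) : Prop :=
  [/\ smooth_on setT g,
      forall x, (g x)^T = g x,
      forall x (v : 'rV[R]_2), v != 0 -> 0 < qform (g x) v &
      forall A, Gamma A -> pullback (act A) g = g].

Definition partial (R : realType) (i : 'I_2) (f : 'rV[R]_2 -> R)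
    (x : 'rV[R]_2) : R := 'D_(delta_mx 0 i) f x.

Definition christoffel (R : realType) (g : 'rV[R]_2 -> 'M[R]_2)
    (k i j : 'I_2) (x : 'rV[R]_2) : R :=
  2^-1 * \sum_l invmx (g x) k l *
    (partial i (fun y => g y j l) x + partial j (fun y => g y i l) x
     - partial l (fun y => g y i j) x).

(* R(d_i, d_j) d_k = \sum_l riemann g l i j k d_l, with
   R(X, Y) = [nabla_X, nabla_Y] - nabla_[X, Y]. *)
Definition riemann (R : realType) (g : 'rV[R]_2 -> 'M[R]_2)
    (l i j k : 'I_2) (x : 'rV[R]_2) : R :=
  partial i (christoffel g l j k) x - partial j (christoffel g l i k) x
  + \sum_m (christoffel g m j k x * christoffel g l i m x
            - christoffel g m i k x * christoffel g l j m x).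

(* <R(d_0, d_1) d_1, d_0> / det g, equal to +1 on the unit sphere. *)
Definition gauss_curvature (R : realType) (g : 'rV[R]_2 -> 'M[R]_2)
    (x : 'rV[R]_2) : R :=
  (\sum_l riemann g l ord0 ord_max ord_max x * g x l ord0) / \det (g x).

(* ---- Embeddings of Sigma in T / Gamma ---- *)

Definition orbit (R : realType) (Gamma : set 'M[R]_3) (p : 'rV[R]_3)
    : set 'rV[R]_3 := [set p *m A | A in Gamma].

Definition same_orbit (R : realType) (Gamma : set 'M[R]_3) (x y : 'rV[R]_2)
    : Prop := exists2 A, Gamma A & y = act A x.

(* A map Sigma -> T / Gamma is a Gamma-invariant function F on H^2 whose values
   are Gamma-orbits in T. As T is open in R^3 and T -> T / Gamma is a local
   diffeomorphism, F is smooth when it locally lifts to smooth maps into T. *)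
Definition local_lift (R : realType) (Gamma : set 'M[R]_3)
    (F : 'rV[R]_2 -> set 'rV[R]_3) (U : set 'rV[R]_2)
    (f : 'rV[R]_2 -> 'rV[R]_3) : Prop :=
  [/\ open U, smooth_on U f &
      forall x, U x -> timelike_cone (f x) /\ F x = orbit Gamma (f x)].

Definition smooth_map (R : realType) (Gamma : set 'M[R]_3)
    (F : 'rV[R]_2 -> set 'rV[R]_3) : Prop :=
  (forall A x, Gamma A -> F (act A x) = F x) /\
  (forall x, exists U f, U x /\ local_lift Gamma F U f).

(* Sigma being compact, a smooth embedding is an injective immersion. *)
Definition smooth_embedding (R : realType) (Gamma : set 'M[R]_3)
    (F : 'rV[R]_2 -> set 'rV[R]_3) : Prop :=
  [/\ smooth_map Gamma F,
      forall x y, F x = F y -> same_orbit Gamma x y &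
      forall U f x, local_lift Gamma F U f -> U x -> row_free (jacobian f x)].

Definition isometric (R : realType) (Gamma : set 'M[R]_3)
    (g : 'rV[R]_2 -> 'M[R]_2) (F : 'rV[R]_2 -> set 'rV[R]_3) : Prop :=
  forall U f x, local_lift Gamma F U f -> U x ->
    pullback f (fun=> eta R) x = g x.

Definition Btilde (R : realType) (Gamma : set 'M[R]_3)
    : set ('rV[R]_2 -> 'M[R]_2) :=
  [set g | [/\ riemannian_metric Gamma g,
               forall x, gauss_curvature g x < 0 &
               exists F, smooth_embedding Gamma F /\ isometric Gamma g F]].

(* ---- Identification of Sigma with H^2 / Gamma ---- *)

(* The lift to H^2 of a diffeomorphism of Sigma. *)
Definition surface_diffeo (R : realType) (Gamma : set 'M[R]_3)
    (psi : 'rV[R]_2 -> 'rV[R]_2) : Prop :=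
  [/\ smooth_on setT psi,
      exists psi', [/\ smooth_on setT psi', cancel psi psi' & cancel psi' psi] &
      forall x y, same_orbit Gamma x y <-> same_orbit Gamma (psi x) (psi y)].

(* The central projection T / Gamma -> H^2 / Gamma is a left inverse of
   F \o psi. Pulling a metric of Sigma back by psi is thus the same as viewing
   it on H^2 / Gamma through the central projection of F(Sigma); psi is the
   identity of Sigma when F(Sigma) is a radial graph parametrized over
   H^2 / Gamma. The condition is needed to compare g with h_Gamma at all: Btilde
   is stable under pullback by every diffeomorphism of Sigma, while h_Gamma is
   fixed. *)
Definition central_parametrization (R : realType) (Gamma : set 'M[R]_3)
    (F : 'rV[R]_2 -> set 'rV[R]_3) (psi : 'rV[R]_2 -> 'rV[R]_2) : Prop :=
  forall x, exists2 r : R, 0 < r & F (psi x) = orbit Gamma (r *: hyperboloid x).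

(* Inequality of quadratic forms at every point. *)
Definition metric_le (R : realType) (g1 g2 : 'rV[R]_2 -> 'M[R]_2) : Prop :=
  forall x v, qform (g1 x) v <= qform (g2 x) v.

(* Main.v *)
From HB Require Import structures.
Require Import Defs.
From mathcomp Require Import all_boot all_order all_algebra.
From mathcomp Require Import all_classical all_reals all_analysis.
From mathcomp Require Import ring lra.

Set Implicit Arguments.
Unset Strict Implicit.
Unset Printing Implicit Defensive.

Import Order.TTheory GRing.Theory Num.Theory.
Import numFieldNormedType.Exports.

Local Open Scope classical_set_scope.
Local Open Scope ring_scope.

(** Why the theorem holds.

    The embedding lifts to a spacelike immersion [f] of the plane H^2 into the cone T
    ([exists_lift]). The central projection [phi] of [f] to the hyperboloid is a local
    diffeomorphism, because a spacelike surface is transverse to the timelike rays; by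
    cocompactness it is a covering, hence a diffeomorphism ([global_inverse]). Its inverse
    [psi] makes the surface a radial graph: [f (psi x)] is [r x *: hyperboloid x] for a
    positive function [r] ([lift_polar]). As the embedding is injective, [psi] descends to
    a diffeomorphism of the quotient and [r] is Gamma-invariant ([psi_equivariant],
    [radius_invariant]). In this parametrization the metric is [g = r^2 h - dr^2], where
    [h] is the hyperbolic metric ([polar_metric]); in particular [g <= r^2 h].

    The metric being positive, [dr^2 <= r^2 h]: the oscillation of the logarithm of [r] is
    bounded by the diameter of a compact set that meets all orbits ([radius_ratio]). It
    remains to keep [dr^2] uniformly away from [r^2 h], so that [g] does not degenerate,
    and this is what negative curvature provides. Let [S] be the squared distance from the
    origin to the tangent plane, that is, minus the square of the normal component of the
    position vector ([tangent_plane_dist]). At a maximum of [S], which exists by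
    cocompactness, the second fundamental form kills the tangential component of the
    position vector. By the theorema egregium the determinant of this form is minus the
    curvature, up to a positive factor, so the form is nondegenerate and the position
    vector is normal ([position_normal_at_max]). At this point [S = r^2], hence
    [S <= M := max r^2] everywhere. The square of the tangential component of the position
    vector, which is [S - r^2], is thus at most [M - r^2], and by Cauchy-Schwarz
    [r^2 dr^2 <= (M - r^2) g], that is, [r^4 h <= M g] ([polar_metric_lower]). Scaling [g]
    by [1 / M] gives both bounds, with a constant that depends on the bound of [max r / r]
    only, hence on Gamma only. *)


(** * Maps of class C^k *)

Section ck_general.
Context {R : realType}.

Lemma Ck_cont (V W : normedModType R) k (U : set V) (f : V -> W) :
  Ck k U f -> forall x, U x -> {for x, continuous f}.
Proof. by case: k => [|k] []. Qed.

Lemma Ck_subset (V W : normedModType R) k (U U' : set V) (f : V -> W) :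
  U' `<=` U -> Ck k U f -> Ck k U' f.
Proof.
move=> sU; elim: k f => [|k IH] f /= [cf df]; split=> //; first by move=> x /sU/cf.
  by move=> x /sU/cf.
by move=> v; have [dv cv] := df v; split; [move=> x /sU/dv | exact: IH].
Qed.

Lemma Ck_ext (V W : normedModType R) k (U : set V) (f g : V -> W) :
  open U -> (forall x, U x -> f x = g x) -> Ck k U f -> Ck k U g.
Proof.
move=> oU; elim: k f g => [|k IH] f g fg /= [cf df].
  split=> // x Ux; have nU : {near x, f =1 g}.
    by apply: (filterS _ (open_nbhs_nbhs (conj oU Ux))) => y /fg.
  change (g @ x --> g x); rewrite -(fg _ Ux); apply: cvg_trans (cf x Ux).
  exact: near_eq_cvg nU.
have nU x : U x -> {near x, f =1 g}.
  by move=> Ux; apply: (filterS _ (open_nbhs_nbhs (conj oU Ux))) => y /fg.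
split=> [x Ux|v].
  change (g @ x --> g x); rewrite -(fg _ Ux); apply: cvg_trans (cf x Ux).
  exact: near_eq_cvg (nU x Ux).
have [dv cv] := df v; split=> [x Ux|].
  by apply: near_eq_derivable (dv x Ux); exact: nU.
apply: IH cv => x Ux; apply: near_eq_derive; exact: nU.
Qed.

Lemma CkS (V W : normedModType R) k (U : set V) (f : V -> W) :
  Ck k.+1 U f -> Ck k U f.
Proof.
elim: k f => [|k IH] f /= [cf df]; split=> // v.
by have [dv cv] := df v; split=> //; exact: IH.
Qed.

Lemma Ck_derive (V W : normedModType R) k (U : set V) (f : V -> W) v :
  Ck k.+1 U f -> Ck k U (fun x => 'D_v f x).
Proof. by move=> [_ /(_ v)[]]. Qed.

Lemma Ck_derivable (V W : normedModType R) k (U : set V) (f : V -> W) v x :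
  Ck k.+1 U f -> U x -> derivable f x v.
Proof. by move=> [_ /(_ v)[+ _]]; exact. Qed.

Lemma continuous_at_mx (T : topologicalType) m n (f : T -> 'M[R]_(m, n)) x :
  (forall i j, {for x, continuous (fun y => f y i j)}) -> {for x, continuous f}.
Proof.
move=> h; apply/cvgrPdist_le => e e0; near=> y.
rewrite [leLHS]/Num.Def.normr/= mx_normrE (bigmax_le _ (ltW e0))//= => i _.
rewrite !mxE/=; move: i; near: y; apply: filter_forall => /= i.
by have /cvgrPdist_le := h i.1 i.2; exact.
Unshelve. all: by end_near. Qed.

Lemma continuous_at_entry (T : topologicalType) m n (f : T -> 'M[R]_(m, n)) x i j :
  {for x, continuous f} -> {for x, continuous (fun y => f y i j)}.
Proof.
by move=> cf; apply: (@continuous_comp _ _ _ f (fun M : 'M[R]_(m, n) => M i j)) => //;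
  exact: coord_continuous.
Qed.

Lemma Ck_mx (V : normedModType R) m n k (U : set V) (f : V -> 'M[R]_(m, n)) :
  open U -> (Ck k U f <-> forall i j, Ck k U (fun x => f x i j)).
Proof.
move=> oU; elim: k f => [|k IH] f.
  split=> [[cf _] i j|h]; first by split=> // x /cf; exact: continuous_at_entry.
  by split=> // x Ux; apply: continuous_at_mx => i j; have [+ _] := h i j; exact.
split=> [[cf df] i j|h].
  split=> [x /cf|v]; first exact: continuous_at_entry.
  have [dv /IH cv] := df v; split=> [x /dv/derivable_mxP|]; first exact.
  by apply: Ck_ext (cv i j) => // x /dv/derive_mx ->; rewrite mxE.
split=> [x Ux|v]; first by apply: continuous_at_mx => i j; exact: Ck_cont (h i j) _ Ux.
have dv x : U x -> derivable f x v.
  by move=> Ux; apply/derivable_mxP => i j; exact: Ck_derivable (h i j) Ux.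
split=> //; apply/IH => i j.
by apply: Ck_ext (Ck_derive v (h i j)) => // x /dv/derive_mx ->; rewrite mxE.
Qed.

Lemma Ck_entry (V : normedModType R) m n k (U : set V) (f : V -> 'M[R]_(m, n)) i j :
  open U -> Ck k U f -> Ck k U (fun x => f x i j).
Proof. by move=> oU cf; have [h _] := Ck_mx k f oU; exact: h. Qed.

End ck_general.

Arguments Ck_cont {R V W k U f} _ {x} _.

Section ck_scalar.
Context {R : realType} {V : normedModType R}.
Implicit Types (U : set V) (f g : V -> R).

Lemma Ck_cst k U (c : R) : Ck k U (fun=> c).
Proof.
have cc x : {for x, continuous ((fun=> c) : V -> R)} by exact: cst_continuous.
elim: k c cc => [|k IH] c cc; split=> //.
move=> v; split=> [x _|]; first exact: derivable_cst.
have -> : 'D_v ((fun=> c) : V -> R) = fun=> 0 by apply/funext => x; exact: derive_cst.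
by apply: IH => x; exact: cst_continuous.
Qed.

Lemma Ck_add k U f g : open U -> Ck k U f -> Ck k U g -> Ck k U (fun x => f x + g x).
Proof.
move=> oU; elim: k f g => [|k IH] f g hf hg.
  by split=> // x Ux; apply: continuousD; [exact: Ck_cont hf _ Ux|exact: Ck_cont hg _ Ux].
split=> [x Ux|v]; first by apply: continuousD; [exact: Ck_cont hf _ Ux|exact: Ck_cont hg _ Ux].
split=> [x Ux|]; first by apply: derivableD; [exact: Ck_derivable hf Ux|exact: Ck_derivable hg Ux].
apply: Ck_ext (IH _ _ (Ck_derive v hf) (Ck_derive v hg)) => // x Ux.
by rewrite deriveD //; [exact: Ck_derivable hf Ux|exact: Ck_derivable hg Ux].
Qed.

Lemma Ck_mul k U f g : open U -> Ck k U f -> Ck k U g -> Ck k U (fun x => f x * g x).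
Proof.
move=> oU; elim: k f g => [|k IH] f g hf hg.
  by split=> // x Ux; apply: continuousM; [exact: Ck_cont hf _ Ux|exact: Ck_cont hg _ Ux].
split=> [x Ux|v]; first by apply: continuousM; [exact: Ck_cont hf _ Ux|exact: Ck_cont hg _ Ux].
split=> [x Ux|]; first by apply: derivableM; [exact: Ck_derivable hf Ux|exact: Ck_derivable hg Ux].
have h := Ck_add oU (IH _ _ (CkS hf) (Ck_derive v hg)) (IH _ _ (CkS hg) (Ck_derive v hf)).
apply: Ck_ext h => // x Ux.
by rewrite deriveM //; [exact: Ck_derivable hf Ux|exact: Ck_derivable hg Ux].
Qed.

Lemma Ck_opp k U f : open U -> Ck k U f -> Ck k U (fun x => - f x).
Proof.
move=> oU hf; apply: Ck_ext (Ck_mul oU (Ck_cst k U (-1)) hf) => // x _.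
by rewrite mulN1r.
Qed.

Lemma Ck_sub k U f g : open U -> Ck k U f -> Ck k U g -> Ck k U (fun x => f x - g x).
Proof. by move=> oU hf hg; apply: Ck_add => //; exact: Ck_opp. Qed.

Lemma Ck_sum k U n (f : 'I_n -> V -> R) : open U -> (forall i, Ck k U (f i)) ->
  Ck k U (fun x => \sum_i f i x).
Proof.
move=> oU; elim: n f => [|n IH] f hf.
  by apply: Ck_ext (Ck_cst k U 0) => // x _; rewrite big_ord0.
have h := Ck_add oU (hf ord0) (IH (fun i => f (lift ord0 i)) (fun i => hf _)).
by apply: Ck_ext h => // x _; rewrite big_ord_recl.
Qed.

Lemma Ck_inv k U f : open U -> (forall x, U x -> f x != 0) -> Ck k U f ->
  Ck k U (fun x => (f x)^-1).
Proof.
move=> oU f0; elim: k => [|k IH] hf.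
  by split=> // x Ux; apply: continuousV; [exact: f0|exact: Ck_cont hf _ Ux].
split=> [x Ux|v]; first by apply: continuousV; [exact: f0|exact: Ck_cont hf _ Ux].
split=> [x Ux|]; first by apply: derivableV; [exact: f0|exact: Ck_derivable hf Ux].
have hi := IH (CkS hf); have h := Ck_mul oU (Ck_opp oU (Ck_mul oU hi hi)) (Ck_derive v hf).
apply: Ck_ext h => // x Ux.
rewrite deriveV //; [|exact: f0|exact: Ck_derivable hf Ux].
by rewrite /GRing.scale /= -exprVn expr2.
Qed.

(** Directional derivatives are derivatives of functions of one real variable;
    this transfers the mean value theorem and the chain rule along lines. *)
Lemma derivable_line f x v t :
  derivable f (x + t *: v) v <-> derivable (fun s : R => f (x + s *: v)) t 1.
Proof.
rewrite /derivable (_ : (fun h => h^-1 *: (f (h *: v + (x + t *: v)) - f (x + t *: v))) =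
  (fun h => h^-1 *: (((fun s : R => f (x + s *: v)) \o shift t) (h *: 1) - f (x + t *: v)))) //.
by apply/funext => h /=; have -> : (h *: (1 : R) : R) = h := mulr1 h; rewrite scalerDl addrCA.
Qed.

Lemma derive_line f x v t :
  'D_1 (fun s : R => f (x + s *: v)) t = 'D_v f (x + t *: v).
Proof.
rewrite /derive (_ : (fun h => h^-1 *: ((f \o shift (x + t *: v)) (h *: v) - f (x + t *: v))) =
  (fun h => h^-1 *: (((fun s : R => f (x + s *: v)) \o shift t) (h *: 1) - f (x + t *: v)))) //.
by apply/funext => h /=; have -> : (h *: (1 : R) : R) = h := mulr1 h; rewrite scalerDl addrCA.
Qed.

Lemma is_derive_sqrt_comp f x v : 0 < f x -> derivable f x v ->
  is_derive x v (fun y => Num.sqrt (f y)) ((2 * Num.sqrt (f x))^-1 * 'D_v f x).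
Proof.
move=> f0 df.
have d1 : is_derive (0 : R) 1 (fun s : R => f (x + s *: v)) ('D_v f x).
  have := df; rewrite -{1}[x]addr0 -(scale0r v) => /derivable_line d.
  by apply: DeriveDef => //; rewrite derive_line scale0r addr0.
have d2 : is_derive (f (x + 0 *: v)) 1 Num.sqrt (2 * Num.sqrt (f x))^-1.
  by rewrite scale0r addr0; exact: is_derive1_sqrt.
have [d3 d4] := is_derive1_comp d2 d1.
apply: DeriveDef.
  by rewrite -[x]addr0 -(scale0r v); apply/derivable_line.
have := derive_line (fun y => Num.sqrt (f y)) x v 0.
by rewrite scale0r addr0 => <-.
Qed.

Lemma Ck_sqrt k U f : open U -> (forall x, U x -> 0 < f x) -> Ck k U f ->
  Ck k U (fun x => Num.sqrt (f x)).
Proof.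
move=> oU f0; have c x : {for x, continuous f} -> {for x, continuous (fun x => Num.sqrt (f x))}.
  by move=> cf; apply: (@continuous_comp _ _ _ f Num.sqrt) => //; exact: sqrt_continuous.
elim: k => [|k IH] hf.
  by split=> // x Ux; apply: c; exact: Ck_cont hf _ Ux.
split=> [x Ux|v]; first by apply: c; exact: Ck_cont hf _ Ux.
have d x : U x -> is_derive x v (fun y => Num.sqrt (f y)) ((2 * Num.sqrt (f x))^-1 * 'D_v f x).
  by move=> Ux; apply: is_derive_sqrt_comp; [exact: f0|exact: Ck_derivable hf Ux].
split=> [x /d[]//|].
have hi : Ck k U (fun x => (2 * Num.sqrt (f x))^-1).
  apply: Ck_inv => //; last by apply: Ck_mul => //; [exact: Ck_cst | exact: IH (CkS hf)].
  by move=> x Ux; rewrite mulf_neq0 // sqrtr_eq0 -ltNge f0.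
by apply: Ck_ext (Ck_mul oU hi (Ck_derive v hf)) => // x /d[_ ->].
Qed.

End ck_scalar.

(** * Mean value theorem and second derivatives *)

Section mx_norm_facts.
Context {R : realType}.

Lemma ler_mx_entry m n (M : 'M[R]_(m, n)) i j : `|M i j| <= `|M|.
Proof.
rewrite [leRHS]/Num.Def.normr/= mx_normrE.
exact: (le_bigmax _ (fun k : 'I_m * 'I_n => `|M k.1 k.2|) (i, j)).
Qed.

Lemma mx_norm_le m n (M : 'M[R]_(m, n)) e : 0 <= e ->
  (forall i j, `|M i j| <= e) -> `|M| <= e.
Proof.
by move=> e0 h; rewrite [leLHS]/Num.Def.normr/= mx_normrE bigmax_le.
Qed.

Lemma mx_norm_lt m n (M : 'M[R]_(m, n)) e : 0 < e ->
  (forall i j, `|M i j| < e) -> `|M| < e.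
Proof.
by move=> e0 h; rewrite [ltLHS]/Num.Def.normr/= mx_normrE bigmax_lt.
Qed.

Lemma mx_norm_mul m n p (A : 'M[R]_(m, n)) (B : 'M[R]_(n, p)) :
  `|A *m B| <= n%:R * `|A| * `|B|.
Proof.
apply: mx_norm_le => [|i j]; first by rewrite !mulr_ge0.
rewrite mxE (le_trans (ler_norm_sum _ _ _))//.
rewrite (@le_trans _ _ (\sum_(k < n) `|A| * `|B|)) //.
  by apply: ler_sum => k _; rewrite normrM ler_pM // ler_mx_entry.
by rewrite sumr_const card_ord -[leLHS]mulr_natl mulrA.
Qed.

End mx_norm_facts.

Lemma near0_norm_lt {R : realType} (V : normedModType R) (r : R) :
  0 < r -> \forall h \near (0 : V), `|h| < r.
Proof.
by move=> r0; apply/nbhs_ballP; exists r => // h; rewrite -ball_normE /= sub0r normrN.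
Qed.

Lemma cont_near_lt {R : realType} (T : topologicalType) (W : normedModType R) (f : T -> W) x e :
  {for x, continuous f} -> 0 < e -> \forall y \near x, `|f x - f y| < e.
Proof. by move=> cf ep; apply: (cvgrPdist_lt _ _).1. Qed.

Section mvt.
Context {R : realType} {V : normedModType R}.
Implicit Types f : V -> R.

Lemma MVT_line f x v : (forall s, 0 <= s <= 1 -> derivable f (x + s *: v) v) ->
  exists2 c, 0 <= c <= 1 & f (x + v) - f x = 'D_v f (x + c *: v).
Proof.
move=> df.
have d s : s \in `[0 : R, 1] -> derivable (fun s : R => f (x + s *: v)) s 1.
  by rewrite in_itv /= => /df /derivable_line.
have [||c] := @MVT_segment R (fun s => f (x + s *: v)) (fun s => 'D_v f (x + s *: v)) 0 1 ler01.
- move=> s; rewrite in_itv /= => /andP[s0 s1]; apply: DeriveDef; last exact: derive_line.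
  by apply: d; rewrite in_itv /= !ltW.
- by apply: derivable_within_continuous => s; exact: d.
rewrite in_itv /= => c01; rewrite scale1r scale0r addr0 subr0 mulr1 => e.
by exists c.
Qed.

Lemma derivable_scale_is f x v k : derivable f x v -> is_derive x (k *: v) f (k * 'D_v f x).
Proof.
move=> dv.
have d1 : is_derive (k * 0) 1 (fun s : R => f (x + s *: v)) ('D_v f x).
  rewrite mulr0; have := dv; rewrite -{1}[x]addr0 -(scale0r v) => /derivable_line d.
  by apply: DeriveDef => //; rewrite derive_line scale0r addr0.
have d2 : is_derive (0 : R) 1 (fun s : R => k * s) k.
  by have := is_deriveZ k (@is_derive_id _ _ (0 : R) 1) => /is_derive_eq; apply; exact: mulr1.
have [d3 d4] := is_derive1_comp d1 d2.
have E : (fun s : R => f (x + s *: v)) \o (fun s : R => k * s) = (fun s => f (x + s *: (k *: v))).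
  by apply/funext => s /=; rewrite scalerA mulrC.
rewrite E in d3 d4.
apply: DeriveDef.
  by rewrite -[x]addr0 -(scale0r (k *: v)); apply/derivable_line.
by have := derive_line f x (k *: v) 0; rewrite scale0r addr0 d4 => <-; rewrite mulrC.
Qed.

Lemma derive_scale f x v k : derivable f x v -> 'D_(k *: v) f x = k * 'D_v f x.
Proof. by move=> /(derivable_scale_is k)[]. Qed.

Lemma is_derive_translate f x v a : derivable f (x + a) v ->
  is_derive x v (fun y => f (y + a)) ('D_v f (x + a)).
Proof.
have E : (fun h : R => h^-1 *: (((fun y => f (y + a)) \o shift x) (h *: v) - f (x + a))) =
   (fun h : R => h^-1 *: ((f \o shift (x + a)) (h *: v) - f (x + a))).
  by apply/funext => h /=; rewrite addrA.
by move=> d; apply: DeriveDef; [rewrite /derivable E|rewrite /derive E].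
Qed.

Lemma ball_segment (a x y : V) (r s : R) : 0 <= s <= 1 ->
  ball a r x -> ball a r y -> ball a r (x + s *: (y - x)).
Proof.
move=> /andP[s0 s1]; rewrite -!ball_normE /= => ax ay.
have -> : a - (x + s *: (y - x)) = (1 - s) *: (a - x) + s *: (a - y).
  rewrite !scalerBr !scalerBl !scale1r; set u := s *: y; set w := s *: x; set z := s *: a.
  by rewrite opprD opprB [- (x - w)]opprB !addrA [RHS](AC 6 (1*4*3*6*(5*2)))/= subrr addr0.
rewrite (le_lt_trans (ler_normD _ _))// !normrZ !ger0_norm ?subr_ge0//.
have [->|s0'] := eqVneq s 0; first by rewrite mul0r addr0 subr0 mul1r.
have sp : 0 < s by rewrite lt0r s0'.
have -> : r = (1 - s) * r + s * r by rewrite mulrBl mul1r subrK.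
by rewrite ler_ltD // ?ltr_pM2l // ler_wpM2l ?subr_ge0 // ltW.
Qed.

(** Two mean value points need not coincide; by continuity it is enough that
    both can be taken arbitrarily near [x]. *)
Lemma eq_of_close_values (g h : V -> R) x :
  {for x, continuous g} -> {for x, continuous h} ->
  (forall r, 0 < r -> exists p q, [/\ ball x r p, ball x r q & g p = h q]) -> g x = h x.
Proof.
move=> cg ch H; apply/eqP; apply: contraT => ne.
have ep : 0 < `|g x - h x| / 2 by rewrite divr_gt0 // normr_gt0 subr_eq0.
have /nbhs_ballP[r /= r0 rP] : nbhs x ([set y | `|g x - g y| < `|g x - h x| / 2] `&` [set y | `|h x - h y| < `|g x - h x| / 2]).
  by apply: filterI; exact: cont_near_lt.
have [p [q [/rP[P1 _] /rP[_ P2] pq]]] := H r r0.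
suff : `|g x - h x| < `|g x - h x| / 2 + `|g x - h x| / 2 by rewrite -splitr ltxx.
have {1}-> : g x - h x = (g x - g p) - (h x - h q) by rewrite pq; ring.
by rewrite (le_lt_trans (ler_normD _ _))// normrN ltrD.
Qed.

(** The mean value theorem, applied first to the increment of [f] along
    [k *: z] and then to ['D_w f]. *)
Lemma second_difference f (U : set V) x w z r k : ball x r `<=` U -> Ck 2 U f ->
  0 < k -> k * (`|w| + `|z|) < r ->
  exists2 p, ball x r p & f (x + k *: w + k *: z) - f (x + k *: w) - (f (x + k *: z) - f x) =
    k * (k * 'D_z ('D_w f) p).
Proof.
move=> rU cf k0 kr.
have inwz s t : 0 <= s <= 1 -> 0 <= t <= 1 -> ball x r (x + s *: (k *: w) + t *: (k *: z)).
  move=> /andP[s0 s1] /andP[t0 t1]; rewrite -ball_normE /= -addrA opprD addNKr normrN.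
  rewrite !scalerA (le_lt_trans (ler_normD _ _))// !normrZ.
  rewrite !ger0_norm ?mulr_ge0 ?(ltW k0) //.
  rewrite (le_lt_trans _ kr) //.
  by rewrite mulrDr lerD // ler_wpM2r // ler_piMl // ltW.
have d a y : ball x r y -> derivable f y a.
  by move=> /rU Uy; exact: Ck_derivable cf Uy.
have dd y : ball x r y -> derivable ('D_w f) y z.
  by move=> /rU Uy; exact: Ck_derivable (Ck_derive w cf) Uy.
have l1 : 0 <= (1 : R) <= 1 by rewrite lexx ler01.
have l0 : 0 <= (0 : R) <= 1 by rewrite lexx ler01.
have dg s : 0 <= s <= 1 -> is_derive (x + s *: (k *: w)) (k *: w)
   (fun y => f (y + k *: z) - f y)
   (k * ('D_w f (x + s *: (k *: w) + k *: z) - 'D_w f (x + s *: (k *: w)))).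
  move=> s01.
  have b1 : ball x r (x + s *: (k *: w) + k *: z) by have := inwz s 1 s01 l1; rewrite scale1r.
  have b0 : ball x r (x + s *: (k *: w)) by have := inwz s 0 s01 l0; rewrite scale0r addr0.
  rewrite mulrBr -!derive_scale; [|exact: d|exact: d].
  have D1 : is_derive (x + s *: (k *: w)) (k *: w) (fun y => f (y + k *: z)) ('D_(k *: w) f (x + s *: (k *: w) + k *: z)).
    exact: is_derive_translate (d _ _ b1).
  have D0 : is_derive (x + s *: (k *: w)) (k *: w) f ('D_(k *: w) f (x + s *: (k *: w))).
    by apply: DeriveDef => //; exact: d.
  exact: is_deriveB.
have [s s01|s s01] := @MVT_line (fun y => f (y + k *: z) - f y) x (k *: w).
  by have [] := dg s s01.
have [_ ->] := dg s s01 => ->.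
have [t t01|t t01] := @MVT_line ('D_w f) (x + s *: (k *: w)) (k *: z).
  exact: (@ex_derive _ _ _ _ _ _ _ (derivable_scale_is k (dd _ (inwz s t s01 t01)))).
have bt := inwz s t s01 t01.
rewrite (derive_scale _ (dd _ bt)) => ->.
by exists (x + s *: (k *: w) + t *: (k *: z)).
Qed.

(** Schwarz: the second difference of [f] is symmetric in its two directions. *)
Lemma derive_sym f (U : set V) x u v : open U -> Ck 2 U f -> U x ->
  'D_u ('D_v f) x = 'D_v ('D_u f) x.
Proof.
move=> oU cf Ux.
have c1 := Ck_cont (Ck_derive u (Ck_derive v cf)) Ux.
have c2 := Ck_cont (Ck_derive v (Ck_derive u cf)) Ux.
apply: (eq_of_close_values c1 c2) => r r0.
have [r' [r'0 rr' rU]] : exists r', [/\ 0 < r', r' <= r & ball x r' `<=` U].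
  have /nbhs_ballP[r1 /= r1p r1U] := open_nbhs_nbhs (conj oU Ux).
  exists (Order.min r r1); rewrite lt_min r0 r1p ge_min lexx; split => //.
  by move=> y xy; apply: r1U; apply: le_ball xy; rewrite ge_min lexx orbT.
pose k := r' / (`|u| + `|v| + 1).
have N0 : 0 < `|u| + `|v| + 1 by rewrite ltr_wpDl // addr_ge0.
have k0 : 0 < k by rewrite divr_gt0.
have kr : k * (`|u| + `|v|) < r'.
  by rewrite /k mulrAC ltr_pdivrMr // ltr_pM2l // ltrDl.
have [p bp Ep] := second_difference rU cf k0 kr.
have [|q bq Eq] := second_difference rU cf k0 (_ : k * (`|v| + `|u|) < r').
  by rewrite [`|v| + _]addrC.
exists q, p; split; [exact: le_ball bq|exact: le_ball bp|].
have k1 : k != 0 by rewrite gt_eqF.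
have cancel2 (A B : R) : k * (k * A) = k * (k * B) -> A = B by move=> /(mulfI k1)/(mulfI k1).
apply: cancel2; apply: etrans (esym Eq) (etrans _ Ep).
rewrite [x + k *: v + _]addrAC; move: (f _) (f _) (f _) (f _) => A B C D; ring.
Qed.
End mvt.

(** * Differentiability of maps on the plane *)

Section lin2.
Context {R : realType}.
Local Notation E := 'rV[R]_2.

Definition ax0 : E := delta_mx 0 ord0.
Definition ax1 : E := delta_mx 0 ord_max.

(** The candidate for the differential of a function with partial derivatives
    [a] and [b]. *)
Definition lin2 (a b : R) (h : E) : R := h 0 ord0 * a + h 0 ord_max * b.

Lemma lin2_is_linear a b : linear (lin2 a b).
Proof.
move=> k u v; rewrite /lin2 !mxE /GRing.scale /=; ring.
Qed.
HB.instance Definition _ a b := GRing.isLinear.Build R E R _ (lin2 a b) (lin2_is_linear a b).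

Lemma rV2E (h : E) : h = h 0 ord0 *: ax0 + h 0 ord_max *: ax1.
Proof.
apply/rowP => i; rewrite !mxE !eqxx /=.
case: (unliftP ord0 i) => [j ->|->]; last by rewrite !eqxx mulr1 mulr0 addr0.
rewrite (ord1 j) (_ : lift ord0 0 = ord_max) ?eqxx ?mulr0 ?add0r ?mulr1 //.
exact: val_inj.
Qed.

Lemma ord2E (i : 'I_2) : i = ord0 \/ i = ord_max.
Proof. by case: i => -[|[|//]] ? ; [left|right]; exact: val_inj. Qed.

Lemma norm2_lt (h : E) e : (`|h| < e) = (`|h 0 ord0| < e) && (`|h 0 ord_max| < e).
Proof.
apply/idP/andP => [he|[h0 h1]].
  by split; apply: le_lt_trans he; exact: ler_mx_entry.
apply: mx_norm_lt => [|i j]; first exact: le_lt_trans h0.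
by rewrite (ord1 i); case: (ord2E j) => ->.
Qed.

Lemma lin2_continuous a b : continuous (lin2 a b).
Proof.
move=> x; rewrite /lin2.
apply: (@continuousD _ _ _ (fun h : E => h 0 ord0 * a) (fun h : E => h 0 ord_max * b)).
  by apply: (@continuousM _ _ (fun h : E => h 0 ord0) (fun=> a)); [exact: coord_continuous|exact: cst_continuous].
by apply: (@continuousM _ _ (fun h : E => h 0 ord_max) (fun=> b)); [exact: coord_continuous|exact: cst_continuous].
Qed.

Lemma lin_close (c d A B h0 h1 N e : R) : `|c - B| < e / 2 -> `|d - A| < e / 2 ->
  `|h0| <= N -> `|h1| <= N -> `|h1 * A + h0 * B - (h0 * c + h1 * d)| <= e * N.
Proof.
move=> P0 P1 H0 H1.
have -> : h1 * A + h0 * B - (h0 * c + h1 * d) = - (h0 * (c - B)) - h1 * (d - A) by ring.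
rewrite (le_trans (ler_normD _ _))// !normrN !normrM.
rewrite [e]splitr mulrDl ![_ / 2 * _]mulrC.
by apply: lerD; apply: ler_pM => //; exact: ltW.
Qed.

(** Going from [x] to [h + x] parallel to one axis and then to the other, the
    mean value theorem produces partial derivatives at points near [x]. *)
Lemma Ck1_expand (f : E -> R) (U : set E) x : open U -> Ck 1 U f -> U x ->
  forall e, 0 < e -> \forall h \near (0 : E),
    `|f (h + x) - f x - lin2 ('D_ax0 f x) ('D_ax1 f x) h| <= e * `|h|.
Proof.
move=> oU cf Ux e ep.
have c0 := Ck_cont (Ck_derive ax0 cf) Ux; have c1 := Ck_cont (Ck_derive ax1 cf) Ux.
have e2 : 0 < e / 2 by rewrite divr_gt0.
have /nbhs_ballP[r /= r0 rP] : \forall y \near x, [/\ U y,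
    `|'D_ax0 f x - 'D_ax0 f y| < e / 2 & `|'D_ax1 f x - 'D_ax1 f y| < e / 2].
  have [C1 C2] := (cont_near_lt c0 e2, cont_near_lt c1 e2).
  apply: filterS (filterI (open_nbhs_nbhs (conj oU Ux)) (filterI C1 C2)) => y [Uy [P1 P2]].
  by split; [exact: Uy|exact: P1|exact: P2].
apply: filterS (near0_norm_lt _ r0) => h hr.
have /andP[h0r h1r] : (`|h 0 ord0| < r) && (`|h 0 ord_max| < r) by rewrite -norm2_lt.
have inb (a b : R) : `|a| < r -> `|b| < r -> ball x r (x + (a *: ax0 + b *: ax1)).
  rewrite -ball_normE /= opprD addNKr normrN norm2_lt !mxE !eqxx /= => ar br.
  by rewrite !mulr1 !mulr0 addr0 add0r ar br.
have ss s (a : R) : 0 <= s <= 1 -> `|a| < r -> `|s * a| < r.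
  move=> /andP[s0 s1]; apply: le_lt_trans.
  by rewrite normrM ger0_norm // ler_piMl.
have d (v : E) y : ball x r y -> derivable f y v.
  by move=> /rP[Uy _ _]; exact: Ck_derivable cf Uy.
have [s|s s01] := @MVT_line _ _ f x (h 0 ord0 *: ax0).
  move=> s01; apply: d; rewrite scalerA -[s * _ *: _]addr0 -(scale0r ax1); apply: inb; first exact: ss.
  by rewrite normr0.
have bs : ball x r (x + s *: (h 0 ord0 *: ax0)).
  rewrite scalerA -[s * _ *: _]addr0 -(scale0r ax1); apply: inb; first exact: ss.
  by rewrite normr0.
rewrite (derive_scale _ (d _ _ bs)) => E1.
have bt t : 0 <= t <= 1 -> ball x r (x + h 0 ord0 *: ax0 + t *: (h 0 ord_max *: ax1)).
  by move=> t01; rewrite -addrA scalerA; apply: inb => //; exact: ss.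
have [t|t t01] := @MVT_line _ _ f (x + h 0 ord0 *: ax0) (h 0 ord_max *: ax1).
  by move=> t01; exact: d (bt _ t01).
rewrite (derive_scale _ (d _ _ (bt _ t01))) -addrA -rV2E => E2.
have [_ P0 _] := rP _ bs; have [_ _ P1] := rP _ (bt _ t01).
have -> : f (h + x) - f x = (f (x + h) - f (x + h 0 ord0 *: ax0)) + (f (x + h 0 ord0 *: ax0) - f x).
  by rewrite [h + x]addrC addrA subrK.
rewrite E2 E1 /lin2.
exact: lin_close P0 P1 (ler_mx_entry _ _ _) (ler_mx_entry _ _ _).
Qed.

Lemma Ck1_differentiable (f : E -> R) (U : set E) x : open U -> Ck 1 U f -> U x ->
  differentiable f x.
Proof.
move=> oU cf Ux; set L := lin2 ('D_ax0 f x) ('D_ax1 f x).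
have key : f \o shift x = cst (f x) + L +o_ (0 : E) id.
  apply/eqaddoP => e ep; have := Ck1_expand oU cf Ux ep.
  apply: filterS => h.
  have E : (f \o shift x - (cst (f x) + L)) h = f (h + x) - f x - L h by rewrite -addrA -opprD.
  by rewrite E.
have dE : 'd f x = L :> (E -> R).
  by apply: diff_unique => //; exact: lin2_continuous.
apply/diff_locallyP; rewrite dE; split => //; exact: lin2_continuous.
Qed.

Lemma differentiable_mx (V : normedModType R) m n (f : V -> 'M[R]_(m, n)) x :
  (forall i j, differentiable (fun y => f y i j) x) -> differentiable f x.
Proof.
move=> h.
have -> : f = \sum_(i < m) \sum_(j < n) (fun y => f y i j *: delta_mx i j).
  apply/funext => y; rewrite [LHS]matrix_sum_delta.
  by rewrite fct_sumE; apply: eq_bigr => i _; rewrite fct_sumE.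
by apply: differentiable_sum => i; apply: differentiable_sum => j; apply: differentiableZl.
Qed.

Lemma derive_lin (f : E -> R) x v : differentiable f x ->
  'D_v f x = v 0 ord0 * 'D_ax0 f x + v 0 ord_max * 'D_ax1 f x.
Proof.
by move=> df; rewrite {1}[v]rV2E !deriveE // linearD !linearZ.
Qed.

Lemma derive_comp2 (f : E -> R) (psi : E -> E) x v :
  differentiable psi x -> differentiable f (psi x) ->
  is_derive x v (fun y => f (psi y)) ('D_v psi x 0 ord0 * 'D_ax0 f (psi x) +
     'D_v psi x 0 ord_max * 'D_ax1 f (psi x)).
Proof.
move=> dp df; have dc : differentiable (f \o psi) x by exact: differentiable_comp.
apply: DeriveDef; first exact: diff_derivable.
by rewrite -derive_lin // [LHS]deriveE // diff_comp // [RHS]deriveE // deriveE.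
Qed.

Lemma derive_entry m n (V : normedModType R) (f : V -> 'M[R]_(m, n)) x v i j : derivable f x v ->
  'D_v f x i j = 'D_v (fun y => f y i j) x.
Proof. by move=> df; rewrite derive_mx // mxE. Qed.

Lemma Ck1_differentiable_mx m n (f : E -> 'M[R]_(m, n)) (U : set E) x : open U -> Ck 1 U f -> U x ->
  differentiable f x.
Proof.
move=> oU cf Ux; apply: differentiable_mx => i j.
exact: Ck1_differentiable oU (Ck_entry i j oU cf) Ux.
Qed.

Lemma Ck_comp k (U U' : set E) (f : E -> R) (psi : E -> E) : open U -> open U' ->
  (forall x, U x -> U' (psi x)) -> Ck k U psi -> Ck k U' f ->
  Ck k U (fun x => f (psi x)).
Proof.
move=> oU oU' pU; elim: k f => [|k IH] f hp hf.
  by split=> // x Ux; apply: (@continuous_comp _ _ _ psi f); [exact: Ck_cont hp _ Ux|exact: (Ck_cont hf (pU x Ux))].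
split=> [x Ux|v].
  by apply: (@continuous_comp _ _ _ psi f); [exact: Ck_cont hp _ Ux|exact: (Ck_cont hf (pU x Ux))].
have le1 (V W : normedModType R) (Z : set V) (g : V -> W) : Ck k.+1 Z g -> Ck 1 Z g.
  by elim: (k) => // j IHj /CkS.
have d x : U x -> is_derive x v (fun y => f (psi y)) ('D_v psi x 0 ord0 * 'D_ax0 f (psi x) +
     'D_v psi x 0 ord_max * 'D_ax1 f (psi x)).
  move=> Ux; apply: derive_comp2; first by apply: Ck1_differentiable_mx oU _ Ux; exact: le1.
  by apply: Ck1_differentiable oU' _ (pU _ Ux); exact: le1.
split=> [x /d[]//|].
have c i : Ck k U (fun x => 'D_v psi x 0 i).
  exact: Ck_entry oU (Ck_derive v hp).
have h := Ck_add oU (Ck_mul oU (c ord0) (IH _ (CkS hp) (Ck_derive ax0 hf)))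
  (Ck_mul oU (c ord_max) (IH _ (CkS hp) (Ck_derive ax1 hf))).
by apply: Ck_ext h => // x /d[_ ->].
Qed.

End lin2.


(** * The inverse function theorem in the plane *)

Section ift.
Context {R : realType}.
Local Notation E := 'rV[R]_2.

Lemma derive_coord (x v : E) i : 'D_v (fun y : E => y 0 i) x = v 0 i.
Proof.
have d : derivable (id : E -> E) x v by exact: derivable_id.
by rewrite -(derive_entry 0 i d) derive_id.
Qed.

Lemma Ck_id k (U : set E) : open U -> Ck k U (id : E -> E).
Proof.
move=> oU; case: k => [|k]; first by split=> // x _; exact: id.
split=> [x _|v]; first exact: id.
split=> [x _|]; first exact: derivable_id.
apply/(Ck_mx _ _ oU) => i j; apply: Ck_ext oU _ (Ck_cst k U (v i j)) => x _.
by rewrite derive_id.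
Qed.

Lemma Ck_coord i k (U : set E) : open U -> Ck k U (fun y : E => y 0 i).
Proof. by move=> oU; exact: Ck_entry oU (Ck_id k oU). Qed.

Lemma continuous_at_lt (V W : normedModType R) (f : V -> W) x :
  (forall e, 0 < e -> \forall y \near x, `|f x - f y| < e) -> {for x, continuous f}.
Proof. by move=> h; apply/cvgrPdist_lt => e ep; exact: h. Qed.

Lemma near_id_expanding (Phi : E -> E) (B : set E) :
  (forall y y', B y -> B y' -> `|(y - Phi y) - (y' - Phi y')| <= 2^-1 * `|y - y'|) ->
  forall y y', B y -> B y' -> `|y - y'| <= 2 * `|Phi y - Phi y'|.
Proof.
move=> H y y' By By'; have := H y y' By By'.
have {1}-> : y - Phi y - (y' - Phi y') = (y - y') - (Phi y - Phi y').
  by rewrite !opprB !addrA [LHS](AC 4 (1*4*3*2)).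
have := ler_normD (y - y' - (Phi y - Phi y')) (Phi y - Phi y'); rewrite subrK.
move: `|y - y'| `|Phi y - Phi y'| `|y - y' - (Phi y - Phi y')| => a b c; lra.
Qed.

Lemma near_id_continuous (Phi : E -> E) (B : set E) y : open B ->
  (forall y y', B y -> B y' -> `|(y - Phi y) - (y' - Phi y')| <= 2^-1 * `|y - y'|) ->
  B y -> {for y, continuous Phi}.
Proof.
move=> oB H By; apply: continuous_at_lt => e ep.
have nB : \forall z \near y, B z by exact: open_nbhs_nbhs.
have := nbhsx_ballx y (e / 2) (divr_gt0 ep (ltr0Sn _ _)).
apply: filterS2 nB => z Bz yz; have := H y z By Bz.
have {1}-> : y - Phi y - (z - Phi z) = (y - z) - (Phi y - Phi z).
  by rewrite !opprB !addrA [LHS](AC 4 (1*4*3*2)).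
move: yz; rewrite -ball_normE /= => yz.
have := ler_normD (Phi y - Phi z - (y - z)) (y - z); rewrite subrK [`|_ - _ - (y - z)|]distrC.
by move: `|y - z| `|Phi y - Phi z| `|y - z - (Phi y - Phi z)| yz => a b c; lra.
Qed.

(** The point [c] of a closed ball that minimizes [`|x - Phi c|] solves the
    equation: moving [c] a little by a multiple of the residual [x - Phi c] would
    otherwise decrease it. The bound [r / 8] keeps [c] inside the ball. *)
Lemma near_id_surj (Phi : E -> E) y0 r x : 0 < r ->
  (forall y y', ball y0 r y -> ball y0 r y' ->
     `|(y - Phi y) - (y' - Phi y')| <= 2^-1 * `|y - y'|) ->
  `|x - Phi y0| < r / 8 -> exists2 y, ball y0 r y & Phi y = x.
Proof.
move=> r0 H xr.
have b0 : ball y0 r y0 by exact: ballxx.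
pose B := [set y : E | `|y0 - y| <= r / 2].
have Bb y : B y -> ball y0 r y.
  by rewrite -ball_normE /B /=; move: `|y0 - y| => N; lra.
have cB : compact B.
  apply: bounded_closed_compact.
    exists (`|y0| + r); split; first exact: num_real.
    move=> M hM y By /=; have := ler_normB y0 (y0 - y); rewrite subKr.
    by move: By; rewrite /B /=; move: `|y0 - y| `|y| `|y0| hM => a b c; lra.
  have -> : B = (fun y => `|y0 - y|) @^-1` [set t | t <= r / 2] by [].
  apply: closed_comp; last exact: closed_le.
  move=> y _; apply: (@continuous_comp _ _ _ (fun y => y0 - y)); last exact: norm_continuous.
  by apply: continuousB; [exact: cst_continuous|exact: id].
have cPhi y : ball y0 r y -> {for y, continuous Phi}.
  by move=> By; apply: (near_id_continuous _ H By); exact: ball_open.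
have B0 : B !=set0 by exists y0; rewrite /B /= subrr normr0 ltW // divr_gt0.
have [|c /set_mem Bc cmin] := @EVT_min_rV R 2 (fun y => `|x - Phi y|) B B0 cB.
  apply: continuous_in_subspaceT => y /set_mem By.
  apply: (@continuous_comp _ _ _ (fun y => x - Phi y)); last exact: norm_continuous.
  by apply: continuousB; [exact: cst_continuous|exact: cPhi (Bb _ By)].
exists c; first exact: Bb.
apply/eqP; apply: contraT => ne; set w := x - Phi c.
have w0 : 0 < `|w| by rewrite normr_gt0 subr_eq0 eq_sym.
have cw : `|w| <= `|x - Phi y0| by apply: cmin; rewrite inE /B /= subrr normr0 ltW // divr_gt0.
have cint : `|y0 - c| < r / 2.
  have := near_id_expanding H b0 (Bb _ Bc).
  have : `|Phi y0 - Phi c| <= `|x - Phi y0| + `|w|.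
    (* Distances are at most twice those of the images under [Phi], so [c] is at distance
       less than [r / 2] from [y0]. *)
    have -> : Phi y0 - Phi c = - (x - Phi y0) + w by rewrite opprB addrA subrK.
    by rewrite (le_trans (ler_normD _ _))// normrN.
  by move: `|y0 - c| `|Phi y0 - Phi c| `|x - Phi y0| `|w| xr cw => a b d e; lra.
(* The step [s] keeps the competitor [c + s *: w] in the closed ball. *)
pose s := Order.min 1 ((r / 2 - `|y0 - c|) / `|w|).
have s0 : 0 < s by rewrite lt_min ltr01 divr_gt0 // subr_gt0.
have s1 : s <= 1 by rewrite ge_min lexx.
have sw : s * `|w| <= r / 2 - `|y0 - c| by rewrite -ler_pdivlMr // ge_min lexx orbT.
have Bcs : B (c + s *: w).
  rewrite /B /= opprD addrA (le_trans (ler_normD _ _))// normrN normrZ (gtr0_norm s0).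
  by move: sw; move: (s * _) `|y0 - c| => a b; lra.
have := cmin (c + s *: w); rewrite inE => /(_ Bcs).
have hh := H _ _ (Bb _ Bcs) (Bb _ Bc).
have e1 : x - Phi (c + s *: w) = (1 - s) *: w + (c + s *: w - Phi (c + s *: w) - (c - Phi c)).
  rewrite scalerBl scale1r; set u := s *: w; set p := Phi _.
  by apply/rowP => i; rewrite /w !mxE; ring.
rewrite e1 => h1.
have : `|w| <= (1 - s) * `|w| + 2^-1 * (s * `|w|).
  apply: le_trans h1 _; apply: le_trans (ler_normD _ _) _.
  rewrite normrZ ger0_norm ?subr_ge0 // lerD2l; apply: le_trans hh _.
  by rewrite [c + _]addrC addrK normrZ (gtr0_norm s0).
have : 0 < s * `|w| by rewrite mulr_gt0.
rewrite mulrBl mul1r; move: (s * `|w|) `|w| => a b; lra.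
Qed.

Lemma Ck1_near_id (Phi : E -> E) y0 : Ck 1 setT Phi ->
  'D_ax0 Phi y0 = ax0 -> 'D_ax1 Phi y0 = ax1 ->
  exists2 r, 0 < r & forall y y', ball y0 r y -> ball y0 r y' ->
     `|(y - Phi y) - (y' - Phi y')| <= 2^-1 * `|y - y'|.
Proof.
move=> cP d0 d1.
pose h (i : 'I_2) (y : E) := y 0 i - Phi y 0 i.
have ci i : Ck 1 setT (h i).
  by apply: Ck_sub; [exact: openT|exact: Ck_coord openT|exact: Ck_entry openT cP].
have dh i v : derivable (fun y => Phi y 0 i) y0 v.
  exact: Ck_derivable (Ck_entry 0 i openT cP) I.
have Dh i v : 'D_v Phi y0 = v -> 'D_v (h i) y0 = 0.
  move=> e; rewrite deriveB; [|exact: Ck_derivable (Ck_coord i 1 openT) I|exact: dh].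
  rewrite derive_coord -derive_entry ?e ?subrr //.
  exact: Ck_derivable cP I.
have near i : \forall y \near y0, `|'D_ax0 (h i) y| < 4^-1 /\ `|'D_ax1 (h i) y| < 4^-1.
  have q0 : 0 < (4^-1 : R) by rewrite invr_gt0.
  have c0 := Ck_cont (Ck_derive ax0 (ci i)) (I : setT y0).
  have c1 := Ck_cont (Ck_derive ax1 (ci i)) (I : setT y0).
  apply: filterS (filterI (cont_near_lt c0 q0) (cont_near_lt c1 q0)) => y [] /=; rewrite !Dh // !sub0r !normrN => A B; split; [exact: A|exact: B].
have /nbhs_ballP[r /= r0 rP] : \forall y \near y0, forall i,
    `|'D_ax0 (h i) y| < 4^-1 /\ `|'D_ax1 (h i) y| < 4^-1.
  by apply: filterS (filterI (near ord0) (near ord_max)) => y [a b] i; case: (ord2E i) => ->.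
exists r => // y y' By By'.
apply: mx_norm_le => [|i j]; first by rewrite mulr_ge0.
rewrite (ord1 i) !mxE -/(h j y) -/(h j y').
have [s s01|s s01] := @MVT_line _ _ (h j) y' (y - y').
  exact: Ck_derivable (ci j) I.
rewrite [y' + (y - y')]addrC subrK => ->.
have [] := rP _ (ball_segment s01 By' By) j.
rewrite (derive_lin (y - y')); last exact: Ck1_differentiable openT (ci j) I.
have := ler_mx_entry (y - y') 0 ord0; have := ler_mx_entry (y - y') 0 ord_max.
move: ('D_ax0 _ _) ('D_ax1 _ _) ((y - y') 0 ord0) ((y - y') 0 ord_max) `|y - y'| => a b c d N dN cN aq bq.
apply: le_trans (ler_normD _ _) _; rewrite !normrM.
have : `|c| * `|a| <= N * 4^-1 by apply: ler_pM => //; exact: ltW.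
have : `|d| * `|b| <= N * 4^-1 by apply: ler_pM => //; exact: ltW.
move: (`|c| * _) (`|d| * _) => u v; lra.
Qed.

(** Composed with the inverse of its differential at [y0], [phi] becomes a map
    close to the identity. *)
Lemma inverse_function (phi : E -> E) y0 : Ck 1 setT phi ->
  jacobian phi y0 \in unitmx ->
  exists r d c, [/\ 0 < r, 0 < d, 0 < c,
   forall y y', ball y0 r y -> ball y0 r y' -> `|y - y'| <= c * `|phi y - phi y'| &
   forall x, ball (phi y0) d x -> exists2 y, ball y0 r y & phi y = x].
Proof.
move=> cphi uJ; set J := jacobian phi y0 in uJ.
pose Phi y := phi y *m invmx J.
have cP : Ck 1 setT Phi.
  apply/(Ck_mx _ _ openT) => i j.
  apply: Ck_ext openT _ (Ck_sum openT (fun k => Ck_mul openT (Ck_entry i k openT cphi) (Ck_cst 1 setT (invmx J k j)))).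
  by move=> y _; rewrite mxE.
have dphi : differentiable phi y0 by exact: Ck1_differentiable_mx openT cphi I.
have DP v : 'D_v Phi y0 = v.
  apply/rowP => j; rewrite derive_entry; last exact: Ck_derivable cP I.
  have -> : (fun y => Phi y 0 j) = (\sum_(k < 2) (fun y => invmx J k j *: phi y 0 k)).
    by apply/funext => y; rewrite fct_sumE mxE; apply: eq_bigr => k _; rewrite mulrC.
  rewrite derive_sum; last first.
    by move=> k; apply: derivableZ; exact: Ck_derivable (Ck_entry 0 k openT cphi) I.
  have -> : v 0 j = (v *m J *m invmx J) 0 j by rewrite mulmxK.
  rewrite mxE; apply: eq_bigr => k _.
  rewrite deriveZ; last exact: Ck_derivable (Ck_entry 0 k openT cphi) I.
  rewrite -derive_entry; last exact: Ck_derivable cphi I.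
  by rewrite deriveEjacobian // mulrC.
have [r r0 H] := Ck1_near_id cP (DP ax0) (DP ax1).
pose N := 2 * `|invmx J|.
have PN y y' : `|Phi y - Phi y'| <= (N + 1) * `|phi y - phi y'|.
  rewrite /Phi -mulmxBl (le_trans (mx_norm_mul _ _))//.
  by rewrite mulrAC -/N mulrDl mul1r lerDl.
have N0 : 0 < N + 1 by rewrite ltr_wpDl // mulr_ge0.
exists r, (r / 8 / (N + 1)), (2 * (N + 1)); split => //.
- by rewrite !divr_gt0.
- by rewrite mulr_gt0.
- move=> y y' By By'; apply: le_trans (near_id_expanding H By By') _.
  by rewrite -mulrA ler_pM2l.
- move=> x; rewrite -ball_normE /= distrC ltr_pdivlMr // => xd.
  have [|y By e] := @near_id_surj Phi y0 r (x *m invmx J) r0 H.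
    apply: le_lt_trans xd; rewrite /Phi -mulmxBl (le_trans (mx_norm_mul _ _))//.
    by rewrite mulrAC -/N [leRHS]mulrC mulrDl mul1r lerDl.
  exists y; first by rewrite -ball_normE in By.
  by move: e => /(congr1 (mulmx^~ J)); rewrite /Phi !mulmxKV.
Qed.

Lemma differentiable_near (V W : normedModType R) (f : V -> W) x e :
  differentiable f x -> 0 < e ->
  \forall k \near (0 : V), `|f (k + x) - f x - 'd f x k| <= e * `|k|.
Proof.
move=> df ep; have /eqaddoP/(_ e ep) := diff_locally df.
apply: filterS => k.
have E1 : (f \o shift x - (cst (f x) + 'd f x)) k = f (k + x) - f x - 'd f x k by rewrite -addrA -opprD.
by rewrite E1.
Qed.

Lemma scaled_residual (h : R) (v k : E) (J : 'M[R]_2) : J \in unitmx -> h != 0 ->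
  v *m invmx J - h^-1 *: k = h^-1 *: ((h *: v - k *m J) *m invmx J).
Proof.
by move=> uJ h0; rewrite mulmxBl mulmxK // scalerBr -scalemxAl scalerA mulVf // scale1r.
Qed.

(** The Lipschitz bound of [inverse_function] makes the increment [k] of [psi]
    comparable to [h], so that the residual of the expansion of [phi] is also small
    compared to [h]. *)
Lemma inverse_derivable (phi psi : E -> E) x v : Ck 1 setT phi ->
  jacobian phi (psi x) \in unitmx -> {for x, continuous psi} ->
  (forall x, phi (psi x) = x) ->
  is_derive x v psi (v *m invmx (jacobian phi (psi x))).
Proof.
move=> cphi uJ cpsi phiK; set y := psi x; set J := jacobian phi y in uJ *.
have [r [d [c [r0 d0 c0 lip _]]]] := inverse_function cphi uJ.
have dphi : differentiable phi y by exact: Ck1_differentiable_mx openT cphi I.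
suff H : h^-1 *: ((psi \o shift x) (h *: v) - psi x) @[h --> 0^'] --> v *m invmx J.
  by apply: DeriveDef; [apply: cvgP H|exact: cvg_lim H].
apply/cvgrPdist_lt => e ep; set M := 2 * `|invmx J| * c * `|v|.
have M0 : 0 <= M by rewrite !mulr_ge0 // ltW.
have ep' : 0 < e / (M + 1) by rewrite divr_gt0 // ltr_wpDl.
have /nbhs_ballP[s /= s0 sP] := differentiable_near dphi ep'.
have rs0 : 0 < Order.min r s by rewrite lt_min r0 s0.
have /nbhs_ballP[t /= t0 tP] := cont_near_lt cpsi rs0.
have v0 : 0 < `|v| + 1 by rewrite ltr_wpDl.
have near0 : \forall h \near (0 : R)^', h != 0 /\ `|h| * (`|v| + 1) < t.
  apply: filterI; first exact: (@nbhs_dnbhs_neq _ (0 : R)).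
  have : \forall h \near (0 : R), `|h| * (`|v| + 1) < t.
    apply: filterS (near0_norm_lt _ (divr_gt0 t0 v0)) => h.
    by rewrite ltr_pdivlMr.
  exact: nbhs_dnbhs.
apply: filterS near0 => h [h0 ht] /=; set k := psi (h *: v + x) - y.
have xh : ball x t (h *: v + x).
  rewrite -ball_normE /= opprD addrCA subrr addr0 normrN normrZ.
  by apply: le_lt_trans ht; rewrite ler_wpM2l // lerDl.
have := tP _ xh; rewrite /= -/y distrC -/k lt_min => /andP[kr ks].
have kpsi : k + y = psi (h *: v + x) by rewrite subrK.
have kb : `|k| <= c * (`|h| * `|v|).
  have byr : ball y r (k + y) by rewrite -ball_normE /= opprD addrCA subrr addr0 normrN.
  have := lip y (k + y) (ballxx _ r0) byr.
  rewrite kpsi !phiK opprD addrCA subrr addr0 normrN normrZ.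
  by rewrite -/y -normrN opprB -/k.
have kq : `|phi (k + y) - phi y - 'd phi y k| <= e / (M + 1) * `|k|.
  by apply: sP; rewrite -ball_normE /= sub0r normrN.
rewrite kpsi !phiK addrK -deriveE // deriveEjacobian // -/J in kq.
have -> : v *m invmx J - h^-1 *: k = h^-1 *: ((h *: v - k *m J) *m invmx J).
  exact: scaled_residual.
rewrite normrZ normfV.
have hp : 0 < `|h| by rewrite normr_gt0.
rewrite -ltr_pdivlMl ?invr_gt0 // invrK.
apply: le_lt_trans (mx_norm_mul _ _) _.
apply: (@le_lt_trans _ _ (e / (M + 1) * (M * `|h|))).
  rewrite mulrAC; apply: (@le_trans _ _ (2 * `|invmx J| * (e / (M + 1) * (c * (`|h| * `|v|))))).
    by rewrite ler_wpM2l ?mulr_ge0 //; apply: le_trans kq _; rewrite ler_wpM2l // ltW.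
  by rewrite /M le_eqVlt; apply/orP; left; apply/eqP; ring.
rewrite mulrA [ltRHS]mulrC ltr_pM2r // mulrAC ltr_pdivrMr ?ltr_wpDl //.
by rewrite ltr_pM2l // ltrDl.
Qed.

Lemma sum2E (V : nmodType) (F : 'I_2 -> V) : \sum_(i < 2) F i = F ord0 + F ord_max.
Proof. by rewrite big_ord_recr big_ord1; congr (F _ + F _); exact: val_inj. Qed.

Lemma ord01 : (ord0 == ord_max :> 'I_2) = false. Proof. by []. Qed.
Lemma ord10 : (ord_max == ord0 :> 'I_2) = false. Proof. by []. Qed.

Lemma det22 (M : 'M[R]_2) : \det M = M ord0 ord0 * M ord_max ord_max - M ord0 ord_max * M ord_max ord0.
Proof.
rewrite (expand_det_row _ ord0) sum2E /cofactor !det_mx11 !mxE /= expr0 expr1 !mul1r mulN1r mulrN.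
have l (i : 'I_2) (j : 'I_1) : lift i j = if i == ord0 then ord_max else ord0.
  by rewrite (ord1 j); case: (ord2E i) => ->; exact: val_inj.
by rewrite !l !eqxx ord10.
Qed.

Definition adj2 (M : 'M[R]_2) : 'M[R]_2 := \matrix_(i, j)
  (if i == ord0 then (if j == ord0 then M ord_max ord_max else - M ord0 ord_max)
   else (if j == ord0 then - M ord_max ord0 else M ord0 ord0)).

Lemma adj2E (M : 'M[R]_2) i j : adj2 M i j =
  (if i == ord0 then (if j == ord0 then M ord_max ord_max else - M ord0 ord_max)
   else (if j == ord0 then - M ord_max ord0 else M ord0 ord0)).
Proof. by rewrite mxE. Qed.

Lemma invmx22 (M : 'M[R]_2) : \det M != 0 -> invmx M = (\det M)^-1 *: adj2 M.
Proof.
move=> d0; have uM : M \in unitmx by rewrite unitmxE unitfE.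
have h : M *m adj2 M = (\det M)%:M.
  apply/matrixP => i j; rewrite !mxE sum2E det22 !mxE.
  by case: (ord2E i) (ord2E j) => -> [] ->; rewrite ?eqxx ?ord01 ?ord10 /=; ring.
have -> : adj2 M = invmx M *m (\det M)%:M by rewrite -h mulKmx.
by rewrite mul_mx_scalar scalerA mulVf // scale1r.
Qed.

Lemma Ck_invmx k (U : set E) (M : E -> 'M[R]_2) i j : open U -> (forall x, U x -> \det (M x) != 0) ->
  Ck k U M -> Ck k U (fun x => invmx (M x) i j).
Proof.
move=> oU dM cM; have cE a b := Ck_entry a b oU cM.
have cd : Ck k U (fun x => (\det (M x))^-1).
  apply: (Ck_inv oU dM).
  apply: Ck_ext oU _ (Ck_sub oU (Ck_mul oU (cE ord0 ord0) (cE ord_max ord_max))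
    (Ck_mul oU (cE ord0 ord_max) (cE ord_max ord0))) => x _.
  by rewrite det22.
have cadj : Ck k U (fun x => adj2 (M x) i j).
  case: (ord2E i) (ord2E j) => -> [] ->;
    [have h := cE ord_max ord_max|have h := Ck_opp oU (cE ord0 ord_max)|
     have h := Ck_opp oU (cE ord_max ord0)|have h := cE ord0 ord0];
  by apply: Ck_ext oU _ h => x _; rewrite adj2E ?eqxx ?ord10.
by apply: Ck_ext oU _ (Ck_mul oU cd cadj) => x Ux; rewrite invmx22 ?dM // [RHS]mxE.
Qed.

(** The derivative [v *m invmx (jacobian phi (psi x))] of [psi] involves [psi]
    itself, hence is as regular as [psi]: regularity improves one order at a time. *)
Lemma smooth_inverse (phi psi : E -> E) : smooth_on setT phi ->
  (forall y, jacobian phi y \in unitmx) -> continuous psi ->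
  (forall x, phi (psi x) = x) -> smooth_on setT psi.
Proof.
move=> sphi uJ cpsi phiK.
have d x v := inverse_derivable v (sphi 1%N) (uJ (psi x)) (cpsi x) phiK.
elim=> [|k IH]; first by split=> // x _; exact: cpsi.
split=> [x _|v]; first exact: cpsi.
split=> [x _|]; first by have [] := d x v.
have -> : 'D_v psi = (fun x => v *m invmx (jacobian phi (psi x))).
  by apply/funext => x; have [_] := d x v.
have cJ i j : Ck k setT (fun x => jacobian phi (psi x) i j).
  pose a : E := if i == ord0 then ax0 else ax1.
  have aE : a = delta_mx 0 i.
    by rewrite /a; case: (ord2E i) => ->; rewrite ?eqxx ?ord10.
  apply: Ck_ext openT _ (Ck_comp openT openT _ IH (Ck_entry 0 j openT (Ck_derive a (sphi k.+1)))) => // x _.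
  rewrite deriveEjacobian; last exact: Ck1_differentiable_mx openT (sphi 1%N) I.
  by rewrite aE -rowE mxE.
have dJ x : setT x -> \det (jacobian phi (psi x)) != 0 by move=> _; rewrite -unitfE -unitmxE.
have cJm : Ck k setT (fun x => jacobian phi (psi x)) by apply/(Ck_mx _ _ openT).
apply/(Ck_mx _ _ openT) => i j.
apply: Ck_ext openT _ (Ck_sum openT (fun l => Ck_mul openT (Ck_cst k setT (v i l)) (Ck_invmx l j openT dJ cJm))) => x _.
by rewrite mxE.
Qed.

End ift.


(** * Lifting through coverings *)

Lemma continuous_at_near {R : realType} (V W : normedModType R) (f g : V -> W) x :
  {near x, f =1 g} -> {for x, continuous f} -> {for x, continuous g}.
Proof.
move=> nE c; change (g @ x --> g x); rewrite -(nbhs_singleton nE).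
apply: cvg_trans c; exact: near_eq_cvg nE.
Qed.

Lemma continuous_at_preim (T U : topologicalType) (f : T -> U) x B :
  {for x, continuous f} -> nbhs (f x) B -> \forall z \near x, B (f z).
Proof. by move=> c nB; exact: c. Qed.

Section connectedness.
Context {R : realType}.

Lemma connected_propagate (T : topologicalType) (A : set T) (P : T -> Prop) a b :
  connected A ->
  (forall x, A x -> P x -> \forall y \near x, A y -> P y) ->
  (forall x, A x -> ~ P x -> \forall y \near x, A y -> ~ P y) ->
  A a -> P a -> A b -> P b.
Proof.
move=> cA oP oN Aa Pa Ab.
have e : [set x | A x /\ P x] = A.
  apply: cA.
  - by exists a.
  - exists (interior [set x | A x -> P x]); first exact: open_interior.
    apply/seteqP; split=> [x /= [Ax Px]|x /= [Ax /interior_subset]]; first by split=> //; exact: oP.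
    by move=> /= h; split=> //; exact: h.
  - exists (~` interior [set x | A x -> ~ P x]); first by apply: open_closedC; exact: open_interior.
    apply/seteqP; split=> [x /= [Ax Px]|x /= [Ax nx]].
      by split=> // /interior_subset /(_ Ax).
    split=> //; apply: contrapT => nPx; apply: nx; exact: oN.
by have [] : [set x | A x /\ P x] b by rewrite e.
Qed.

Definition segment_closed (V : normedModType R) (W : set V) :=
  forall x y s, W x -> W y -> 0 <= s <= 1 -> W (x + s *: (y - x)).

Lemma segment_closedI (V : normedModType R) (W W' : set V) :
  segment_closed W -> segment_closed W' -> segment_closed (W `&` W').
Proof. by move=> c c' x y s [a b] [a' b'] s01; split; [exact: c|exact: c']. Qed.

Lemma segment_closed_ball (V : normedModType R) (x : V) r : segment_closed (ball x r).
Proof. by move=> y z s yb zb s01; exact: ball_segment. Qed.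

Lemma convex_propagate (V : normedModType R) (W : set V) (P : V -> Prop) a b :
  segment_closed W ->
  (forall x, W x -> P x -> \forall y \near x, W y -> P y) ->
  (forall x, W x -> ~ P x -> \forall y \near x, W y -> ~ P y) ->
  W a -> P a -> W b -> P b.
Proof.
move=> cW oP oN Wa Pa Wb.
pose g (t : R) := a + t *: (b - a).
have cg t : {for t, continuous g}.
  apply: (@continuousD _ _ _ (fun=> a) (fun t : R => t *: (b - a))); first exact: cst_continuous.
  exact: scalel_continuous.
have Wg t : t \in `[0, 1] -> W (g t) by rewrite in_itv /= => t01; exact: cW.
have -> : b = g 1 by rewrite /g scale1r addrC subrK.
have g0 : g 0 = a by rewrite /g scale0r addr0.
apply: (@connected_propagate R `[0, 1]%classic (fun t => P (g t)) 0 1).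
- exact: segment_connected.
- move=> t /= t01 Pt; have := continuous_at_preim (cg t) (oP _ (Wg _ t01) Pt).
  by apply: filterS => s h s01; apply: h; exact: Wg.
- move=> t /= t01 Pt; have := continuous_at_preim (cg t) (oN _ (Wg _ t01) Pt).
  by apply: filterS => s h s01; apply: h; exact: Wg.
- by rewrite /= in_itv /= lexx ler01.
- by rewrite g0.
- by rewrite /= in_itv /= lexx ler01.
Qed.

End connectedness.

Section lifting.
Context {R : realType} {n : nat} {Y : normedModType R}.
Local Notation E := 'rV[R]_n.
Variable Psi : E -> set Y.

(** The total space of a covering is encoded by its fibers [Psi x], seen as
    subsets of a common space [Y]; a selection is a continuous section over [W]. *)
Definition selection (W : set E) (s : E -> Y) :=
  forall x, W x -> {for x, continuous s} /\ Psi x (s x).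

(** Makes the set where two sections agree open, hence lifts unique. *)
Definition discrete_fibers := forall x y, Psi x y -> exists2 B, nbhs y B &
  \forall x' \near x, forall y1 y2, B y1 -> B y2 -> Psi x' y1 -> Psi x' y2 -> y1 = y2.

(** The radius [d] is the same for all points [y] of the fibers, so that a
    section can be continued by a definite amount. *)
Definition evenly_covered := forall x0, exists2 d, 0 < d &
  forall x y, ball x0 d x -> Psi x y -> exists2 s, selection (ball x0 d) s & s x = y.

Hypotheses (Hd : discrete_fibers) (He : evenly_covered).

Lemma selection_subset (W W' : set E) s : W' `<=` W -> selection W s -> selection W' s.
Proof. by move=> WW h x /WW /h. Qed.

Lemma selection_unique (W : set E) s1 s2 a b : segment_closed W ->
  selection W s1 -> selection W s2 -> W a -> s1 a = s2 a -> W b -> s1 b = s2 b.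
Proof.
move=> cW h1 h2 Wa e Wb; apply: (@convex_propagate _ _ W (fun x => s1 x = s2 x) a b cW) => // x Wx.
- move=> ex; have [c1 p1] := h1 x Wx; have [c2 p2] := h2 x Wx.
  have [B nB hB] := Hd p1; have nB2 : nbhs (s2 x) B by rewrite -ex.
  apply: filterS (filterI hB (filterI (continuous_at_preim c1 nB) (continuous_at_preim c2 nB2))) => z [k [B1 B2]] Wz.
  by apply: k => //; [have [] := h1 z Wz|have [] := h2 z Wz].
- move=> /eqP ne; have [c1 _] := h1 x Wx; have [c2 _] := h2 x Wx.
  have ep : 0 < `|s1 x - s2 x| / 2 by rewrite divr_gt0 // normr_gt0 subr_eq0.
  apply: filterS (filterI (cont_near_lt c1 ep) (cont_near_lt c2 ep)) => z [k1 k2] _ ez.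
  have : `|s1 x - s2 x| < `|s1 x - s2 x| / 2 + `|s1 x - s2 x| / 2; last by rewrite -splitr ltxx.
  have {1}-> : s1 x - s2 x = (s1 x - s1 z) - (s2 x - s2 z) by rewrite ez opprB addrA subrK.
  by rewrite (le_lt_trans (ler_normD _ _))// normrN ltrD.
Qed.

(** Compactness of the closed ball makes the radius of [evenly_covered] uniform. *)
Lemma uniform_selection (b : E) (M : R) : exists2 d, 0 < d & forall x y, `|x - b| <= M -> Psi x y ->
  exists2 s, selection (ball x d) s & s x = y.
Proof.
pose K := [set x : E | `|x - b| <= M].
have cK : compact K.
  apply: bounded_closed_compact.
    exists (`|b| + M); split; first exact: num_real.
    move=> N hN y By /=; have := ler_normD (y - b) b; rewrite subrK.
    by move: By; rewrite /K /=; move: `|y - b| `|y| `|b| hN => a b' c; lra.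
  have -> : K = (fun y : E => `|y - b|) @^-1` [set t | t <= M] by [].
  apply: closed_comp; last exact: closed_le.
  move=> y _; apply: (@continuous_comp _ _ _ (fun y : E => y - b)); last exact: norm_continuous.
  by apply: continuousB; [exact: id|exact: cst_continuous].
have /compact_near_coveringP nK := cK.
have := nK R (nbhs (0 : R)^'+) (fun d x => forall y, Psi x y -> exists2 s, selection (ball x d) s & s x = y) _ _.
case.
  move=> x0 _; have [d d0 hd] := He x0.
  have d2 : 0 < d / 2 by rewrite divr_gt0.
  exists (ball x0 (d / 2), [set r | r < d / 2]) => /=.
    by split; [exact: nbhsx_ballx|exact: nbhs_right_lt].
  move=> [x r] /= [bx rd] y Pxy; have [|s hs sx] := hd x y _ Pxy.
    by apply: le_ball bx; rewrite ler_pdivrMr // ler_pMr // ler1n.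
  exists s => //; apply: selection_subset hs => z bz.
  rewrite [d]splitr; apply: ball_triangle bx _.
  by apply: le_ball bz; exact: ltW.
move=> d /= d0 h.
exists (d / 2); first by rewrite divr_gt0.
move=> x y xM; apply: h => //=; last by rewrite divr_gt0.
by rewrite /ball /= sub0r normrN gtr0_norm ?divr_gt0 // ltr_pdivrMr // ltr_pMr // ltr1n.
Qed.

Section grow.
Variables (b : E) (y0 : Y) (M d : R).
Hypotheses (M0 : 0 <= M) (d0 : 0 < d).
Hypothesis unif : forall x y, `|x - b| <= M -> Psi x y ->
  exists2 s, selection (ball x d) s & s x = y.

(** The homothety [c] sends each point [x] of the larger ball to a point of the
    smaller one at distance less than [d / 4]. The extension at [x] is the value at [x]
    of the local section through [s (c x)]; uniqueness makes these sections agree. *)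
Lemma grow_selection r s : 0 < r -> r <= M -> selection (ball b r) s -> s b = y0 ->
  exists2 s', selection (ball b (r + d / 4)) s' & s' b = y0.
Proof.
move=> r0 rM hs sb.
have f_ex z : exists f, ball b r z -> selection (ball z d) f /\ f z = s z.
  have [bz|nbz] := pselect (ball b r z); last by exists (fun=> y0).
  have [_ Pz] := hs z bz.
  have [|f hf fz] := unif _ Pz; last by exists f.
  by move: bz; rewrite -ball_normE /= distrC => /ltW h; exact: le_trans rM.
have [f hf] : exists f : E -> E -> Y, forall z, ball b r z -> selection (ball z d) (f z) /\ f z z = s z.
  by exists (fun z => projT1 (cid (f_ex z))) => z; case: (cid (f_ex z)).
have q0 : 0 < r + d / 4 by rewrite addr_gt0 // divr_gt0.
pose k := r / (r + d / 4).
have k0 : 0 < k by rewrite divr_gt0.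
have k1 : k < 1 by rewrite ltr_pdivrMr // mul1r ltrDl divr_gt0.
pose c (x : E) := b + k *: (x - b).
have bc x : ball b (r + d / 4) x -> ball b r (c x).
  rewrite -!ball_normE /= /c opprD addNKr normrN normrZ (gtr0_norm k0) distrC => h.
  by rewrite /k mulrAC ltr_pdivrMr // ltr_pM2l.
have xc x : ball b (r + d / 4) x -> `|x - c x| < d / 4.
  rewrite -ball_normE /= distrC => h.
  have -> : x - c x = (1 - k) *: (x - b) by rewrite /c opprD addrA scalerBl scale1r.
  rewrite normrZ gtr0_norm ?subr_gt0 //.
  have -> : 1 - k = (d / 4) / (r + d / 4).
    by rewrite /k -{1}(divff (lt0r_neq0 q0)) -mulrBl [r + _]addrC addrK.
  by rewrite mulrAC ltr_pdivrMr // ltr_pM2l // divr_gt0.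
have cc x x' : `|c x - c x'| <= `|x - x'|.
  have -> : c x - c x' = k *: (x - x').
    by rewrite /c opprD addrACA subrr add0r -scalerBr opprB addrA subrK.
  by rewrite normrZ (gtr0_norm k0) ler_piMl // ltW.
have d4 : 0 < d / 4 by rewrite divr_gt0.
exists (fun x => f (c x) x); last first.
  have cb : c b = b by rewrite /c subrr scaler0 addr0.
  by rewrite cb; have [_ ->] := hf b (ballxx _ r0).
move=> x bx; have [hx fx] := hf _ (bc _ bx).
have bxx : ball (c x) d x.
  rewrite -ball_normE /= distrC; apply: lt_le_trans (xc _ bx) _.
  by rewrite ler_pdivrMr // ler_pMr // ler1n.
split; last by have [] := hx x bxx.
have [ctsx _] := hx x bxx.
apply: continuous_at_near ctsx.
have nb : \forall z \near x, ball b (r + d / 4) z by apply: open_nbhs_nbhs; split => //; exact: ball_open.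
apply: filterS (filterI nb (nbhsx_ballx x _ d4)) => z [bz xz].
have [hz fz] := hf _ (bc _ bz).
have czx : ball (c x) d (c z).
  rewrite -ball_normE /=; apply: le_lt_trans (cc _ _) _.
  move: xz; rewrite -ball_normE /= => xz; apply: lt_le_trans xz _.
  by rewrite ler_pdivrMr // ler_pMr // ler1n.
have e1 : f (c x) (c z) = f (c z) (c z).
  rewrite fz; apply: (@selection_unique (ball (c x) d `&` ball b r) _ _ (c x)) => //.
  - by apply: segment_closedI; exact: segment_closed_ball.
  - by apply: selection_subset hx => w [].
  - by apply: selection_subset hs => w [].
  - by split; [exact: ballxx|exact: bc].
  - by split => //; exact: bc.
apply: (@selection_unique (ball (c x) d `&` ball (c z) d) _ _ (c z)) => //.
- by apply: segment_closedI; exact: segment_closed_ball.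
- by apply: selection_subset hx => w [].
- by apply: selection_subset hz => w [].
- by split => //; exact: ballxx.
- split.
    move: xz (xc _ bx); rewrite -!ball_normE /= => xz xcx.
    have -> : c x - z = (x - z) - (x - c x) by rewrite opprB [RHS]addrC addrA subrK.
    rewrite (le_lt_trans (ler_normD _ _))// normrN.
    by move: xz xcx d0; move: `|x - z| `|x - c x| => p q; lra.
  move: (xc _ bz); rewrite -ball_normE /= distrC => h; apply: lt_le_trans h _.
  by rewrite ler_pdivrMr // ler_pMr // ler1n.
Qed.

Lemma selection_on_ball : Psi b y0 -> exists2 s, selection (ball b M) s & s b = y0.
Proof.
move=> Pb.
have H m : m%:R * (d / 4) <= M -> exists2 s, selection (ball b (m.+1%:R * (d / 4))) s & s b = y0.
  have d4 : 0 < d / 4 by rewrite divr_gt0.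
  elim: m => [_|m IH hm].
    have [|s hs sb] := unif _ Pb; first by rewrite subrr normr0.
    exists s => //; apply: selection_subset hs; apply: le_ball.
    by rewrite mul1r ler_pdivrMr // ler_pMr // ler1n.
  have [|s hs sb] := IH.
    by apply: le_trans hm; rewrite ler_wpM2r ?ler_nat // ltW.
  have [||s' hs' sb'] := grow_selection _ _ hs sb; [by rewrite mulr_gt0|by []|].
  by exists s' => //; rewrite -[m.+2]addn1 natrD mulrDl mul1r.
have d4 : 0 < d / 4 by rewrite divr_gt0.
pose m := Num.truncn (M / (d / 4)).
have /andP[m1 m2] : m%:R <= M / (d / 4) < m.+1%:R.
  by apply: truncn_itv; rewrite divr_ge0 // ltW.
have [|s hs sb] := H m; first by rewrite -ler_pdivlMr.
exists s => //; apply: selection_subset hs; apply: le_ball.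
by rewrite -ler_pdivrMr // ltW.
Qed.

End grow.

(** Sections over the balls of integral radius, which agree by uniqueness,
    exhaust the space. *)
Theorem global_selection b y0 : Psi b y0 -> exists2 s, selection setT s & s b = y0.
Proof.
move=> Pb.
have ex (N : nat) : exists s, selection (ball b N%:R) s /\ s b = y0.
  have [d d0 hd] := uniform_selection b N%:R.
  by have [//|s hs sb] := selection_on_ball _ d0 hd Pb; exists s.
have [s hs] : exists s : nat -> E -> Y, forall N, selection (ball b N%:R) (s N) /\ s N b = y0.
  by exists (fun N => projT1 (cid (ex N))) => N; case: (cid (ex N)).
pose N (x : E) := (Num.truncn `|x - b|).+1.
have bN x : ball b (N x)%:R x.
  rewrite -ball_normE /= distrC.
  by have /andP[] := truncn_itv (normr_ge0 (x - b)).
have b0 m x : ball b m x -> 0 < m.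
  by rewrite -ball_normE /=; exact: le_lt_trans.
have agree m m' x : ball b m%:R x -> ball b m'%:R x -> s m x = s m' x.
  move=> h h'; apply: (@selection_unique (ball b m%:R `&` ball b m'%:R) _ _ b) => //.
  - by apply: segment_closedI; exact: segment_closed_ball.
  - by apply: selection_subset (hs m).1 => w [].
  - by apply: selection_subset (hs m').1 => w [].
  - by split; apply: ballxx; [exact: b0 h|exact: b0 h'].
  - by rewrite (hs m).2 (hs m').2.
exists (fun x => s (N x) x); last exact: (hs _).2.
move=> x _; have [cx Px] := (hs (N x)).1 x (bN x).
split => //; apply: continuous_at_near cx.
have nb : \forall z \near x, ball b (N x)%:R z by apply: open_nbhs_nbhs; split => //; exact: ball_open.
by apply: filterS nb => z bz; apply: agree.
Qed.

End lifting.


(** * Minkowski space and its isometries *)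

Section minkowski.
Context {R : realType}.
Local Notation E := 'rV[R]_2.
Local Notation M3 := 'rV[R]_3.

Definition i1 : 'I_3 := lift ord0 ord0.

Lemma ord3E (i : 'I_3) : [\/ i = ord0, i = i1 | i = ord_max].
Proof.
by case: i => -[|[|[|//]]] ?; [constructor 1|constructor 2|constructor 3]; exact: val_inj.
Qed.

Lemma sum3E (V : nmodType) (F : 'I_3 -> V) : \sum_(i < 3) F i = F ord0 + F i1 + F ord_max.
Proof.
rewrite !big_ord_recl big_ord0 addr0 addrA.
by congr (_ + F _ + F _); exact: val_inj.
Qed.

Lemma row3P (p q : M3) : p 0 ord0 = q 0 ord0 -> p 0 i1 = q 0 i1 -> p 0 ord_max = q 0 ord_max -> p = q.
Proof. by move=> a b c; apply/rowP => i; case: (ord3E i) => ->. Qed.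

Lemma row2P (p q : E) : p 0 ord0 = q 0 ord0 -> p 0 ord_max = q 0 ord_max -> p = q.
Proof. by move=> a c; apply/rowP => i; case: (ord2E i) => ->. Qed.

Definition lor (p q : M3) : R := p 0 ord0 * q 0 ord0 + p 0 i1 * q 0 i1 - p 0 ord_max * q 0 ord_max.

Lemma mul_eta (p : M3) j : (p *m eta R) 0 j = if j == ord_max then - p 0 j else p 0 j.
Proof.
rewrite mul_mx_diag mxE mxE; case: ifP => _; by rewrite ?mulrN1 ?mulr1.
Qed.

Lemma lorE (p q : M3) : (p *m eta R *m q^T) 0 0 = lor p q.
Proof.
by rewrite mxE sum3E !mul_eta ![q^T _ _]mxE /lor /= mulNr.
Qed.

Lemma qform_eta p : qform (eta R) p = lor p p.
Proof. exact: lorE. Qed.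

Lemma lorC p q : lor p q = lor q p. Proof. by rewrite /lor; ring. Qed.
Lemma lorDl p p' q : lor (p + p') q = lor p q + lor p' q.
Proof. by rewrite /lor !mxE; ring. Qed.
Lemma lorZl k p q : lor (k *: p) q = k * lor p q.
Proof. by rewrite /lor !mxE; ring. Qed.
Lemma lorDr p q q' : lor p (q + q') = lor p q + lor p q'.
Proof. by rewrite /lor !mxE; ring. Qed.
Lemma lorZr k p q : lor p (k *: q) = k * lor p q.
Proof. by rewrite /lor !mxE; ring. Qed.

Lemma lor_isom (A : 'M[R]_3) p q : SO21 A -> lor (p *m A) (q *m A) = lor p q.
Proof.
move=> [h _]; rewrite -!lorE trmx_mul !mulmxA; congr ((_ *m _) 0 0).
by rewrite -!mulmxA [A *m _]mulmxA h.
Qed.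

Lemma coneP p : timelike_cone p <-> lor p p < 0 /\ 0 < p 0 ord_max.
Proof. by rewrite /timelike_cone /= qform_eta. Qed.

(** Cauchy-Schwarz for the first two coordinates, each vector being dominated by
    its last coordinate. *)
Lemma lor_cone_lt0 p q : timelike_cone p -> timelike_cone q -> lor p q < 0.
Proof.
move=> /coneP [hp zp] /coneP [hq zq]; move: hp hq zp zq; rewrite /lor.
move: (p 0 ord0) (p 0 i1) (p 0 ord_max) (q 0 ord0) (q 0 i1) (q 0 ord_max) => a b c d e f hp hq zp zq.
rewrite subr_lt0.
have [neg|pos] := lerP (a * d + b * e) 0; first by apply: le_lt_trans neg _; rewrite mulr_gt0.
rewrite -(@ltr_pXn2r _ 2) ?nnegrE ?(ltW pos) ?mulr_ge0 ?ltW //.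
apply: (@le_lt_trans _ _ ((a * a + b * b) * (d * d + e * e))).
  rewrite -subr_ge0.
  have -> : (a * a + b * b) * (d * d + e * e) - (a * d + b * e) ^+ 2 = (a * e - b * d) ^+ 2 by ring.
  exact: sqr_ge0.
have h1 : a * a + b * b < c * c by lra.
have h2 : d * d + e * e < f * f by lra.
rewrite exprMn !expr2 (_ : c * c * (f * f) = (c * c) * (f * f)) //.
apply: ltr_pM => //; by rewrite -!expr2 addr_ge0 // sqr_ge0.
Qed.

(** If [q] were in the opposite cone, [lor p (- q)] would be negative as well. *)
Lemma lor_cone_z p q : timelike_cone p -> lor q q < 0 -> lor p q < 0 -> timelike_cone q.
Proof.
move=> cp hq hpq; apply/coneP; split=> //; rewrite ltNge; apply/negP => z0.
have zn : q 0 ord_max != 0.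
  apply/negP => /eqP z; move: hq; rewrite /lor z mulr0 subr0 ltNge.
  by rewrite -!expr2 addr_ge0 // sqr_ge0.
have cN : timelike_cone (- q).
  apply/coneP; split; last by rewrite mxE oppr_gt0 lt_neqAle zn.
  by rewrite -scaleN1r lorZl lorZr mulrA mulrNN !mul1r.
have := lor_cone_lt0 cp cN; rewrite -scaleN1r lorZr mulN1r oppr_lt0.
by move=> h; have := lt_trans h hpq; rewrite ltxx.
Qed.

Definition ez : M3 := delta_mx 0 ord_max.
Lemma ezE i : ez 0 i = (i == ord_max)%:R. Proof. by rewrite mxE eqxx. Qed.
Lemma ez_z : ez 0 ord_max = 1. Proof. by rewrite ezE. Qed.
Lemma lor_ez p : lor ez p = - p 0 ord_max.
Proof. by rewrite /lor !ezE /= !mul0r mul1r add0r add0r. Qed.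
Lemma cone_ez : timelike_cone ez.
Proof. by apply/coneP; rewrite lor_ez ez_z ltrN10 ltr01. Qed.

Definition orthochronous (A : 'M[R]_3) := SO21 A /\ 0 < A ord_max ord_max.

Lemma ez_mul (A : 'M[R]_3) i : (ez *m A) 0 i = A ord_max i.
Proof. by rewrite -rowE mxE. Qed.

(** The last diagonal entry has square at least 1 on SO(2,1), so it keeps its
    sign along a connected component; it is 1 at the identity. *)
Lemma SO21_id_orthochronous A : SO21_id A -> orthochronous A.
Proof.
move=> cA; have sA := connected_component_sub cA; split => //.
have I1 : SO21 (1%:M : 'M[R]_3) by split; rewrite ?mul1mx ?trmx1 ?mulmx1 ?det1.
have nz (B : 'M[R]_3) : SO21 B -> B ord_max ord_max != 0.
  move=> sB; apply/negP => /eqP b; have := lor_isom ez ez sB.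
  rewrite lor_ez ez_z /lor !ez_mul b => h.
  have : 0 <= B ord_max ord0 ^+ 2 + B ord_max i1 ^+ 2 by rewrite addr_ge0 // sqr_ge0.
  lra.
have c (B : 'M[R]_3) : {for B, continuous (fun B : 'M[R]_3 => B ord_max ord_max)} by exact: coord_continuous.
apply: (@connected_propagate _ (connected_component (@SO21 R) 1%:M)
  (fun A : 'M[R]_3 => 0 < A ord_max ord_max) 1%:M A) => //.
- exact: component_connected.
- move=> B _ B0; have := continuous_at_preim (@c B) (open_nbhs_nbhs (conj (@open_gt R 0) B0)).
  by apply: filterS => D.
- move=> B sB /negP; rewrite -leNgt le_eqVlt (negbTE (nz _ (connected_component_sub sB))) /= => B0.
  have := continuous_at_preim (@c B) (open_nbhs_nbhs (conj (@open_lt R 0) B0)).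
  by apply: filterS => D /= D0 _; apply/negP; rewrite -leNgt ltW.
- exact: connected_component_refl.
- by rewrite mxE eqxx ltr01.
Qed.

Lemma orthochronous_cone A p : orthochronous A -> timelike_cone p -> timelike_cone (p *m A).
Proof.
move=> [sA Az] cp; have ca : timelike_cone (ez *m A).
  apply/coneP; rewrite lor_isom // lor_ez ez_z ez_mul; split => //; exact: ltrN10.
apply: (lor_cone_z ca).
  by rewrite lor_isom //; have /coneP[] := cp.
by rewrite lor_isom //; exact: lor_cone_lt0 cone_ez cp.
Qed.

Lemma SO21_unit A : @SO21 R A -> A \in unitmx.
Proof. by move=> [_ d]; rewrite unitmxE d unitr1. Qed.

Lemma eta2 : eta R *m eta R = 1%:M.
Proof.
rewrite mulmx_diag -diag_const_mx; congr diag_mx; apply/rowP => i; rewrite !mxE.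
by case: ifP => _; rewrite ?mulrNN mulr1.
Qed.

Lemma SO21_inv A : @SO21 R A -> invmx A = eta R *m A^T *m eta R.
Proof.
move=> sA; have uA := SO21_unit sA; have [h _] := sA.
have k : A *m (eta R *m A^T *m eta R) = 1%:M by rewrite !mulmxA h eta2.
by rewrite -[LHS]mulmx1 -k mulKmx.
Qed.

Lemma SO21_tr A : @SO21 R A -> @SO21 R A^T.
Proof.
move=> sA; have [h d] := sA; split; last by rewrite det_tr.
have uA := SO21_unit sA.
have : eta R *m A^T *m eta R *m A = 1%:M by rewrite -SO21_inv // mulVmx.
rewrite -!mulmxA => /(congr1 (mulmx (eta R))).
by rewrite mulmx1 !mulmxA eta2 mul1mx trmxK.
Qed.

Lemma delta_row_mul (A : 'M[R]_3) i j : ((delta_mx 0 i : M3) *m A) 0 j = A i j.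
Proof. by rewrite -rowE mxE. Qed.

Lemma lor_delta i : lor (delta_mx 0 i) (delta_mx 0 i) = if i == ord_max then -1 else 1.
Proof.
rewrite /lor !mxE.
by case: (ord3E i) => -> /=; rewrite ?mulr1 ?mulr0 ?addr0 ?add0r ?subr0.
Qed.

Lemma ler_norm_sqr (a b : R) : 0 <= b -> a * a <= b * b -> `|a| <= b.
Proof.
move=> b0; rewrite -!expr2 -(real_normK (num_real a)) => h.
by rewrite -(@ler_pXn2r _ 2) ?nnegrE.
Qed.

(** The rows and the columns of [A] have Lorentzian square 1 or -1. The last
    column is thus bounded by its last entry, and each row by its own last entry. *)
Lemma orthochronous_bound A : orthochronous A -> `|A| <= 1 + A ord_max ord_max.
Proof.
move=> [sA Az].
have hr i : A i ord0 * A i ord0 + A i i1 * A i i1 - A i ord_max * A i ord_max = if i == ord_max then -1 else 1.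
  by rewrite -lor_delta -(lor_isom _ _ sA) /lor !delta_row_mul.
have := lor_isom ez ez (SO21_tr sA).
rewrite lor_ez ez_z {1}/lor !ez_mul !mxE => hc.
have [z zE] : exists z, z = A ord_max ord_max by exists (A ord_max ord_max).
rewrite -zE in Az hc *.
have sq (x : R) : 0 <= x * x by rewrite -expr2 sqr_ge0.
have c3 i : A i ord_max * A i ord_max <= z * z.
  have s0 := sq (A ord0 ord_max); have s1 := sq (A i1 ord_max); case: (ord3E i) => ->; rewrite -?zE; lra.
have c12 i : A i ord0 * A i ord0 + A i i1 * A i i1 <= 1 + z * z.
  by have := hr i; have := c3 i; case: ifP => _; lra.
have e : (1 + z) * (1 + z) = 1 + z * z + 2 * z by ring.
apply: mx_norm_le => [|i j]; first lra.
apply: ler_norm_sqr; first lra.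
have s0 := sq (A i ord0); have s1 := sq (A i i1); have := c3 i; have := c12 i.
rewrite e; case: (ord3E j) => ->; lra.
Qed.

(** A quantitative reversed Cauchy-Schwarz inequality. The height of [p] is
    [- lor (ez *m A) (p *m A)], and [p *m A] stays at a definite distance from the light
    cone, so that this product controls the height of [ez *m A]. *)
Lemma boost_bound A p M m : orthochronous A -> timelike_cone p ->
  p 0 ord_max <= M -> (p *m A) 0 ord_max <= M -> 0 < m -> lor p p <= - m ->
  A ord_max ord_max <= 2 * M ^+ 2 / m.
Proof.
move=> iA cp pM qM m0 hp; have [sA Az] := iA.
have cq := orthochronous_cone iA cp; set q := p *m A in cq qM.
have qq : lor q q <= - m by rewrite lor_isom.
have hz : lor (ez *m A) q = - p 0 ord_max by rewrite lor_isom // lor_ez.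
have ha : lor (ez *m A) (ez *m A) = -1 by rewrite lor_isom // lor_ez ez_z.
have zq : 0 < q 0 ord_max by have /coneP[] := cq.
have zp : 0 < p 0 ord_max by have /coneP[] := cp.
move: hz ha qq; rewrite /lor !ez_mul.
set a := A _ ord0; set b := A _ i1; set z := A _ ord_max in Az *.
set x := q 0 ord0; set y := q 0 i1; set w := q 0 ord_max in zq qM *.
set h := p 0 ord_max in pM zp *; move=> hz ha qq.
have M0 : 0 < M by lra.
rewrite ler_pdivlMr //.
have cs : (a * x + b * y) ^+ 2 <= (a * a + b * b) * (x * x + y * y).
  rewrite -subr_ge0.
  have -> : (a * a + b * b) * (x * x + y * y) - (a * x + b * y) ^+ 2 = (a * y - b * x) ^+ 2 by ring.
  exact: sqr_ge0.
have cs2 : (a * a + b * b) * (x * x + y * y) <= (z * z) * (w * w - m).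
  apply: ler_pM; rewrite -?expr2 ?addr_ge0 ?sqr_ge0 //; rewrite ?expr2; lra.
have e1 : a * x + b * y = z * w - h by lra.
rewrite e1 in cs.
have k : z * (z * m) <= z * (2 * h * w).
  have : (z * w - h) ^+ 2 <= z * z * (w * w - m) by exact: le_trans cs cs2.
  have -> : (z * w - h) ^+ 2 = z * z * (w * w) - z * (2 * h * w) + h * h by ring.
  have : 0 <= h * h by rewrite mulr_ge0 // ltW.
  rewrite mulrBr; move: (z * z * (w * w)) (z * (2 * h * w)) (h * h) => u v s; rewrite mulrA; lra.
rewrite ler_pM2l // in k; apply: le_trans k _.
rewrite -mulrA ler_pM2l // expr2; apply: ler_pM => //; exact: ltW.
Qed.

End minkowski.

(** * Proper discontinuity of Gamma on the timelike cone *)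

Section discontinuity.
Context {R : realType}.
Local Notation E := 'rV[R]_2.
Local Notation M3 := 'rV[R]_3.
Variable Gamma : set 'M[R]_3.
Hypotheses (subG : is_subgroup Gamma) (GSO : Gamma `<=` @SO21_id R)
  (isoG : Gamma `<=` isolated Gamma).

Lemma Gamma1 : Gamma 1%:M. Proof. by case: subG. Qed.
Lemma GammaM A B : Gamma A -> Gamma B -> Gamma (A *m B). Proof. by case: subG => _ + _; apply. Qed.
Lemma GammaV A : Gamma A -> Gamma (invmx A). Proof. by case: subG => _ _; apply. Qed.
Lemma Gamma_iso A : Gamma A -> orthochronous A.
Proof. by move=> /GSO/SO21_id_orthochronous. Qed.
Lemma Gamma_SO A : Gamma A -> SO21 A. Proof. by move=> /Gamma_iso[]. Qed.
Lemma Gamma_unit A : Gamma A -> A \in unitmx. Proof. by move=> /Gamma_SO/SO21_unit. Qed.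
Lemma GammaKV (A : 'M[R]_3) n (p : 'M[R]_(n, 3)) : Gamma A -> p *m invmx A *m A = p.
Proof. by move=> /Gamma_unit uA; rewrite mulmxKV. Qed.

Lemma Gamma_inv_bound A : Gamma A -> `|invmx A| <= 1 + `|A|.
Proof.
move=> gA; have := orthochronous_bound (Gamma_iso (GammaV gA)).
have -> : (invmx A) ord_max ord_max = A ord_max ord_max.
  rewrite -!ez_mul; apply: oppr_inj; rewrite -!lor_ez.
  by rewrite -(lor_isom ez _ (Gamma_SO gA)) GammaKV // lorC.
move=> h; apply: le_trans h _; rewrite lerD2l.
exact: le_trans (ler_norm _) (ler_mx_entry _ _ _).
Qed.

Lemma Gamma_discrete : exists2 e, 0 < e & forall A, Gamma A -> `|A - 1%:M| < e -> A = 1%:M.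
Proof.
have [_ [V /nbhs_ballP[e /= e0 eV] VG]] := isoG Gamma1.
exists e => // A gA Ae; have : (V `&` Gamma) A.
  by split=> //; apply: eV; rewrite -ball_normE /= distrC.
by rewrite VG.
Qed.

(** Multiplication by [invmx A], whose norm is bounded, reduces to discreteness
    at the identity. *)
Lemma Gamma_unif_discrete N : exists2 e, 0 < e & forall A B, Gamma A -> Gamma B ->
  `|A| <= N -> `|B - A| < e -> B = A.
Proof.
have [e e0 he] := Gamma_discrete.
have N0 : 0 < 3 * (1 + `|N|) + 1 by rewrite ltr_wpDl // mulr_ge0 // addr_ge0.
exists (e / (3 * (1 + `|N|) + 1)); first by rewrite divr_gt0.
move=> A B gA gB AN; rewrite ltr_pdivlMr // => BA.
have uA := Gamma_unit gA.
have : invmx A *m B = 1%:M.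
  apply: he; first by apply: GammaM => //; exact: GammaV.
  have -> : invmx A *m B - 1%:M = invmx A *m (B - A) by rewrite mulmxBr mulVmx.
  apply: le_lt_trans (mx_norm_mul _ _) _; apply: le_lt_trans BA.
  rewrite [leRHS]mulrC ler_wpM2r //.
  apply: (@le_trans _ _ (3 * (1 + `|N|))); last by rewrite lerDl.
  rewrite ler_wpM2l //; apply: le_trans (Gamma_inv_bound gA) _.
  by rewrite lerD2l (le_trans AN) // ler_norm.
by move=> /(congr1 (mulmx A)); rewrite mulmxA mulmxV // mul1mx mulmx1.
Qed.

(** Gamma has no accumulation point, even outside Gamma: any two of its
    elements close enough to [A] are close to each other, hence equal. *)
Lemma Gamma_isolated_nbhs (A : 'M[R]_3) : exists2 r, 0 < r & forall B, Gamma B -> `|B - A| < r -> B = A.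
Proof.
have [e e0 he] := Gamma_unif_discrete (`|A| + 1).
pose s := Order.min 1 (e / 2).
have s0 : 0 < s by rewrite lt_min ltr01 divr_gt0.
have [[C [gC CA Cs]]|no] := pselect (exists C, [/\ Gamma C, C != A & `|C - A| < s]); last first.
  exists s => // B gB Bs; apply/eqP; apply: contraT => ne; exfalso; apply: no; by exists B.
exists (Order.min s `|C - A|); first by rewrite lt_min s0 normr_gt0 subr_eq0.
move=> B gB; rewrite lt_min => /andP[Bs BC].
suff e1 : B = C by rewrite e1 ltxx in BC.
apply: he => //.
  have : `|C| <= `|C - A| + `|A| by rewrite -{1}(subrK A C) ler_normD.
  by move: Cs; rewrite lt_min => /andP[+ _]; move: `|C - A| `|C| `|A| => a b c; lra.
have -> : B - C = (B - A) - (C - A) by rewrite opprB addrA subrK.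
apply: le_lt_trans (ler_normD _ _) _; rewrite normrN.
move: Bs Cs; rewrite !lt_min => /andP[_ h1] /andP[_ h2].
by rewrite [e]splitr ltrD.
Qed.

(** Compactness of balls of matrices, carried over from row vectors. *)
Lemma matrix_ball_near_covering m n (N : R) (P : R -> 'M[R]_(m, n) -> Prop) :
  (forall A : 'M[R]_(m, n), \forall B \near A & d \near (0 : R)^'+, P d B) ->
  exists2 d, 0 < d & forall A, `|A| <= N -> P d A.
Proof.
move=> h.
pose K := [set v : 'rV[R]_(m * n) | `|v| <= N].
have cK : compact K.
  apply: bounded_closed_compact.
    by exists N; split; [exact: num_real|move=> M NM v /= vN; exact: le_trans vN (ltW NM)].
  have -> : K = (fun v : 'rV[R]_(m * n) => `|v|) @^-1` [set t | t <= N] by [].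
  by apply: closed_comp; [move=> y _; exact: norm_continuous|exact: closed_le].
have cv (v : 'rV[R]_(m * n)) : {for v, continuous (@vec_mx R m n)}.
  apply: continuous_at_mx => i j.
  have -> : (fun y : 'rV[R]_(m * n) => vec_mx y i j) = (fun y => y 0 (mxvec_index i j)).
    by apply/funext => y; rewrite mxE.
  exact: coord_continuous.
have /compact_near_coveringP nK := cK.
have [|d /= d0 hd] := nK R (nbhs (0 : R)^'+) (fun d v => P d (vec_mx v)) _ _.
  move=> v _; have [[U V] /= [nU nV] UV] := h (vec_mx v).
  exists (vec_mx @^-1` U, V); first by split => //; exact: continuous_at_preim (cv v) nU.
  by move=> [w d] /= [Uw Vd]; exact: (UV (vec_mx w, d)).
exists (d / 2); first by rewrite divr_gt0.
move=> A AN; rewrite -(mxvecK A); apply: (hd (d / 2)).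
- by rewrite /ball /= sub0r normrN gtr0_norm ?divr_gt0 // ltr_pdivrMr // ltr_pMr // ltr1n.
- by rewrite divr_gt0.
- rewrite /K /=; apply: mx_norm_le => [|i k]; first exact: le_trans AN.
  case/mxvec_indexP: k => a b; rewrite (ord1 i) mxvecE.
  exact: le_trans (ler_mx_entry _ _ _) AN.
Qed.

Lemma lor_continuous (T : topologicalType) (f g : T -> M3) x :
  {for x, continuous f} -> {for x, continuous g} -> {for x, continuous (fun y => lor (f y) (g y))}.
Proof.
move=> cf cg; have cfi i := @continuous_at_entry R T 1 3 f x 0 i cf.
have cgi i := @continuous_at_entry R T 1 3 g x 0 i cg.
apply: (@continuousB _ _ _ (fun y => f y 0 ord0 * g y 0 ord0 + f y 0 i1 * g y 0 i1) (fun y => f y 0 ord_max * g y 0 ord_max)).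
  by apply: (@continuousD _ _ _ (fun y => f y 0 ord0 * g y 0 ord0) (fun y => f y 0 i1 * g y 0 i1));
    apply: continuousM.
exact: continuousM.
Qed.

Lemma id_continuous_at (T : topologicalType) (x : T) : {for x, continuous (id : T -> T)}.
Proof. exact: id. Qed.

Lemma cone_near (p : M3) : timelike_cone p -> \forall q \near (p : M3), timelike_cone q /\
  (q 0 ord_max <= p 0 ord_max + 1 /\ lor q q <= lor p p / 2).
Proof.
move=> /coneP [hp zp].
have cz : {for p, continuous (fun q : M3 => q 0 ord_max)} by exact: coord_continuous.
have cl : {for p, continuous (fun q : M3 => lor q q)}.
  by apply: lor_continuous; exact: id_continuous_at.
have h2 : lor p p < lor p p / 2 by rewrite ltr_pdivlMr // mulr_natr mulr2n gtrDl.
have N1 := continuous_at_preim cz (open_nbhs_nbhs (conj (@open_gt R 0) zp)).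
have z1 : [set t | t < p 0 ord_max + 1] (p 0 ord_max) by rewrite /= ltrDl.
have N2 := continuous_at_preim cz (open_nbhs_nbhs (conj (@open_lt R _) z1)).
have N3 := continuous_at_preim cl (open_nbhs_nbhs (conj (@open_lt R _) h2)).
apply: filterS (filterI N1 (filterI N2 N3)) => q [/= k1 [k2 k3]].
split; last by split; exact: ltW.
by apply/coneP; split => //; apply: lt_trans k3 _; rewrite pmulr_llt0.
Qed.

Hypothesis freeG : forall A p, Gamma A -> timelike_cone p -> p *m A = p -> A = 1%:M.

(** By [boost_bound] the elements of Gamma that bring a point near [p] back near
    [p] are bounded, so by compactness it suffices to look near a given matrix [A]. There
    is at most one element of Gamma there, and it moves [p] by a definite amount. *)
Lemma proper_discontinuity (p : M3) : timelike_cone p ->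
  exists2 d, 0 < d & forall A q, Gamma A -> ball p d q -> ball p d (q *m A) -> A = 1%:M.
Proof.
move=> cp; have /nbhs_ballP[d1 /= d10 h1] := cone_near cp.
have [hp zp] := (coneP p).1 cp.
set M := p 0 ord_max + 1 in h1; set m := - (lor p p / 2).
have m0 : 0 < m by rewrite oppr_gt0 pmulr_llt0.
pose N := 1 + 2 * M ^+ 2 / m.
have bound A q : Gamma A -> ball p d1 q -> ball p d1 (q *m A) -> `|A| <= N.
  move=> gA /h1[cq [qM ql]] /h1[_ [qAM _]].
  apply: le_trans (orthochronous_bound (Gamma_iso gA)) _; rewrite lerD2l.
  by apply: (boost_bound (Gamma_iso gA) cq) => //; rewrite opprK.
pose P (d : R) (A : 'M[R]_3) := Gamma A -> A != 1%:M -> forall q, ball p d q -> ~ ball p d (q *m A).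
have [|d2 d20 h2] := @matrix_ball_near_covering 3 3 N P.
  move=> A; have [r r0 hr] := Gamma_isolated_nbhs A.
  have nA : \forall B \near (A : 'M[R]_3), `|B - A| < r.
    by apply/nbhs_ballP; exists r => // B; rewrite -ball_normE /= distrC.
  have [A1|A1] := eqVneq A 1%:M.
    exists ([set B | `|B - A| < r], setT); first by split => //; exact: filterT.
    move=> [B d] /= [Br _] gB; rewrite /P; rewrite (hr B gB Br) A1 eqxx //.
  have [gA|ngA] := pselect (Gamma A); last first.
    exists ([set B | `|B - A| < r], setT); first by split => //; exact: filterT.
    by move=> [B d] /= [Br _] gB; move: (gB); rewrite (hr B gB Br).
  have ne : 0 < `|p *m A - p|.
    rewrite normr_gt0 subr_eq0; apply/eqP => e; move/eqP: A1; apply; exact: freeG gA cp e.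
  pose k := 1 + 3 * `|A|.
  have k0 : 0 < k by rewrite ltr_wpDr // mulr_ge0.
  exists ([set B | `|B - A| < r], [set d | d < `|p *m A - p| / k]).
    by split => //; exact: nbhs_right_lt (divr_gt0 ne k0).
  move=> [B d] /= [Br dk] gB B1 q; rewrite (hr B gB Br) -!ball_normE /= => pq pqA.
  rewrite ltr_pdivlMr // in dk.
  have : `|p *m A - p| <= `|p - q *m A| + `|p - q| * (3 * `|A|).
    have -> : p *m A - p = - (p - q *m A) + (p - q) *m A.
      by rewrite mulmxBl opprB [RHS]addrC addrA subrK.
    apply: le_trans (ler_normD _ _) _; rewrite normrN lerD2l.
    by apply: le_trans (mx_norm_mul _ _) _; rewrite mulrAC mulrC.
  have : `|p - q| * (3 * `|A|) <= d * (3 * `|A|) by rewrite ler_wpM2r ?mulr_ge0 // ltW.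
  move: dk pqA; rewrite /k mulrDr mulr1.
  move: (d * _) (`|p - q| * _) `|p *m A - p| `|p - q *m A| => a b c e; lra.
exists (Order.min d1 d2); first by rewrite lt_min d10 d20.
move=> A q gA b b'; apply/eqP; apply: contraT => A1.
have sub1 x : ball p (Order.min d1 d2) x -> ball p d1 x by apply: le_ball; rewrite ge_min lexx.
have sub2 x : ball p (Order.min d1 d2) x -> ball p d2 x by apply: le_ball; rewrite ge_min lexx orbT.
by have := h2 A (bound A q gA (sub1 _ b) (sub1 _ b')) gA A1 q (sub2 _ b) (sub2 _ b').
Qed.

End discontinuity.

(** * The hyperboloid and polar coordinates in the cone *)

Section hyperboloid.
Context {R : realType}.
Local Notation E := 'rV[R]_2.
Local Notation M3 := 'rV[R]_3.

Definition hz (x : E) : R := Num.sqrt (1 + x 0 ord0 ^+ 2 + x 0 ord_max ^+ 2).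

Lemma hyp0 (x : E) : hyperboloid x 0 ord0 = x 0 ord0.
Proof.
rewrite /hyperboloid (_ : ord0 = lshift 1 (ord0 : 'I_2)); last exact: val_inj.
exact: row_mxEl.
Qed.

Lemma hyp1 (x : E) : hyperboloid x 0 i1 = x 0 ord_max.
Proof.
rewrite /hyperboloid (_ : i1 = lshift 1 (ord_max : 'I_2)); last exact: val_inj.
exact: row_mxEl.
Qed.

Lemma hyp2 (x : E) : hyperboloid x 0 ord_max = hz x.
Proof.
rewrite /hyperboloid (_ : ord_max = rshift 2 (ord0 : 'I_1)); last exact: val_inj.
by apply: etrans (row_mxEr _ _ _ _) _; rewrite mxE eqxx mulr1n.
Qed.

Lemma coord0 (p : M3) : hyperboloid_coord p 0 ord0 = p 0 ord0.
Proof. by rewrite mxE; congr (p _ _); exact: val_inj. Qed.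

Lemma coord1 (p : M3) : hyperboloid_coord p 0 ord_max = p 0 i1.
Proof. by rewrite mxE; congr (p _ _); exact: val_inj. Qed.

Lemma hz_gt0 (x : E) : 0 < hz x.
Proof. by rewrite sqrtr_gt0 -addrA ltr_pwDl // addr_ge0 // sqr_ge0. Qed.

Lemma hz_sqr (x : E) : hz x * hz x = 1 + x 0 ord0 * x 0 ord0 + x 0 ord_max * x 0 ord_max.
Proof. by rewrite -expr2 sqr_sqrtr ?expr2 // -!expr2 -addrA addr_ge0 // addr_ge0 // sqr_ge0. Qed.

Lemma lor_hyp (x : E) : lor (hyperboloid x) (hyperboloid x) = -1.
Proof. by rewrite /lor hyp0 hyp1 hyp2 hz_sqr; ring. Qed.

Lemma cone_hyp (x : E) : timelike_cone (hyperboloid x).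
Proof. by apply/coneP; rewrite lor_hyp hyp2 hz_gt0 ltrN10. Qed.

Lemma hyp_coord (p : M3) : lor p p = -1 -> 0 < p 0 ord_max -> hyperboloid (hyperboloid_coord p) = p.
Proof.
move=> h z; apply: row3P; rewrite ?hyp0 ?hyp1 ?hyp2 ?coord0 ?coord1 //.
rewrite /hz coord0 coord1.
have -> : 1 + p 0 ord0 ^+ 2 + p 0 i1 ^+ 2 = p 0 ord_max ^+ 2.
  by move: h; rewrite /lor !expr2; lra.
by rewrite sqrtr_sqr gtr0_norm.
Qed.

Lemma coord_hyp (x : E) : hyperboloid_coord (hyperboloid x) = x.
Proof. by apply: row2P; rewrite ?coord0 ?coord1 ?hyp0 ?hyp1. Qed.

(** Polar coordinates in the cone: [height p] is the Lorentzian norm of [p], and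
    [cproj p] the chart coordinates of its central projection to the hyperboloid. *)
Definition height (p : M3) : R := Num.sqrt (- lor p p).
Definition cproj (p : M3) : E := hyperboloid_coord ((height p)^-1 *: p).

Lemma height_gt0 p : timelike_cone p -> 0 < height p.
Proof. by move=> /coneP[h _]; rewrite sqrtr_gt0 oppr_gt0. Qed.

Lemma height_sqr p : timelike_cone p -> height p * height p = - lor p p.
Proof. by move=> /coneP[h _]; rewrite -expr2 sqr_sqrtr // oppr_ge0 ltW. Qed.

Lemma cone_polar p : timelike_cone p -> p = height p *: hyperboloid (cproj p).
Proof.
move=> cp; have h0 := height_gt0 cp; have [_ z0] := (coneP p).1 cp.
rewrite hyp_coord.
- by rewrite scalerA mulfV ?scale1r // gt_eqF.
- rewrite lorZl lorZr -[lor p p]opprK -(height_sqr cp).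
  by field; rewrite gt_eqF.
- by rewrite mxE mulr_gt0 ?invr_gt0.
Qed.

Lemma height_scale r x : 0 < r -> height (r *: hyperboloid x) = r.
Proof.
by move=> r0; rewrite /height lorZl lorZr lor_hyp mulrN1 mulrN opprK -expr2 sqrtr_sqr gtr0_norm.
Qed.

Lemma proj_scale r x : 0 < r -> cproj (r *: hyperboloid x) = x.
Proof.
by move=> r0; rewrite /cproj height_scale // scalerA mulVf ?gt_eqF // scale1r coord_hyp.
Qed.

Lemma height_mul A p : SO21 A -> height (p *m A) = height p.
Proof. by move=> sA; rewrite /height lor_isom. Qed.

Lemma hyp_act A (x : E) : orthochronous A -> hyperboloid (act A x) = hyperboloid x *m A.
Proof.
move=> iA; have [sA _] := iA; rewrite /act hyp_coord //; first by rewrite lor_isom // lor_hyp.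
by have /coneP[] := orthochronous_cone iA (cone_hyp x).
Qed.

Lemma proj_mul A p : orthochronous A -> timelike_cone p -> cproj (p *m A) = act A (cproj p).
Proof.
move=> iA cp; have [sA _] := iA.
rewrite {1}(cone_polar cp) -scalemxAl -hyp_act // proj_scale //; exact: height_gt0.
Qed.

Lemma act1 (x : E) : act 1%:M x = x :> E.
Proof. by rewrite /act mulmx1 coord_hyp. Qed.

Lemma actM A B x : orthochronous A -> act B (act A x) = act (A *m B) x :> E.
Proof. by move=> iA; rewrite {1}/act hyp_act // -mulmxA. Qed.

(** Hyperbolic cosine of the distance between two points of the chart. *)
Definition ccosh (x x' : E) : R := - lor (hyperboloid x) (hyperboloid x').

Lemma ccosh_act A x x' : orthochronous A -> ccosh (act A x) (act A x') = ccosh x x'.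
Proof. by move=> iA; have [sA _] := iA; rewrite /ccosh !hyp_act // lor_isom. Qed.

(** Compares the Euclidean distance in the chart to the hyperbolic one, with a
    constant that depends on one of the points only. *)
Lemma ccosh_dist (x x' : E) : let d0 := x 0 ord0 - x' 0 ord0 in let d1 := x 0 ord_max - x' 0 ord_max in
  d0 * d0 + d1 * d1 <= 4 * (hz x * hz x) * (ccosh x x' * (ccosh x x' - 1)).
Proof.
rewrite /= /ccosh /lor !hyp0 !hyp1 !hyp2; have := hz_sqr x; have := hz_sqr x'.
move: (x 0 ord0) (x 0 ord_max) (x' 0 ord0) (x' 0 ord_max) (hz x) (hz x') => a b a' b' z z' h' h.
pose d0 := a - a'; pose d1 := b - b'; pose dz := z - z'.
pose u := d0 * a + d1 * b; pose w := u - dz * z; pose n := a * a + b * b.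
pose D := d0 * d0 + d1 * d1.
pose c := - (a * a' + b * b' - z * z').
(* [2 * (c - 1)] is the Lorentzian square of the difference of the two points of the
   hyperboloid, and [w] its product with the first of them. *)
have wE : w = c - 1 + 2 * (1 + n - z * z) + (z * z - 1 - n) by rewrite /w /u /dz /d0 /d1 /c /n; ring.
have wc : w = c - 1 by rewrite wE h /n; ring.
have DE : D - dz * dz = 2 * (c - 1).
  have -> : D - dz * dz = (a * a + b * b - z * z) + (a' * a' + b' * b' - z' * z') + 2 * c.
    by rewrite /D /d0 /d1 /dz /c; ring.
  by rewrite h h'; ring.
have form : D - dz * dz + 2 * (w * w) = 2 * (c * (c - 1)) by rewrite DE wc; ring.
have n0 : 0 <= n by rewrite addr_ge0 // -expr2 sqr_ge0.
have D0 : 0 <= D by rewrite addr_ge0 // -expr2 sqr_ge0.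
have cs : u * u <= n * D.
  rewrite -subr_ge0 (_ : n * D - u * u = (d0 * b - d1 * a) ^+ 2) ?sqr_ge0 //.
  by rewrite /n /D /u; ring.
have nz : z * z = 1 + n by rewrite h /n; ring.
have key : 0 <= D * 2^-1 + 2 * (u * w) + 2 * (n * (w * w)).
  have [n1|n1] := eqVneq n 0.
    have u0 : u = 0.
      by apply/eqP; rewrite -sqrf_eq0 expr2 eq_le -{2}expr2 sqr_ge0 andbT; rewrite n1 mul0r in cs.
    by rewrite u0 n1 !mul0r !mulr0 !addr0 mulr_ge0 // invr_ge0.
  have np : 0 < n by rewrite lt0r n1.
  rewrite -(pmulr_rge0 _ np).
  have : 0 <= (u + 2 * (n * w)) * (u + 2 * (n * w)) by rewrite -expr2 sqr_ge0.
  have -> : (u + 2 * (n * w)) * (u + 2 * (n * w)) = u * u + 4 * (n * (u * w)) + 4 * (n * (n * (w * w))) by ring.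
  have -> : n * (D * 2^-1 + 2 * (u * w) + 2 * (n * (w * w))) = 2^-1 * (n * D) + 2 * (n * (u * w)) + 2 * (n * (n * (w * w))) by ring.
  move: cs; by move: (n * D) (u * u) (n * (u * w)) (n * (n * (w * w))) => p q r s; lra.
have dzE : (dz * z) * (dz * z) = (u - w) * (u - w) by rewrite /w; ring.
have fz : z * z * (2 * (c * (c - 1))) = (1 + n) * D - (u - w) * (u - w) + 2 * ((1 + n) * (w * w)).
  have aux (Z dz2 ww DD uw F n' : R) : Z = 1 + n' -> dz2 * Z = uw -> F = DD - dz2 + 2 * ww ->
    Z * F = (1 + n') * DD - uw + 2 * ((1 + n') * ww) by move=> -> <- ->; ring.
  apply: (aux _ (dz * dz)); [exact: nz|by rewrite -dzE; ring|by rewrite form].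
have -> : 4 * (z * z) * (c * (c - 1)) = 2 * (z * z * (2 * (c * (c - 1)))) by ring.
have w2 : 0 <= w * w by rewrite -expr2 sqr_ge0.
(* It remains to eliminate [u] by Cauchy-Schwarz. *)
have aux2 (DD nn uu uw ww : R) : 0 <= DD * 2^-1 + 2 * uw + 2 * (nn * ww) -> uu <= nn * DD ->
    0 <= ww -> 0 <= DD -> DD <= 2 * ((1 + nn) * DD - (uu - 2 * uw + ww) + 2 * ((1 + nn) * ww)).
  move=> h1 h2 h3 h4; have -> : 2 * ((1 + nn) * DD - (uu - 2 * uw + ww) + 2 * ((1 + nn) * ww)) =
    2 * DD + 2 * (nn * DD) - 2 * uu + 4 * uw + 2 * ww + 4 * (nn * ww) by ring.
  by move: (nn * DD) (nn * ww) h1 h2 => p q h1 h2; lra.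
have uwE : (u - w) * (u - w) = u * u - 2 * (u * w) + w * w by ring.
rewrite uwE in fz; rewrite -/c -/d0 -/d1 -/D fz; exact: aux2.
Qed.

Lemma ccosh_ge1 x x' : 1 <= ccosh x x'.
Proof.
have c0 : 0 < ccosh x x' by rewrite oppr_gt0; apply: lor_cone_lt0; exact: cone_hyp.
have := ccosh_dist x x' => /= h.
have h2 : 0 <= 4 * (hz x * hz x) * (ccosh x x' * (ccosh x x' - 1)).
  by apply: le_trans h; rewrite addr_ge0 // -expr2 sqr_ge0.
have zz : 0 < 4 * (hz x * hz x) by rewrite !mulr_gt0 // hz_gt0.
by rewrite (pmulr_rge0 _ zz) (pmulr_rge0 _ c0) subr_ge0 in h2.
Qed.

Lemma Ck_hyp k : Ck k setT (@hyperboloid R).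
Proof.
apply/(Ck_mx _ _ openT) => i j; rewrite (ord1 i).
have c l := Ck_coord l k (@openT E).
case: (ord3E j) => ->.
- by apply: Ck_ext openT _ (c ord0) => x _; rewrite hyp0.
- by apply: Ck_ext openT _ (c ord_max) => x _; rewrite hyp1.
have h : Ck k setT (fun x : E => 1 + x 0 ord0 * x 0 ord0 + x 0 ord_max * x 0 ord_max).
  by apply: Ck_add openT _ _; [apply: Ck_add openT _ _; [exact: Ck_cst|]|]; exact: Ck_mul openT (c _) (c _).
have := Ck_sqrt openT _ h => h2.
apply: Ck_ext openT _ (h2 _) => x _; first by rewrite hyp2 /hz !expr2.
by rewrite -!expr2 -addrA ltr_pwDl // addr_ge0 // sqr_ge0.
Qed.

Lemma Ck_mulmx k (U : set E) m n p (f : E -> 'M[R]_(m, n)) (A : 'M[R]_(n, p)) : open U ->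
  Ck k U f -> Ck k U (fun x => f x *m A).
Proof.
move=> oU cf; apply/(Ck_mx _ _ oU) => i j.
apply: Ck_ext oU _ (Ck_sum oU (fun l => Ck_mul oU (Ck_entry i l oU cf) (Ck_cst k U (A l j)))) => x _.
by rewrite mxE.
Qed.

Lemma Ck_coordinates k (U : set E) (f : E -> M3) : open U -> Ck k U f ->
  Ck k U (fun x => hyperboloid_coord (f x)).
Proof.
move=> oU cf; apply/(Ck_mx _ _ oU) => i j; rewrite (ord1 i).
case: (ord2E j) => ->.
  by apply: Ck_ext oU _ (Ck_entry 0 ord0 oU cf) => x _; rewrite coord0.
by apply: Ck_ext oU _ (Ck_entry 0 i1 oU cf) => x _; rewrite coord1.
Qed.

Lemma Ck_act k A : Ck k setT (@act R A).
Proof. exact: Ck_coordinates openT (Ck_mulmx A openT (Ck_hyp k)). Qed.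

Lemma Ck_lor k (U : set E) (f g : E -> M3) : open U -> Ck k U f -> Ck k U g ->
  Ck k U (fun x => lor (f x) (g x)).
Proof.
move=> oU cf cg; have h i := Ck_mul oU (Ck_entry 0 i oU cf) (Ck_entry 0 i oU cg).
exact: Ck_sub oU (Ck_add oU (h ord0) (h i1)) (h ord_max).
Qed.

Lemma Ck_height k (U : set E) (f : E -> M3) : open U -> (forall x, U x -> timelike_cone (f x)) ->
  Ck k U f -> Ck k U (fun x => height (f x)).
Proof.
move=> oU cT cf; apply: Ck_sqrt oU _ (Ck_opp oU (Ck_lor oU cf cf)) => x /cT/coneP[h _].
by rewrite oppr_gt0.
Qed.

Lemma Ck_scale k (U : set E) m n (r : E -> R) (f : E -> 'M[R]_(m, n)) : open U ->
  Ck k U r -> Ck k U f -> Ck k U (fun x => r x *: f x).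
Proof.
move=> oU cr cf; apply/(Ck_mx _ _ oU) => i j.
by apply: Ck_ext oU _ (Ck_mul oU cr (Ck_entry i j oU cf)) => x _; rewrite mxE.
Qed.

Lemma Ck_proj k (U : set E) (f : E -> M3) : open U -> (forall x, U x -> timelike_cone (f x)) ->
  Ck k U f -> Ck k U (fun x => cproj (f x)).
Proof.
move=> oU cT cf; apply: (Ck_coordinates oU); apply: (Ck_scale oU _ cf).
by apply: (Ck_inv oU _ (Ck_height oU cT cf)) => x /cT/height_gt0/lt0r_neq0.
Qed.

Lemma pullback_etaE n (f : 'rV[R]_n -> M3) x i j : differentiable f x ->
  pullback f (fun=> eta R) x i j = lor ('D_(delta_mx 0 i) f x) ('D_(delta_mx 0 j) f x).
Proof.
move=> df; rewrite !deriveEjacobian // -lorE trmx_mul !mulmxA /pullback.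
have key (M : 'M[R]_n) : ((delta_mx 0 i : 'rV[R]_n) *m M *m (delta_mx 0 j : 'rV[R]_n)^T) 0 0 = M i j.
  by rewrite trmx_delta -rowE -colE !mxE.
by rewrite -key !mulmxA.
Qed.

Lemma qform_pullback n (f : 'rV[R]_n -> M3) x v : differentiable f x ->
  qform (pullback f (fun=> eta R) x) v = lor ('D_v f x) ('D_v f x).
Proof.
move=> df; rewrite /qform /pullback !deriveEjacobian // -lorE trmx_mul !mulmxA //.
Qed.

End hyperboloid.


(** * The lift of an embedding and its central projection *)

Lemma Ck_local {R : realType} (V W : normedModType R) k (U : set V) (f : V -> W) :
  (forall x, U x -> exists2 U', open U' /\ U' x & Ck k U' f) -> Ck k U f.
Proof.
elim: k f => [|k IH] f h.
  by split=> // x Ux; have [U' [_ U'x] c] := h x Ux; exact (Ck_cont c U'x).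
split=> [x Ux|v]; first by have [U' [_ U'x] c] := h x Ux; exact (Ck_cont c U'x).
split=> [x Ux|]; first by have [U' [_ U'x] c] := h x Ux; exact: Ck_derivable c U'x.
by apply: IH => x Ux; have [U' oU c] := h x Ux; exists U' => //; exact: Ck_derive.
Qed.

Section lattice.
Context {R : realType}.
Local Notation E := 'rV[R]_2.
Local Notation M3 := 'rV[R]_3.
Variables (Gamma : set 'M[R]_3) (K : set E).
Hypotheses (subG : is_subgroup Gamma) (GSO : Gamma `<=` @SO21_id R)
  (isoG : Gamma `<=` isolated Gamma) (cK : compact K)
  (hK : forall x : E, exists2 A, Gamma A & K (act A x))
  (freeA : acts_freely Gamma).
Let GM := @GammaM _ _ subG.
Let GV := @GammaV _ _ subG.
Let Giso := @Gamma_iso _ _ GSO.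
Let GSOA := @Gamma_SO _ _ GSO.

(** A fixed point in the cone has a fixed central projection. *)
Lemma cone_free A (p : M3) : Gamma A -> timelike_cone p -> p *m A = p -> A = 1%:M.
Proof.
move=> gA cp e; apply: (freeA gA (x := cproj p)).
by rewrite -proj_mul ?e //; exact: Giso.
Qed.

Lemma act_inj_Gamma A B (x : E) : Gamma A -> Gamma B -> act A x = act B x -> A = B.
Proof.
move=> gA gB e.
have h : A *m invmx B = 1%:M.
  apply: (freeA (GM gA (GV gB)) (x := x)).
  rewrite -actM ?e; last exact: Giso.
  by rewrite actM ?mulmxV ?act1 //; [exact: (Gamma_unit GSO)|exact: Giso].
by rewrite -[A](GammaKV (A := B) GSO) // h mul1mx.
Qed.

Lemma actK A (x : E) : Gamma A -> act (invmx A) (act A x) = x.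
Proof. by move=> gA; rewrite actM ?mulmxV ?act1 //; [exact: (Gamma_unit GSO)|exact: Giso]. Qed.

Lemma actKV A (x : E) : Gamma A -> act A (act (invmx A) x) = x.
Proof. by move=> gA; rewrite actM ?mulVmx ?act1 //; [exact: (Gamma_unit GSO)|exact: Giso (GV gA)]. Qed.

Lemma orbit_self (p : M3) : Defs.orbit Gamma p p.
Proof. by exists 1%:M; [exact: Gamma1|rewrite mulmx1]. Qed.

Lemma orbit_mul A (p : M3) : Gamma A -> Defs.orbit Gamma (p *m A) = Defs.orbit Gamma p.
Proof.
move=> gA; apply/seteqP; split=> [q [B gB <-]|q [B gB <-]].
  by exists (A *m B); [exact: GM|rewrite mulmxA].
by exists (invmx A *m B); [exact: GM (GV gA) gB|rewrite mulmxA mulmxK //; exact: (Gamma_unit GSO)].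
Qed.

Section embedding.
Variable F : E -> set M3.
Hypotheses (F_inv : forall A x, Gamma A -> F (act A x) = F x)
  (F_loc : forall x, exists U f, U x /\ local_lift Gamma F U f)
  (F_inj : forall x y, F x = F y -> same_orbit Gamma x y).

Lemma F_orbit x p : F x p -> timelike_cone p /\ F x = Defs.orbit Gamma p.
Proof.
have [U [f [Ux [oU sf hf]]]] := F_loc x; have [cf ->] := hf x Ux.
by move=> [A gA <-]; rewrite orbit_mul //; split=> //; apply: orthochronous_cone cf; exact: Giso.
Qed.

(** By proper discontinuity, a small ball meets an orbit at most once. *)
Lemma F_discrete : discrete_fibers F.
Proof.
move=> x p Fp; have [cp Fx] := F_orbit Fp.
have [d d0 hd] := proper_discontinuity subG GSO isoG cone_free cp.
exists (ball p d); first exact: nbhsx_ballx.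
apply: filterS (nbhsx_ballx x 1 ltr01) => x' _ y1 y2 B1 B2 F1 F2.
have [_ e] := F_orbit F1; rewrite e in F2; case: F2 => A gA e2.
rewrite -e2 in B2; by rewrite -e2 (hd A y1 gA B1 B2) mulmx1.
Qed.

Lemma F_evenly_covered : evenly_covered F.
Proof.
move=> x0; have [U [f [Ux [oU sf hf]]]] := F_loc x0.
have /nbhs_ballP[d /= d0 dU] := open_nbhs_nbhs (conj oU Ux).
exists d => // x p bx; have [cf ->] := hf x (dU _ bx); case=> A gA <-.
exists (fun x => f x *m A); last by [].
move=> z bz; have [cfz Fz] := hf z (dU _ bz).
split; last by rewrite Fz; exists A.
exact (Ck_cont (Ck_mulmx A oU (sf 0%N)) (dU _ bz)).
Qed.

(** The plane being simply connected, [Sigma -> T / Gamma] lifts to a map from H^2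
    to T; it is smooth because it agrees locally with translates of the given lifts. *)
Lemma exists_lift : exists f : E -> M3, smooth_on setT f /\
  forall x, timelike_cone (f x) /\ F x = Defs.orbit Gamma (f x).
Proof.
have [U [f0 [U0 [oU sf hf]]]] := F_loc 0; have [_ F0] := hf _ U0.
have Fp : F 0 (f0 0) by rewrite F0; exact: orbit_self.
have [f sel _] := global_selection F_discrete F_evenly_covered Fp.
exists f; split; last by move=> x; have [_ /F_orbit] := sel x I.
move=> k; apply: Ck_local => x _.
have [W [h [Wx [oW sh hh]]]] := F_loc x.
have /nbhs_ballP[d /= d0 dW] := open_nbhs_nbhs (conj oW Wx).
have [_ Fx] := sel x I; have [_ e] := hh x Wx; rewrite e in Fx; case: Fx => A gA eA.
exists (ball x d); first by split; [exact: ball_open|exact: ballxx].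
have sW : selection F (ball x d) (fun z => h z *m A).
  move=> z bz; have [cz ez] := hh z (dW _ bz).
  split; last by rewrite ez; exists A.
  exact (Ck_cont (Ck_mulmx A oW (sh 0%N)) (dW _ bz)).
apply: (@Ck_ext _ _ _ k (ball x d) (fun z => h z *m A)).
- exact: ball_open.
- move=> z bz; apply: (selection_unique F_discrete (@segment_closed_ball _ _ x d) sW _ (ballxx _ d0) eA bz).
  by apply: selection_subset sel.
- by apply: Ck_mulmx; [exact: ball_open|apply: Ck_subset (sh k)].
Qed.

Section lifted.
Variable f : E -> M3.
Hypotheses (sf : smooth_on setT f)
  (hf : forall x, timelike_cone (f x) /\ F x = Defs.orbit Gamma (f x))
  (pos : forall x v, v != 0 -> 0 < lor ('D_v f x) ('D_v f x)).

Let cf x : {for x, continuous f}. Proof. exact (Ck_cont (sf 0%N) I). Qed.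
Let coneF x : timelike_cone (f x). Proof. by have [] := hf x. Qed.

Lemma act_continuous A (x : E) : {for x, continuous (@act R A)}.
Proof. exact (Ck_cont (Ck_act 0 A) I). Qed.

Lemma segment_closedT (V : normedModType R) : segment_closed (@setT V). Proof. by []. Qed.

(** [f \o act A] and [f] lift the same map, so they differ by an element of Gamma. *)
Lemma lift_equivariant A : Gamma A -> exists2 B, Gamma B & forall y, f (act A y) = f y *m B.
Proof.
move=> gA; have : Defs.orbit Gamma (f 0) (f (act A 0)).
  by have [_ <-] := hf 0; rewrite -(F_inv 0 gA); have [_ ->] := hf (act A 0); exact: orbit_self.
move=> [B gB e]; exists B; first exact: gB.
have s1 : selection F setT (fun y => f (act A y)).
  move=> x _; split; first by apply: (@continuous_comp _ _ _ (@act R A) f); [exact: act_continuous|exact: cf].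
  by rewrite -(F_inv x gA); have [_ ->] := hf (act A x); exact: orbit_self.
have s2 : selection F setT (fun y => f y *m B).
  move=> x _; split; first exact (Ck_cont (Ck_mulmx B openT (sf 0%N)) I).
  by have [_ ->] := hf x; exists B.
move=> y; exact: (@selection_unique _ _ _ F F_discrete setT (fun y => f (act A y)) (fun y => f y *m B) 0 y (@segment_closedT _) s1 s2 I (esym e) I).
Qed.

(** Lifts the central projection of F(Sigma) to H^2 / Gamma. *)
Definition phi (y : E) : E := cproj (f y).

Lemma smooth_phi : smooth_on setT phi.
Proof. by move=> k; exact: Ck_proj openT (fun x _ => coneF x) (sf k). Qed.

Lemma phi_continuous y : {for y, continuous phi}.
Proof. exact (Ck_cont (smooth_phi 0%N) I). Qed.

Lemma phi_equivariant A B : Gamma B -> (forall y, f (act A y) = f y *m B) ->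
  forall y, phi (act A y) = act B (phi y).
Proof. by move=> gB e y; rewrite /phi e proj_mul //; exact: Giso. Qed.

(** If the differential of [phi] kills [v], then ['D_v f] is radial, hence
    timelike or zero; but the image of [f] is spacelike. *)
Lemma jacobian_phi_unit y : jacobian phi y \in unitmx.
Proof.
rewrite -row_free_unit; apply: inj_row_free => v vJ.
apply/eqP; apply: contraT => v0; have := pos y v0.
have dphi : differentiable phi y by exact: Ck1_differentiable_mx openT (smooth_phi 1%N) I.
have dh : derivable (fun y => height (f y)) y v.
  exact: Ck_derivable (Ck_height openT (fun x _ => coneF x) (sf 1%N)) I.
rewrite -deriveEjacobian // in vJ.
have e i : 'D_v f y 0 i = 'D_v (fun y => height (f y)) y * hyperboloid (phi y) 0 i.
  rewrite derive_entry; last exact: Ck_derivable (sf 1%N) I.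
  have -> : (fun y => f y 0 i) = (fun y => height (f y)) * (fun y => hyperboloid (phi y) 0 i).
    by apply/funext => z; rewrite {1}(cone_polar (coneF z)) mxE.
  have dH : differentiable (fun x : E => hyperboloid x 0 i) (phi y).
    exact: Ck1_differentiable openT (Ck_entry 0 i openT (Ck_hyp 1)) I.
  have [d1 d2] := derive_comp2 v dphi dH.
  have d20 : 'D_v (fun y => hyperboloid (phi y) 0 i) y = 0.
    have zz (w : E) (a b : R) : w = 0 -> w 0 ord0 * a + w 0 ord_max * b = 0.
      by move=> ->; rewrite !mxE !mul0r addr0.
    rewrite d2; exact: zz vJ.
  rewrite (deriveM dh d1) d20 scaler0 add0r.
  exact: mulrC.
have -> : 'D_v f y = 'D_v (fun y => height (f y)) y *: hyperboloid (phi y).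
  by apply/rowP => i; rewrite [RHS]mxE; exact: e.
rewrite lorZl lorZr lor_hyp mulrN1 mulrN ltrNr oppr0 -expr2 => h.
by have := le_lt_trans (sqr_ge0 _) h; rewrite ltxx.
Qed.

Lemma phi_local_inverse y : exists r d c, [/\ 0 < r, 0 < d, 0 < c,
   forall y1 y2, ball y r y1 -> ball y r y2 -> `|y1 - y2| <= c * `|phi y1 - phi y2| &
   forall x, ball (phi y) d x -> exists2 y', ball y r y' & phi y' = x].
Proof. exact: inverse_function (smooth_phi 1%N) (jacobian_phi_unit y). Qed.

(** Hyperbolic balls, which Gamma permutes; [e] bounds the hyperbolic cosine of the
    distance minus 1. *)
Definition hball (x : E) (e : R) : set E := [set x' | ccosh x x' < 1 + e].

Lemma hball_act A x x' e : Gamma A -> hball x e x' -> hball (act A x) e (act A x').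
Proof. by move=> gA; rewrite /hball /= ccosh_act //; exact: Giso. Qed.

Lemma hball_subset Z x e d : 0 < d -> 0 < e -> e <= 1 -> hz x * hz x <= Z -> 32 * Z * e <= d * d ->
  hball x e `<=` ball x d.
Proof.
move=> d0 e0 e1 hZ Ze x' xx'.
have := ccosh_dist x x' => /=; have := ccosh_ge1 x x'; move: xx'; rewrite /hball /=.
have z0 : 0 < hz x * hz x by rewrite mulr_gt0 // hz_gt0.
move: (ccosh x x') => c c1 c2 hd.
have bound : 4 * (hz x * hz x) * (c * (c - 1)) < d * d.
  apply: lt_le_trans Ze.
  have : c * (c - 1) <= 2 * e.
    apply: (@le_trans _ _ (2 * (c - 1))); last lra.
    by rewrite ler_wpM2r //; lra.
  move=> h; apply: (@le_lt_trans _ _ (4 * Z * (2 * e))).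
    by apply: ler_pM => //; [lra|rewrite mulr_ge0 //; lra|lra].
  have Ze0 : 0 < Z * e by rewrite mulr_gt0 //; lra.
  have -> : 4 * Z * (2 * e) = 8 * (Z * e) by ring.
  have -> : 32 * Z * e = 32 * (Z * e) by ring.
  lra.
have sq (a b : R) : a * a + b * b < d * d -> `|a| < d.
  move=> h; rewrite -(@ltr_pXn2r _ 2) ?nnegrE ?(ltW d0) // real_normK ?num_real // !expr2.
  by apply: le_lt_trans h; rewrite lerDl -expr2 sqr_ge0.
have h2 := le_lt_trans hd bound.
rewrite -ball_normE /= norm2_lt !mxE; apply/andP; split; first exact: sq h2.
by apply: (@sq _ (x 0 ord0 - x' 0 ord0)); rewrite [ltLHS]addrC.
Qed.

Lemma hz_continuous (x : E) : {for x, continuous hz}.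
Proof.
have -> : hz = (fun x : E => hyperboloid x 0 ord_max) by apply/funext => z; rewrite hyp2.
exact (Ck_cont (Ck_entry 0 ord_max openT (Ck_hyp 0)) I).
Qed.

(** The inverse function theorem gives sections of [phi] over balls around each
    point, and compactness of [K] a size that is uniform for centres in [phi @` K]. *)
Lemma local_sections : exists2 e, 0 < e & forall y, K y ->
  exists s, [/\ forall x, hball (phi y) e x -> {for x, continuous s} /\ phi (s x) = x & s (phi y) = y].
Proof.
have /compact_near_coveringP nK := cK.
pose P (e : R) (y : E) := exists s, [/\ forall x, hball (phi y) e x -> {for x, continuous s} /\ phi (s x) = x & s (phi y) = y].
have [|d /= d0 hd] := nK R (nbhs (0 : R)^'+) P _; last first.
  exists (d / 2); first by rewrite divr_gt0.
  move=> y Ky; apply: (hd (d / 2)) => //; last by rewrite divr_gt0.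
  by rewrite /ball /= sub0r normrN gtr0_norm ?divr_gt0 // ltr_pdivrMr // ltr_pMr // ltr1n.
move=> y0 _; have [r [d [c [r0 d0 c0 lip sur]]]] := phi_local_inverse y0.
have s_ex x : exists y, ball (phi y0) d x -> ball y0 r y /\ phi y = x.
  have [bx|nbx] := pselect (ball (phi y0) d x); last by exists 0.
  by have [y by_ e] := sur x bx; exists y.
have [s hs] : exists s : E -> E, forall x, ball (phi y0) d x -> ball y0 r (s x) /\ phi (s x) = x.
  by exists (fun x => projT1 (cid (s_ex x))) => x; case: (cid (s_ex x)).
have cs x : ball (phi y0) d x -> {for x, continuous s}.
  move=> bx; apply: continuous_at_lt => e ep.
  have nb : \forall z \near x, ball (phi y0) d z by apply: open_nbhs_nbhs; split => //; exact: ball_open.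
  apply: filterS (filterI nb (nbhsx_ballx x _ (divr_gt0 ep c0))) => z [bz xz].
  have [b1 e1] := hs x bx; have [b2 e2] := hs z bz.
  apply: le_lt_trans (lip _ _ b1 b2) _; rewrite e1 e2.
  by move: xz; rewrite -ball_normE /= ltr_pdivlMr // mulrC.
pose Z := hz (phi y0) * hz (phi y0) + 1.
have Z0 : 0 < Z by rewrite ltr_wpDl // -expr2 sqr_ge0.
have cz : {for y0, continuous (fun y => hz (phi y) * hz (phi y))}.
  have c1 : {for y0, continuous (fun y => hz (phi y))}.
    by apply: (@continuous_comp _ _ _ phi hz); [exact: phi_continuous|exact: hz_continuous].
  exact (continuousM c1 c1).
have d2 : 0 < d / 2 by rewrite divr_gt0.
have n1 : \forall y \near y0, ball y0 r y by exact: nbhsx_ballx.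
have n2 : \forall y \near y0, ball (phi y0) (d / 2) (phi y).
  by apply: (continuous_at_preim (@phi_continuous y0)); exact: nbhsx_ballx.
have n3 : \forall y \near y0, hz (phi y) * hz (phi y) < Z.
  have o : [set t | t < Z] (hz (phi y0) * hz (phi y0)) by rewrite /= /Z ltrDl.
  exact: continuous_at_preim cz (open_nbhs_nbhs (conj (@open_lt R Z) o)).
(* For [phi y] near [phi y0], a hyperbolic ball of size [e < e1] around [phi y] lies in
   [ball (phi y) (d / 2)], hence in [ball (phi y0) d]. *)
pose e1 := Order.min 1 (d / 2 * (d / 2) / (32 * Z)).
have e10 : 0 < e1 by rewrite lt_min ltr01 divr_gt0 // mulr_gt0.
exists ([set y | ball y0 r y /\ (ball (phi y0) (d / 2) (phi y) /\ hz (phi y) * hz (phi y) < Z)],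
        [set e | 0 < e /\ e < e1]) => /=.
  split; first exact: filterI n1 (filterI n2 n3).
  exact: filterI (nbhs_right_gt (0 : R)) (nbhs_right_lt e10).
move=> [y e] /= [[yr [yd yZ]] [ep ee1]]; rewrite lt_min in ee1; case/andP: ee1 => ee1 eed.
have sub : hball (phi y) e `<=` ball (phi y0) d.
  move=> x hx; rewrite [d]splitr; apply: ball_triangle yd _.
  apply: (@hball_subset Z) hx => //; [exact: ltW|exact: ltW|].
  by rewrite mulrC -ler_pdivlMr ?mulr_gt0 // ltW.
exists s; split; first by move=> x /sub bx; split; [exact: cs|have [] := hs x bx].
have [|b1 e1'] := hs (phi y).
  by apply: le_ball yd; rewrite ler_pdivrMr // ler_pMr // ler1n.
apply/eqP; rewrite -subr_eq0 -normr_le0; apply: le_trans (lip _ _ b1 yr) _.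
by rewrite e1' subrr normr0 mulr0.
Qed.

(** Gamma carries the sections of [local_sections] over the whole plane, without
    changing the hyperbolic size of the balls. This completeness makes [phi] a covering. *)
Lemma uniform_sections : exists2 e, 0 < e & forall y,
  exists s, [/\ forall x, hball (phi y) e x -> {for x, continuous s} /\ phi (s x) = x & s (phi y) = y].
Proof.
have [e e0 he] := local_sections; exists e => // y.
have [A gA KA] := hK y; have [B gB eB] := lift_equivariant gA.
have pe := phi_equivariant gB eB.
have [s [hs sy]] := he _ KA; rewrite pe in hs sy.
have pV x : phi (act (invmx A) x) = act (invmx B) (phi x).
  by rewrite -{2}(actKV x gA) pe actK.
exists (fun x => act (invmx A) (s (act B x))); split; last by rewrite sy actK.
move=> x hx; have [c1 p1] := hs _ (hball_act gB hx).
split; last by rewrite pV p1 actK.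
apply: (@continuous_comp _ _ _ (fun x => s (act B x)) (@act R (invmx A))); last exact: act_continuous.
by apply: (@continuous_comp _ _ _ (@act R B) s); [exact: act_continuous|exact: c1].
Qed.

Let fiber (x : E) : set E := [set y | phi y = x].

Lemma fiber_discrete : discrete_fibers fiber.
Proof.
move=> x y _; have [r [d [c [r0 d0 c0 lip _]]]] := phi_local_inverse y.
exists (ball y r); first exact: nbhsx_ballx.
apply: filterS (nbhsx_ballx x 1 ltr01) => x' _ y1 y2 b1 b2 e1 e2.
apply/eqP; rewrite -subr_eq0 -normr_le0; apply: le_trans (lip _ _ b1 b2) _.
by rewrite e1 e2 subrr normr0 mulr0.
Qed.

Lemma ccosh_near1 (x : E) e : 0 < e -> exists2 d, 0 < d & forall x1 x2, ball x d x1 -> ball x d x2 ->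
  ccosh x1 x2 < 1 + e.
Proof.
move=> e0.
have ch (z : E * E) : {for z, continuous (fun z : E * E => hyperboloid z.1)}.
  apply: (@continuous_comp _ _ _ (fun z : E * E => z.1) (@hyperboloid R)); first exact: cvg_fst.
  exact (Ck_cont (Ck_hyp 0) I).
have ch2 (z : E * E) : {for z, continuous (fun z : E * E => hyperboloid z.2)}.
  apply: (@continuous_comp _ _ _ (fun z : E * E => z.2) (@hyperboloid R)); first exact: cvg_snd.
  exact (Ck_cont (Ck_hyp 0) I).
have cl := lor_continuous (ch (x, x)) (ch2 (x, x)).
have o : [set t | - (1 + e) < t] (lor (hyperboloid x) (hyperboloid x)) by rewrite /= lor_hyp; lra.
have [[U V] /= [nU nV] UV] := continuous_at_preim cl (open_nbhs_nbhs (conj (@open_gt R _) o)).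
have /nbhs_ballP[d /= d0 dUV] : nbhs x (U `&` V) by exact: filterI.
exists d => // x1 x2 b1 b2; rewrite /ccosh ltrNl.
have [[U1 _] [_ V2]] := (dUV _ b1, dUV _ b2).
exact: (UV (x1, x2)).
Qed.

Lemma fiber_evenly_covered : evenly_covered fiber.
Proof.
move=> x0; have [e e0 he] := uniform_sections.
have [d d0 hd] := ccosh_near1 x0 e0.
exists d; first exact: d0.
move=> x y bx yx; have [s [hs sy]] := he y; rewrite yx in hs sy.
exists s; last exact: sy.
by move=> z bz; apply: hs; exact: hd.
Qed.

(** A section [psi] of the covering [phi] exists as the plane is simply connected.
    The points where [psi \o phi] is the identity form a nonempty, open and closed set. *)
Lemma global_inverse : exists psi : E -> E, [/\ smooth_on setT psi, cancel psi phi & cancel phi psi].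
Proof.
have [psi sel psi0] := global_selection fiber_discrete fiber_evenly_covered (erefl (phi 0) : fiber (phi 0) 0).
have cpsi x : {for x, continuous psi} by have [] := sel x I.
have phiK x : phi (psi x) = x by have [] := sel x I.
exists psi; split; [|exact: phiK|].
  exact: smooth_inverse smooth_phi jacobian_phi_unit cpsi phiK.
have cc y : {for y, continuous (fun y => psi (phi y))}.
  by apply: (@continuous_comp _ _ _ phi psi); [exact: phi_continuous|exact: cpsi].
move=> y; apply: (@convex_propagate _ _ setT (fun y => psi (phi y) = y) 0 y (@segment_closedT _)) => //.
- move=> z _ e; have := fiber_discrete (erefl (phi z) : fiber (phi z) z).
  move=> [B nB hB]; have nB' : nbhs (psi (phi z)) B by rewrite e.
  have hB' := continuous_at_preim (@phi_continuous z) hB.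
  apply: filterS (filterI hB' (filterI nB (continuous_at_preim (cc z) nB'))) => w [h [b1 b2]] _.
  by apply: h => //; exact: phiK.
- move=> z _ /eqP ne; have ep : 0 < `|psi (phi z) - z| / 2 by rewrite divr_gt0 // normr_gt0 subr_eq0.
  apply: filterS (filterI (cont_near_lt (cc z) ep) (nbhsx_ballx z _ ep)) => w [k1 k2] _ ew.
  rewrite -ball_normE /= in k2.
  have : `|psi (phi z) - z| < `|psi (phi z) - z| / 2 + `|psi (phi z) - z| / 2; last by rewrite -splitr ltxx.
  have {1}-> : psi (phi z) - z = (psi (phi z) - psi (phi w)) - (z - w) by rewrite ew opprB addrA subrK.
  by rewrite (le_lt_trans (ler_normD _ _))// normrN ltrD.
Qed.

Section inverse.
Variable psi : E -> E.
Hypotheses (spsi : smooth_on setT psi) (psiK : cancel psi phi) (phiK : cancel phi psi).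

(** F(Sigma) lifts to the radial graph of this function over H^2. *)
Definition polar_radius (x : E) : R := height (f (psi x)).

Lemma radius_gt0 x : 0 < polar_radius x. Proof. exact: height_gt0. Qed.

Lemma lift_polar x : f (psi x) = polar_radius x *: hyperboloid x.
Proof. by rewrite {1}(cone_polar (coneF (psi x))) -/(phi (psi x)) psiK. Qed.

Lemma Ck_radius k : Ck k setT polar_radius.
Proof.
have c := Ck_height openT (fun x _ => coneF x) (sf k).
exact: (Ck_comp openT openT _ (spsi k) c).
Qed.

Lemma radius_max : exists x0, forall x, polar_radius x <= polar_radius x0.
Proof.
pose h y := height (f y).
have hinv A y : Gamma A -> h (act A y) = h y.
  by move=> gA; have [B gB e] := lift_equivariant gA; rewrite /h e height_mul //; exact: GSOA.
have K0 : K !=set0 by have [A _ KA] := hK 0; exists (act A 0).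
have [|c Kc cmax] := @EVT_max_rV R 2 h K K0 cK.
  apply: continuous_in_subspaceT => y _.
  exact (Ck_cont (Ck_height openT (fun x _ => coneF x) (sf 0%N)) I).
exists (phi c) => x; rewrite /polar_radius phiK -/(h c).
have [A gA KA] := hK (psi x).
by rewrite -/(h (psi x)) -(hinv A) //; apply: cmax; rewrite inE.
Qed.

Lemma F_psi x : F (psi x) = Defs.orbit Gamma (polar_radius x *: hyperboloid x).
Proof. by have [_ ->] := hf (psi x); rewrite lift_polar. Qed.

(** Where the radii agree, [F] takes the same value at [psi x0] and at
    [psi (act A x0)]; by injectivity these two points are in the same orbit, and the
    relation that holds between them extends to all points by equivariance of [phi]. *)
Lemma radius_meets_equivariant A x0 : Gamma A -> polar_radius (act A x0) = polar_radius x0 ->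
  exists2 B, Gamma B & forall x, psi (act A x) = act B (psi x).
Proof.
move=> gA e0.
have eF : F (psi x0) = F (psi (act A x0)).
  rewrite !F_psi e0 hyp_act; last exact: Giso.
  by rewrite scalemxAl orbit_mul.
have [B gB eB] := F_inj eF; exists B => // x.
have [C gC eC] := lift_equivariant gB.
have pC := phi_equivariant gC eC.
have AC : A = C by apply: (@act_inj_Gamma A C x0) => //; rewrite -[LHS]psiK eB pC psiK.
by rewrite -[RHS]phiK pC psiK AC.
Qed.

(** Embeddedness enters here. If [polar_radius (act A x)] and [polar_radius x] were
    nowhere equal, one would be larger than the other for all [x]; at a maximum of
    [polar_radius], or at its image by [invmx A], this is absurd. *)
Lemma psi_equivariant A : Gamma A ->
  exists2 B, Gamma B & forall x, psi (act A x) = act B (psi x).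
Proof.
move=> gA; have [[x0 e0]|no] := pselect (exists x0, polar_radius (act A x0) = polar_radius x0).
  exact: radius_meets_equivariant e0.
exfalso; have [xm hm] := radius_max.
have cr x : {for x, continuous (fun x => polar_radius (act A x) - polar_radius x)}.
  apply: (@continuousB _ _ _ (fun x => polar_radius (act A x)) polar_radius); last exact (Ck_cont (Ck_radius 0) I).
  apply: (@continuous_comp _ _ _ (@act R A) polar_radius); first exact: act_continuous.
  exact (Ck_cont (Ck_radius 0) I).
have ne x : polar_radius (act A x) != polar_radius x by apply/eqP => e; apply: no; exists x.
have H : polar_radius (act A (act (invmx A) xm)) < polar_radius (act (invmx A) xm).
  apply: (@convex_propagate _ _ setT (fun x => polar_radius (act A x) < polar_radius x) xm _ (@segment_closedT _)) => //.
  - move=> x _; rewrite -subr_lt0 => h.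
    apply: filterS (continuous_at_preim (cr x) (open_nbhs_nbhs (conj (@open_lt R 0) h))) => z /= hz _.
    by rewrite -subr_lt0.
  - move=> x _ /negP; rewrite -leNgt le_eqVlt eq_sym (negbTE (ne x)) /= -subr_gt0 => h.
    apply: filterS (continuous_at_preim (cr x) (open_nbhs_nbhs (conj (@open_gt R 0) h))) => z /= hz _.
    by apply/negP; rewrite -leNgt -subr_ge0 ltW.
  - by rewrite lt_neqAle ne hm.
by rewrite actKV // in H; have := lt_le_trans H (hm _); rewrite ltxx.
Qed.

Lemma radius_invariant A x : Gamma A -> polar_radius (act A x) = polar_radius x.
Proof.
move=> gA; have [B gB eB] := psi_equivariant gA.
have [C gC eC] := lift_equivariant gB.
by rewrite /polar_radius eB eC height_mul //; exact: GSOA.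
Qed.

Lemma psi_surface_diffeo : surface_diffeo Gamma psi.
Proof.
split; first exact: spsi.
  by exists phi; split; [exact: smooth_phi|exact: psiK|exact: phiK].
move=> x y; split=> [[A gA ->]|[A gA e]].
  by have [B gB eB] := psi_equivariant gA; exists B.
have [B gB eB] := lift_equivariant gA.
by exists B => //; rewrite -[LHS]psiK e (phi_equivariant gB eB) psiK.
Qed.

Lemma psi_central : central_parametrization Gamma F psi.
Proof. by move=> x; exists (polar_radius x); [exact: radius_gt0|exact: F_psi]. Qed.

End inverse.
End lifted.
End embedding.
End lattice.


(** * Theorema egregium for surfaces in Minkowski space *)

Section curvature.
Context {R : realType}.
Local Notation E := 'rV[R]_2.
Local Notation M3 := 'rV[R]_3.

Lemma is_derive_entry (u : E -> M3) x v i : derivable u x v ->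
  is_derive x v (fun y => u y 0 i) ('D_v u x 0 i).
Proof.
move=> du; apply: DeriveDef; last exact: esym (derive_entry 0 i du).
by have [h _] := derivable_mxP u x v; exact: h.
Qed.

Lemma is_derive_lor (u w : E -> M3) x v : derivable u x v -> derivable w x v ->
  is_derive x v (fun y => lor (u y) (w y)) (lor ('D_v u x) (w x) + lor (u x) ('D_v w x)).
Proof.
move=> du dw.
have p i := @is_deriveM _ _ _ _ x v _ _ (is_derive_entry i du) (is_derive_entry i dw).
have := is_deriveB (is_deriveD (p ord0) (p i1)) (p ord_max).
move=> /is_derive_eq; apply; rewrite /lor /GRing.scale /=; ring.
Qed.

(** The component of [p] along the unit normal to the plane of [u] and [w], times
    the square root of the Gram determinant of [u] and [w]. *)
Definition tdet (p u w : M3) : R :=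
  p 0 ord0 * (u 0 i1 * w 0 ord_max - u 0 ord_max * w 0 i1)
  + p 0 i1 * (u 0 ord_max * w 0 ord0 - u 0 ord0 * w 0 ord_max)
  + p 0 ord_max * (u 0 ord0 * w 0 i1 - u 0 i1 * w 0 ord0).

(** Splits [lor p q] into the contributions of the tangential and of the normal
    components, relative to the plane of [u] and [w]; the normal is timelike, whence the
    sign. *)
Lemma lor_normal_part (p q u w : M3) :
  (lor u u * lor w w - lor u w * lor u w) * lor p q
  - (lor p u * (lor w w * lor q u - lor u w * lor q w)
     + lor p w * (lor u u * lor q w - lor u w * lor q u))
  = - (tdet p u w * tdet q u w).
Proof. by rewrite /lor /tdet; ring. Qed.

Lemma det_gram (G : 'M[R]_2) (u : 'I_2 -> M3) : (forall i j, G i j = lor (u i) (u j)) ->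
  \det G = lor (u ord0) (u ord0) * lor (u ord_max) (u ord_max) - lor (u ord0) (u ord_max) * lor (u ord0) (u ord_max).
Proof. by move=> h; rewrite det22 !h (lorC (u ord_max)). Qed.

(** [lor_normal_part] with the tangential component expressed by the inverse Gram
    matrix. *)
Lemma gram_tangential (G : 'M[R]_2) (u : 'I_2 -> M3) (p q : M3) :
  (forall i j, G i j = lor (u i) (u j)) -> \det G != 0 ->
  \det G * (\sum_l (\sum_k invmx G l k * lor p (u k)) * lor q (u l)) =
  \det G * lor p q + tdet p (u ord0) (u ord_max) * tdet q (u ord0) (u ord_max).
Proof.
move=> h d0.
have e l k : invmx G l k = (\det G)^-1 * adj2 G l k by rewrite invmx22 // [LHS]mxE.
have := lor_normal_part p q (u ord0) (u ord_max); rewrite -(det_gram h).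
rewrite !sum2E !e !adj2E !eqxx !ord10 !h (lorC (u ord_max)) /=.
move: (\det G) d0 (lor _ _) (lor _ _) (lor _ _) (lor _ _) (lor _ _) (lor _ _) (lor _ _) (lor _ _) (tdet _ _ _) (tdet _ _ _).
move=> D D0 a b c d a' b' c' d' t t' H.
have -> : D * d' + t' * t = c' * (b' * a' - d * c) + b * (a * c - d * a') by lra.
by field.
Qed.

Lemma is_derive_tdet (p u w : E -> M3) x v : derivable p x v -> derivable u x v -> derivable w x v ->
  is_derive x v (fun y => tdet (p y) (u y) (w y))
    (tdet ('D_v p x) (u x) (w x) + tdet (p x) ('D_v u x) (w x) + tdet (p x) (u x) ('D_v w x)).
Proof.
move=> dp du dw.
have ep i := is_derive_entry i dp; have eu i := is_derive_entry i du.
have ew i := is_derive_entry i dw.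
have m3 i j k : is_derive x v (fun y => p y 0 i * (u y 0 j * w y 0 k))
   ('D_v p x 0 i * (u x 0 j * w x 0 k) + p x 0 i * ('D_v u x 0 j * w x 0 k + u x 0 j * 'D_v w x 0 k)).
  apply: (is_derive_eq (is_deriveM (ep i) (is_deriveM (eu j) (ew k)))).
  change (p x 0 i * (u x 0 j * 'D_v w x 0 k + w x 0 k * 'D_v u x 0 j) + (u x 0 j * w x 0 k) * 'D_v p x 0 i =
    'D_v p x 0 i * (u x 0 j * w x 0 k) + p x 0 i * ('D_v u x 0 j * w x 0 k + u x 0 j * 'D_v w x 0 k)).
  by ring.
have b i j k := is_deriveB (m3 i j k) (m3 i k j).
have := is_deriveD (is_deriveD (b ord0 i1 ord_max) (b i1 ord_max ord0)) (b ord_max ord0 i1).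
move=> h; have E1 : (fun y => tdet (p y) (u y) (w y)) = (fun y => p y 0 ord0 * (u y 0 i1 * w y 0 ord_max) - p y 0 ord0 * (u y 0 ord_max * w y 0 i1)
  + (p y 0 i1 * (u y 0 ord_max * w y 0 ord0) - p y 0 i1 * (u y 0 ord0 * w y 0 ord_max))
  + (p y 0 ord_max * (u y 0 ord0 * w y 0 i1) - p y 0 ord_max * (u y 0 i1 * w y 0 ord0))).
  by apply/funext => y; rewrite /tdet; ring.
rewrite E1; apply: (is_derive_eq h); rewrite /tdet; ring.
Qed.

(** For [u] and [w] tangent at the point [p], with derivatives [uu] and [uw] in
    some direction, the left-hand side vanishes at the critical points of the squared
    distance [tdet p u w ^+ 2 / G] from the origin to the tangent plane. The right-hand
    side is the second fundamental form applied to that direction and to the tangential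
    component of [p], up to a factor. *)
Lemma support_critical_identity (p u w uu uw : M3) :
  let G := lor u u * lor w w - lor u w * lor u w in
  let G' := 2 * (lor uu u * lor w w + lor u u * lor uw w - lor u w * (lor uu w + lor u uw)) in
  2 * (tdet p uu w + tdet p u uw) * G - tdet p u w * G' =
  - 2 * (tdet uu u w * (lor w w * lor p u - lor u w * lor p w)
       + tdet uw u w * (lor u u * lor p w - lor u w * lor p u)).
Proof. by rewrite /= /lor /tdet; ring. Qed.

(** The last hypothesis is the derivative of the previous one. In the
    antisymmetrization that defines the curvature the third derivatives [X] cancel, and
    only products of second derivatives are left. *)
Lemma egregium_algebra (g : 'I_2 -> 'I_2 -> R) (C : 'I_2 -> 'I_2 -> 'I_2 -> R)
   (T : 'I_2 -> 'I_2 -> 'I_2 -> R) (dC X : 'I_2 -> 'I_2 -> 'I_2 -> 'I_2 -> R)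
   (Y : 'I_2 -> 'I_2 -> 'I_2 -> 'I_2 -> R) :
  (forall i j, g i j = g j i) -> (forall i j m, T i j m = T j i m) ->
  (forall m, X ord0 ord_max ord_max m = X ord_max ord0 ord_max m) ->
  (forall j k m, \sum_l g m l * C l j k = T j k m) ->
  (forall i j k m, \sum_l ((T i m l + T i l m) * C l j k + g m l * dC i l j k) = X i j k m + Y j k i m) ->
  \sum_l (dC ord0 l ord_max ord_max - dC ord_max l ord0 ord_max
     + \sum_m (C m ord_max ord_max * C l ord0 m - C m ord0 ord_max * C l ord_max m)) * g l ord0
  = Y ord_max ord_max ord0 ord0 - Y ord0 ord_max ord_max ord0
    - \sum_l C l ord_max ord_max * T ord0 ord0 l + \sum_l C l ord0 ord_max * T ord0 ord_max l.
Proof.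
move=> gs Ts Xs hT hU.
have A1 := hU ord0 ord_max ord_max ord0; have A2 := hU ord_max ord0 ord_max ord0.
have B1 := hT ord0 ord0 ord0; have B2 := hT ord0 ord_max ord0.
have B3 := hT ord_max ord0 ord0; have B4 := hT ord_max ord_max ord0.
rewrite (Xs ord0) in A1.
move: A1 A2 B1 B2 B3 B4; rewrite !sum2E (gs ord_max ord0) !(Ts ord_max ord0).
move: (g ord0 ord0) (g ord0 ord_max) (X ord_max ord0 ord_max ord0) (Y _ _ _ _) (Y _ _ _ _).
move=> g00 g01 x y1 y2.
move: (T ord0 ord0 ord0) (T ord0 ord0 ord_max) (T ord0 ord_max ord0) (T ord0 ord_max ord_max) (T ord_max ord_max ord0).
move=> t000 t001 t010 t011 t110.
move: (C ord0 ord0 ord0) (C ord_max ord0 ord0) (C ord0 ord0 ord_max) (C ord_max ord0 ord_max)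
  (C ord0 ord_max ord0) (C ord_max ord_max ord0) (C ord0 ord_max ord_max) (C ord_max ord_max ord_max).
move=> c000 c100 c001 c101 c010 c110 c011 c111.
move: (dC _ _ _ _) (dC _ _ _ _) (dC _ _ _ _) (dC _ _ _ _) => d1 d2 d3 d4.
move=> A1 A2 B1 B2 B3 B4.
have := congr1 (fun z => c011 * z) B1; have := congr1 (fun z => c111 * z) B2.
have := congr1 (fun z => c001 * z) B3; have := congr1 (fun z => c101 * z) B4.
move=> /= {B1 B2 B3 B4}; lra.
Qed.

Lemma egregium_final (D a b c d t1 t2 t3 : R) :
  D * a = D * c + t1 * t2 -> D * b = D * d + t3 * t3 ->
  (c - d - a + b) * D = - (t2 * t1 - t3 * t3).
Proof. move=> ? ?; lra. Qed.

Lemma first_kind_sum (a b c d : R) : 2^-1 * (c * (a + b + (a + d) - (b + d))) = c * a.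
Proof. by field. Qed.

Definition pd (i : 'I_2) (u : E -> M3) (x : E) : M3 := 'D_(delta_mx 0 i) u x.

Lemma Ck_pd k i (u : E -> M3) : Ck k.+1 setT u -> Ck k setT (pd i u).
Proof. exact: Ck_derive. Qed.

Lemma partial_lor i (u w : E -> M3) x : Ck 1 setT u -> Ck 1 setT w ->
  partial i (fun y => lor (u y) (w y)) x = lor (pd i u x) (w x) + lor (u x) (pd i w x).
Proof.
move=> cu cw.
have h := is_derive_lor (Ck_derivable (v := delta_mx 0 i) cu (I : setT x))
  (Ck_derivable (v := delta_mx 0 i) cw (I : setT x)).
by case: h => _ h; exact h.
Qed.

Lemma pd_sym i j (u : E -> M3) x : Ck 2 setT u -> pd i (pd j u) x = pd j (pd i u) x.
Proof.
move=> cu; apply/rowP => l.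
have cl := Ck_entry 0 l openT cu.
have ent a b : pd a (pd b u) x 0 l = 'D_(delta_mx 0 a) ('D_(delta_mx 0 b) (fun y => u y 0 l)) x.
  rewrite {1}/pd derive_entry; last exact: Ck_derivable (Ck_pd b cu) I.
  congr ('D_ _ _ x); apply/funext => y.
  by rewrite /pd derive_entry //; exact: Ck_derivable (CkS cu) I.
exact: etrans (ent i j) (etrans (derive_sym _ _ openT cl I) (esym (ent j i))).
Qed.

Section immersion.
Variable f : E -> M3.
Hypotheses (sf : smooth_on setT f).
Let g : E -> 'M[R]_2 := pullback f (fun=> eta R).
Hypothesis posG : forall x, 0 < \det (g x).

Definition d1 (i : 'I_2) : E -> M3 := pd i f.
Definition d2 (i j : 'I_2) : E -> M3 := pd i (pd j f).

Lemma Ck_d1 k i : Ck k setT (d1 i). Proof. exact: Ck_pd (sf k.+1). Qed.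
Lemma Ck_d2 k i j : Ck k setT (d2 i j). Proof. exact: Ck_pd (Ck_pd j (sf k.+2)). Qed.
Lemma d2_sym i j x : d2 i j x = d2 j i x. Proof. exact: pd_sym (sf 2%N). Qed.

Lemma gE x i j : g x i j = lor (d1 i x) (d1 j x).
Proof.
by apply: pullback_etaE; apply: Ck1_differentiable_mx openT _ I; exact: sf.
Qed.

Lemma partial_g i j l x : partial i (fun y => g y j l) x = lor (d2 i j x) (d1 l x) + lor (d1 j x) (d2 i l x).
Proof.
have -> : (fun y => g y j l) = (fun y => lor (d1 j y) (d1 l y)) by apply/funext => y; exact: gE.
exact: partial_lor (Ck_d1 1 j) (Ck_d1 1 l).
Qed.

(** The Christoffel symbols of an induced metric give the tangential components of
    the second derivatives. *)
Lemma christoffelE k i j x : christoffel g k i j x = \sum_l invmx (g x) k l * lor (d2 i j x) (d1 l x).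
Proof.
rewrite /christoffel mulr_sumr; apply: eq_bigr => l _.
rewrite !partial_g (d2_sym l i) (d2_sym l j) (d2_sym j i) (lorC (d1 j x) _) (lorC (d1 i x) _).
exact: first_kind_sum.
Qed.

Lemma christoffel_lower m i j x : \sum_l g x m l * christoffel g l i j x = lor (d2 i j x) (d1 m x).
Proof.
pose T : 'cV[R]_2 := \col_l lor (d2 i j x) (d1 l x).
have gu : g x \in unitmx by rewrite unitmxE unitfE gt_eqF.
have cE l : christoffel g l i j x = (invmx (g x) *m T) l 0.
  by rewrite christoffelE [RHS]mxE; apply: eq_bigr => p _; rewrite [T _ _]mxE.
have -> : lor (d2 i j x) (d1 m x) = (g x *m (invmx (g x) *m T)) m 0.
  by rewrite mulmxA mulmxV // mul1mx mxE.
by rewrite [RHS]mxE; apply: eq_bigr => l _; rewrite cE.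
Qed.

Lemma Ck_christoffel l i j : Ck 1 setT (christoffel g l i j).
Proof.
have cg : Ck 1 setT g.
  apply/(Ck_mx _ _ openT) => a b.
  by apply: Ck_ext openT _ (Ck_lor openT (Ck_d1 1 a) (Ck_d1 1 b)) => x _; rewrite gE.
have dg x : setT x -> \det (g x) != 0 by move=> _; rewrite gt_eqF.
apply: Ck_ext openT _ (Ck_sum openT (fun p => Ck_mul openT (Ck_invmx l p openT dg cg)
   (Ck_lor openT (Ck_d2 1 i j) (Ck_d1 1 p)))) => x _.
by rewrite christoffelE.
Qed.

(** The derivative of [christoffel_lower]. *)
Lemma partial_christoffel i j k m x :
  \sum_l ((lor (d2 i m x) (d1 l x) + lor (d2 i l x) (d1 m x)) * christoffel g l j k x
     + g x m l * partial i (christoffel g l j k) x)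
  = lor (pd i (d2 j k) x) (d1 m x) + lor (d2 j k x) (d2 i m x).
Proof.
have cg a b : Ck 1 setT (fun x => g x a b).
  by apply: Ck_ext openT _ (Ck_lor openT (Ck_d1 1 a) (Ck_d1 1 b)) => y _; rewrite gE.
have E1 : (fun y => lor (d2 j k y) (d1 m y)) = \sum_(l < 2) (fun y => g y m l) * (christoffel g l j k).
  by apply/funext => y; rewrite fct_sumE -christoffel_lower.
have L := partial_lor i x (Ck_d2 1 j k) (Ck_d1 1 m); rewrite E1 /partial in L.
have dG l : derivable (fun y => g y m l) x (delta_mx 0 i) by exact: Ck_derivable (cg m l) I.
have dC l : derivable (christoffel g l j k) x (delta_mx 0 i) by exact: Ck_derivable (Ck_christoffel l j k) I.
rewrite derive_sum in L; last by move=> l; exact: derivableM.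
rewrite -[RHS]L; apply: eq_bigr => l _.
rewrite (deriveM (dG l) (dC l)) -/(partial i (fun y => g y m l) x) partial_g (lorC (d1 m x)).
rewrite /GRing.scale /= addrC; congr (_ + _); exact: mulrC.
Qed.

Lemma det_gE x : \det (g x) = lor (d1 ord0 x) (d1 ord0 x) * lor (d1 ord_max x) (d1 ord_max x)
    - lor (d1 ord0 x) (d1 ord_max x) * lor (d1 ord0 x) (d1 ord_max x).
Proof. exact: det_gram (gE x). Qed.

(** Theorema egregium. The three determinants are the coefficients of the second
    fundamental form times the square root of [\det g]; the sign comes from the timelike
    normal. *)
Lemma gauss_egregium x : gauss_curvature g x * (\det (g x) * \det (g x)) =
  - (tdet (d2 ord0 ord0 x) (d1 ord0 x) (d1 ord_max x) * tdet (d2 ord_max ord_max x) (d1 ord0 x) (d1 ord_max x)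
     - tdet (d2 ord0 ord_max x) (d1 ord0 x) (d1 ord_max x) * tdet (d2 ord0 ord_max x) (d1 ord0 x) (d1 ord_max x)).
Proof.
have d0 : \det (g x) != 0 by rewrite gt_eqF.
have := egregium_algebra (g := fun i j => g x i j) (C := fun l j k => christoffel g l j k x)
  (T := fun i j m => lor (d2 i j x) (d1 m x))
  (dC := fun i l j k => partial i (christoffel g l j k) x)
  (X := fun i j k m => lor (pd i (d2 j k) x) (d1 m x))
  (Y := fun j k i m => lor (d2 j k x) (d2 i m x)).
have h1 i j : g x i j = g x j i by rewrite (gE x i j) (gE x j i); exact: lorC.
have h2 i j m : lor (d2 i j x) (d1 m x) = lor (d2 j i x) (d1 m x).
  by rewrite (d2_sym i j x).
have h3 m : lor (pd ord0 (d2 ord_max ord_max) x) (d1 m x) = lor (pd ord_max (d2 ord0 ord_max) x) (d1 m x).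
  by rewrite /d2 (pd_sym ord0 ord_max x (Ck_d1 2 ord_max)).
move=> /(_ h1 h2 h3 (fun j k m => christoffel_lower m j k x) (fun i j k m => partial_christoffel i j k m x)) h.
rewrite /gauss_curvature mulrA divfK // [X in X * _ = _]h.
have s i j i' j' : \det (g x) * (\sum_l christoffel g l i j x * lor (d2 i' j' x) (d1 l x)) =
  \det (g x) * lor (d2 i j x) (d2 i' j' x) + tdet (d2 i j x) (d1 ord0 x) (d1 ord_max x) * tdet (d2 i' j' x) (d1 ord0 x) (d1 ord_max x).
  under eq_bigr => l _ do rewrite christoffelE.
  exact: (gram_tangential (u := fun i => d1 i x) _ _ (gE x) d0).
rewrite -[d2 ord_max ord0 x]d2_sym.
exact: egregium_final (s ord_max ord_max ord0 ord0) (s ord0 ord_max ord0 ord_max).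
Qed.

End immersion.
End curvature.


(** * Distance from the origin to the tangent planes *)

Section chain_rule.
Context {R : realType}.
Local Notation E := 'rV[R]_2.
Local Notation M3 := 'rV[R]_3.

Lemma derive_chain (f : E -> M3) (psi : E -> E) x v :
  differentiable psi x -> differentiable f (psi x) ->
  'D_v (fun y => f (psi y)) x = 'D_('D_v psi x) f (psi x).
Proof.
move=> dp df; have dc := differentiable_comp dp df.
rewrite (deriveE v dp) (deriveE _ df) -[LHS]/('D_v (f \o psi) x) (deriveE v dc).
exact (congr1 (fun L : E -> M3 => L v) (diff_comp dp df)).
Qed.

Lemma derive_pd (f : E -> M3) x v : differentiable f x ->
  'D_v f x = v 0 ord0 *: pd ord0 f x + v 0 ord_max *: pd ord_max f x.
Proof.
move=> df; rewrite {1}[v]rV2E (deriveE _ df) linearD !linearZ /=.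
by rewrite -!(deriveE _ df).
Qed.

Lemma qform_pullback_comp (g : E -> 'M[R]_2) (psi : E -> E) x v : differentiable psi x ->
  qform (pullback psi g x) v = qform (g (psi x)) ('D_v psi x).
Proof. by move=> dp; rewrite /qform /pullback deriveEjacobian // trmx_mul !mulmxA. Qed.

Lemma derive_at_max (h : E -> R) y0 v : Ck 1 setT h -> (forall y, h y <= h y0) ->
  'D_v h y0 = 0.
Proof.
move=> ch hm.
have d t : t \in `]-1, (1 : R)[%R -> derivable (fun s : R => h (y0 + s *: v)) t 1.
  by move=> _; apply/derivable_line; exact: Ck_derivable ch I.
have [|//||_] := @derive1_at_max R (fun s : R => h (y0 + s *: v)) (-1) 1 0 _ d.
- exact: le_trans (lerN10 _) ler01.
- by rewrite in_itv /= ltrN10 ltr01.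
- by move=> t _; rewrite scale0r addr0; exact: hm.
by rewrite derive_line scale0r addr0.
Qed.

Lemma Ck_tdet k (p u w : E -> M3) : Ck k setT p -> Ck k setT u -> Ck k setT w ->
  Ck k setT (fun x => tdet (p x) (u x) (w x)).
Proof.
move=> cp cu cw.
have m a b c := Ck_mul openT (Ck_entry 0 a openT cp) (Ck_sub openT
   (Ck_mul openT (Ck_entry 0 b openT cu) (Ck_entry 0 c openT cw))
   (Ck_mul openT (Ck_entry 0 c openT cu) (Ck_entry 0 b openT cw))).
exact: Ck_add openT (Ck_add openT (m ord0 i1 ord_max) (m i1 ord_max ord0)) (m ord_max ord0 i1).
Qed.

(** Minus the Gram determinant of [p], [u], [w], expanded along [p]. *)
Lemma tdet_sqr (p u w : M3) : tdet p u w * tdet p u w =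
  (- lor p p) * (lor u u * lor w w - lor u w * lor u w)
  + (lor p u * (lor w w * lor p u - lor u w * lor p w) + lor p w * (lor u u * lor p w - lor u w * lor p u)).
Proof. by rewrite /lor /tdet; ring. Qed.

Lemma tdet_sqr_isom (B : 'M[R]_3) (p u w : M3) : SO21 B ->
  tdet (p *m B) (u *m B) (w *m B) * tdet (p *m B) (u *m B) (w *m B) = tdet p u w * tdet p u w.
Proof. by move=> sB; rewrite !tdet_sqr !lor_isom. Qed.

Lemma tdet_change (p u w : M3) (a b c d : R) :
  tdet p (a *: u + b *: w) (c *: u + d *: w) = (a * d - b * c) * tdet p u w.
Proof. by rewrite /tdet !mxE; ring. Qed.

Lemma gram_change (u w : M3) (a b c d : R) :
  let u' := a *: u + b *: w in let w' := c *: u + d *: w in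
  lor u' u' * lor w' w' - lor u' w' * lor u' w' =
  (a * d - b * c) * (a * d - b * c) * (lor u u * lor w w - lor u w * lor u w).
Proof. by rewrite /= /lor !mxE; ring. Qed.

Lemma gram_schmidt (u w : M3) (t := - lor u w *: u + lor u u *: w) :
  lor t t = lor u u * (lor u u * lor w w - lor u w * lor u w).
Proof. by rewrite /t !(lorDl, lorDr, lorZl, lorZr) (lorC w u); ring. Qed.

Lemma gram_derivative_algebra (u w u' w' : M3) :
  lor u u *: (lor w' w + lor w w') + lor w w *: (lor u' u + lor u u')
    - (lor u w *: (lor u' w + lor u w') + lor u w *: (lor u' w + lor u w')) =
  2 * (lor u' u * lor w w + lor u u * lor w' w - lor u w * (lor u' w + lor u w')).
Proof. by rewrite (lorC u u') (lorC w w') /GRing.scale /=; ring. Qed.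

Lemma ratio_change (t t' G G' d : R) : d * t' * (d * t') = t * t -> d * d * G' = G -> 0 < G ->
  t' * t' / G' = t * t / G.
Proof.
move=> <- <- h.
have d0 : d != 0 by apply: contraTneq h => ->; rewrite !mul0r ltxx.
have G0 : G' != 0 by apply: contraTneq h => ->; rewrite mulr0 ltxx.
by field; rewrite d0 G0.
Qed.

Lemma derive_mulmxr (f : E -> M3) (B : 'M[R]_3) x v : derivable f x v ->
  'D_v (fun y => f y *m B) x = 'D_v f x *m B.
Proof.
move=> df; have e i := is_derive_entry i df.
have h j := is_deriveD (is_deriveD (is_deriveZ (B ord0 j) (e ord0)) (is_deriveZ (B i1 j) (e i1))) (is_deriveZ (B ord_max j) (e ord_max)).
have E1 j : (fun y => (f y *m B) 0 j) = B ord0 j \*: (fun y => f y 0 ord0) + B i1 j \*: (fun y => f y 0 i1) + B ord_max j \*: (fun y => f y 0 ord_max).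
  apply/funext => y; rewrite mxE sum3E; congr (_ + _ + _); exact: mulrC.
have dm : derivable (fun y => f y *m B) x v.
  apply/derivable_mxP => i j; rewrite (ord1 i) E1; by case: (h j).
apply/rowP => j; rewrite derive_entry // E1.
have [_ k] := h j; apply: (etrans k).
rewrite [RHS]mxE sum3E; congr (_ + _ + _); exact: mulrC.
Qed.

Lemma symmetric_kernel (b00 b01 b11 c0 c1 : R) : b00 * b11 - b01 * b01 != 0 ->
  b00 * c0 + b01 * c1 = 0 -> b01 * c0 + b11 * c1 = 0 -> c0 = 0 /\ c1 = 0.
Proof.
move=> d0 e0 e1.
have f0 : (b00 * b11 - b01 * b01) * c0 = b11 * (b00 * c0 + b01 * c1) - b01 * (b01 * c0 + b11 * c1) by ring.
have f1 : (b00 * b11 - b01 * b01) * c1 = b00 * (b01 * c0 + b11 * c1) - b01 * (b00 * c0 + b01 * c1) by ring.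
move: f0 f1; rewrite e0 e1 !mulr0 subr0 => /eqP + /eqP.
by rewrite !mulf_eq0 (negbTE d0) /= => /eqP-> /eqP->.
Qed.

Lemma critical_cancel (D G S t t' : R) : D != 0 -> D * D = S * G ->
  D * t + D * t - S * t' = 0 -> 2 * t * G - D * t' = 0.
Proof.
move=> D0 e h; apply/eqP; rewrite -(mulrI_eq0 _ (mulfI D0)); apply/eqP.
transitivity ((D * t + D * t - S * t') * G + t' * (S * G - D * D)); first by ring.
by rewrite h e subrr mul0r mulr0 addr0.
Qed.

Lemma plane_dist_isom (B : 'M[R]_3) (p u w p' u' w' : M3) (a b c d : R) : SO21 B ->
  p *m B = p' -> u *m B = a *: u' + b *: w' -> w *m B = c *: u' + d *: w' ->
  0 < lor u u * lor w w - lor u w * lor u w ->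
  tdet p' u' w' * tdet p' u' w' / (lor u' u' * lor w' w' - lor u' w' * lor u' w') =
  tdet p u w * tdet p u w / (lor u u * lor w w - lor u w * lor u w).
Proof.
move=> sB ep eu ew h.
apply: (ratio_change (d := a * d - b * c)) h.
  by rewrite -tdet_change -(tdet_sqr_isom p u w sB) ep eu ew.
by rewrite -gram_change -eu -ew !lor_isom.
Qed.

(** Cauchy-Schwarz in the plane of [u] and [w]: the right-hand side is the square
    of the tangential component of [p] times that of [t], up to the Gram determinant. *)
Lemma gram_cauchy (p u w t : M3) (a b : R) : t = a *: u + b *: w ->
  lor p t * lor p t * (lor u u * lor w w - lor u w * lor u w) <=
  (lor p u * (lor w w * lor p u - lor u w * lor p w) + lor p w * (lor u u * lor p w - lor u w * lor p u)) * lor t t.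
Proof.
move=> ->; rewrite !(lorDl, lorDr, lorZl, lorZr) (lorC w u) -subr_ge0.
move: (lor _ _) (lor _ _) (lor _ _) (lor _ _) (lor _ _) => x y A B C.
rewrite (_ : _ - _ = (a * (x * y - A * C) - b * (B * C - A * y)) ^+ 2); first exact: sqr_ge0.
ring.
Qed.

End chain_rule.

Section support.
Context {R : realType}.
Local Notation E := 'rV[R]_2.
Local Notation M3 := 'rV[R]_3.
Variable f : E -> M3.
Hypothesis sf : smooth_on setT f.
Let g : E -> 'M[R]_2 := pullback f (fun=> eta R).

Definition gram (y : E) : R := lor (d1 f ord0 y) (d1 f ord0 y) * lor (d1 f ord_max y) (d1 f ord_max y)
  - lor (d1 f ord0 y) (d1 f ord_max y) * lor (d1 f ord0 y) (d1 f ord_max y).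
Definition tvol (y : E) : R := tdet (f y) (d1 f ord0 y) (d1 f ord_max y).

Lemma Ck_gram k : Ck k setT gram.
Proof.
have c i j := Ck_lor openT (Ck_d1 sf k i) (Ck_d1 sf k j).
exact: Ck_sub openT (Ck_mul openT (c _ _) (c _ _)) (Ck_mul openT (c _ _) (c _ _)).
Qed.

Lemma Ck_tvol k : Ck k setT tvol.
Proof. exact: Ck_tdet (sf k) (Ck_d1 sf k _) (Ck_d1 sf k _). Qed.

Lemma derive_gram i y : 'D_(delta_mx 0 i) gram y =
  2 * (lor (d2 f i ord0 y) (d1 f ord0 y) * lor (d1 f ord_max y) (d1 f ord_max y)
     + lor (d1 f ord0 y) (d1 f ord0 y) * lor (d2 f i ord_max y) (d1 f ord_max y)
     - lor (d1 f ord0 y) (d1 f ord_max y) * (lor (d2 f i ord0 y) (d1 f ord_max y) + lor (d1 f ord0 y) (d2 f i ord_max y))).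
Proof.
have dd j : derivable (d1 f j) y (delta_mx 0 i) by exact: Ck_derivable (Ck_d1 sf 1 j) I.
have l j k := is_derive_lor (dd j) (dd k).
have := is_deriveB (is_deriveM (l ord0 ord0) (l ord_max ord_max)) (is_deriveM (l ord0 ord_max) (l ord0 ord_max)).
case=> _ h; apply: (etrans h).
exact (gram_derivative_algebra (d1 f ord0 y) (d1 f ord_max y) (d2 f i ord0 y) (d2 f i ord_max y)).
Qed.

Lemma derive_tvol i y : 'D_(delta_mx 0 i) tvol y =
  tdet (f y) (d2 f i ord0 y) (d1 f ord_max y) + tdet (f y) (d1 f ord0 y) (d2 f i ord_max y).
Proof.
have dd j : derivable (d1 f j) y (delta_mx 0 i) by exact: Ck_derivable (Ck_d1 sf 1 j) I.
have [_ h] := is_derive_tdet (Ck_derivable (v := delta_mx 0 i) (sf 1) I) (dd ord0) (dd ord_max).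
apply: (etrans h).
have z (u w : M3) j : tdet (if j == ord0 :> 'I_2 then u else w) u w = 0.
  by case: ifP => _; rewrite /tdet; ring.
have -> : tdet ('D_(delta_mx 0 i) f y) (d1 f ord0 y) (d1 f ord_max y) = 0.
  case: (ord2E i) => ->; [exact: (z (d1 f ord0 y) (d1 f ord_max y) ord0)|exact: (z (d1 f ord0 y) (d1 f ord_max y) ord_max)].
by rewrite add0r.
Qed.

Hypotheses (pos : forall x v, v != 0 -> 0 < lor ('D_v f x) ('D_v f x))
  (Kneg : forall y, gauss_curvature g y < 0).

Lemma tangent_gt0 y a b : b != 0 ->
  0 < lor (a *: d1 f ord0 y + b *: d1 f ord_max y) (a *: d1 f ord0 y + b *: d1 f ord_max y).
Proof.
move=> b0; pose v : E := a *: delta_mx 0 ord0 + b *: delta_mx 0 ord_max.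
have v0 : v 0 ord0 = a by rewrite !mxE !eqxx ord01 mulr0 mulr1 addr0.
have v1 : v 0 ord_max = b by rewrite !mxE !eqxx ord10 mulr0 mulr1 add0r.
have nz : v != 0 by apply: contraNneq b0 => e; rewrite -v1 e mxE.
have := pos y nz; rewrite derive_pd ?v0 ?v1; first by apply.
by apply: Ck1_differentiable_mx openT (sf 1) I.
Qed.

Lemma d1_gt0 y : 0 < lor (d1 f ord0 y) (d1 f ord0 y).
Proof.
have nz : delta_mx 0 ord0 != 0 :> E.
  by apply/eqP => /rowP/(_ ord0)/eqP; rewrite !mxE !eqxx oner_eq0.
exact: (pos y nz).
Qed.

Lemma gram_gt0 y : 0 < gram y.
Proof.
have := tangent_gt0 y (- lor (d1 f ord0 y) (d1 f ord_max y)) (lt0r_neq0 (d1_gt0 y)).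
rewrite gram_schmidt -/(gram y).
by rewrite pmulr_rgt0 // d1_gt0.
Qed.

(** The coordinates of the tangential component of the position vector and its
    square, all times [gram]. *)
Definition tan0 (y : E) : R :=
  lor (d1 f ord_max y) (d1 f ord_max y) * lor (f y) (d1 f ord0 y) - lor (d1 f ord0 y) (d1 f ord_max y) * lor (f y) (d1 f ord_max y).
Definition tan1 (y : E) : R :=
  lor (d1 f ord0 y) (d1 f ord0 y) * lor (f y) (d1 f ord_max y) - lor (d1 f ord0 y) (d1 f ord_max y) * lor (f y) (d1 f ord0 y).
Definition tangential (y : E) : R := lor (f y) (d1 f ord0 y) * tan0 y + lor (f y) (d1 f ord_max y) * tan1 y.

Lemma tvol_sqr y : tvol y * tvol y = - lor (f y) (f y) * gram y + tangential y.
Proof. exact: tdet_sqr. Qed.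

Lemma radial_tangent y v : lor (f y) ('D_v f y) * lor (f y) ('D_v f y) * gram y <=
  tangential y * lor ('D_v f y) ('D_v f y).
Proof.
apply: (gram_cauchy (f y) (a := v 0 ord0) (b := v 0 ord_max)).
by apply: derive_pd; apply: Ck1_differentiable_mx openT (sf 1) I.
Qed.

Lemma tangential_ge0 y : 0 <= tangential y.
Proof.
have := radial_tangent y (delta_mx 0 ord0); rewrite -/(d1 f ord0 y) => h.
rewrite -(pmulr_lge0 _ (d1_gt0 y)); apply: le_trans h.
by apply: mulr_ge0; [exact: sqr_ge0|exact: ltW (gram_gt0 y)].
Qed.

Lemma det_gram_g y : \det (g y) = gram y.
Proof. exact: det_gE. Qed.

(** The squared distance from the origin to the tangent plane, that is, minus the
    Lorentzian square of the normal component of the position vector. *)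
Definition tangent_plane_dist (y : E) : R := tvol y * tvol y / gram y.

Lemma tangent_plane_dist_continuous y : {for y, continuous tangent_plane_dist}.
Proof.
have nz z : setT z -> gram z != 0 by move=> _; exact: lt0r_neq0 (gram_gt0 z).
exact (Ck_cont (Ck_mul openT (Ck_mul openT (Ck_tvol 0) (Ck_tvol 0)) (Ck_inv openT nz (Ck_gram 0))) I).
Qed.

Lemma tangent_plane_dist_equivariant (a : E -> E) (B : 'M[R]_3) y : SO21 B -> smooth_on setT a ->
  (forall y, f (a y) = f y *m B) -> tangent_plane_dist (a y) = tangent_plane_dist y.
Proof.
move=> sB sa e.
have df z : differentiable f z by exact: Ck1_differentiable_mx openT (sf 1) I.
have da : differentiable a y by exact: Ck1_differentiable_mx openT (sa 1) I.
have ch i : d1 f i y *m B = 'D_(delta_mx 0 i) a y 0 ord0 *: d1 f ord0 (a y) + 'D_(delta_mx 0 i) a y 0 ord_max *: d1 f ord_max (a y).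
  rewrite -[RHS](derive_pd _ (df (a y))) -(derive_chain _ da (df (a y))).
  rewrite (_ : (fun y => f (a y)) = (fun y => f y *m B)); last exact/funext.
  exact: esym (derive_mulmxr B (Ck_derivable (sf 1) I)).
exact (plane_dist_isom sB (esym (e y)) (ch ord0) (ch ord_max) (gram_gt0 y)).
Qed.

(** At a critical point of [tangent_plane_dist] the second fundamental form kills
    the tangential component of the position vector, by [support_critical_identity].
    Negative curvature makes this form nondegenerate, by [gauss_egregium]; so the position
    vector is normal. *)
Lemma position_normal_at_max y0 : timelike_cone (f y0) ->
  (forall y, tangent_plane_dist y <= tangent_plane_dist y0) ->
  tvol y0 * tvol y0 = - lor (f y0) (f y0) * gram y0.
Proof.
move=> cp hm; set S := tangent_plane_dist y0.
have SG : tvol y0 * tvol y0 = S * gram y0 by rewrite /S /tangent_plane_dist divfK // gt_eqF // gram_gt0.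
have D0 : tvol y0 != 0.
  have /coneP[p0 _] := cp.
  apply/eqP => e; have := tvol_sqr y0; rewrite e mul0r => h.
  have : 0 < - lor (f y0) (f y0) * gram y0 + tangential y0.
    by rewrite ltr_wpDr ?tangential_ge0 // mulr_gt0 ?gram_gt0 // oppr_gt0.
  by rewrite -h ltxx.
have crit i : 2 * 'D_(delta_mx 0 i) tvol y0 * gram y0 - tvol y0 * 'D_(delta_mx 0 i) gram y0 = 0.
  apply: (critical_cancel D0 SG).
  (* [h] has the maximum 0 at [y0], and is easier to differentiate than the quotient. *)
  pose h y := tvol y * tvol y - S * gram y.
  have ch : Ck 1 setT h.
    exact: Ck_sub openT (Ck_mul openT (Ck_tvol 1) (Ck_tvol 1)) (Ck_mul openT (Ck_cst 1 setT S) (Ck_gram 1)).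
  have hh y : h y <= h y0.
    rewrite /h SG subrr subr_le0 -ler_pdivrMr ?gram_gt0 //; exact: hm.
  have dt : derivable tvol y0 (delta_mx 0 i) by exact: Ck_derivable (Ck_tvol 1) I.
  have dg : derivable gram y0 (delta_mx 0 i) by exact: Ck_derivable (Ck_gram 1) I.
  have := derive_at_max (delta_mx 0 i) ch hh.
  have [_ e] := is_deriveB (is_deriveM (DeriveDef dt erefl) (DeriveDef dt erefl))
     (is_deriveZ S (DeriveDef dg erefl)).
  by move=> <-; exact: esym e.
have d0 : tdet (d2 f ord0 ord0 y0) (d1 f ord0 y0) (d1 f ord_max y0) * tdet (d2 f ord_max ord_max y0) (d1 f ord0 y0) (d1 f ord_max y0)
     - tdet (d2 f ord0 ord_max y0) (d1 f ord0 y0) (d1 f ord_max y0) * tdet (d2 f ord0 ord_max y0) (d1 f ord0 y0) (d1 f ord_max y0) != 0.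
  have pd y : 0 < \det (g y) by rewrite det_gram_g gram_gt0.
  have e := gauss_egregium sf pd y0.
  have lt0 : gauss_curvature g y0 * (\det (g y0) * \det (g y0)) < 0.
    by rewrite nmulr_rlt0 ?mulr_gt0.
  by move: lt0; rewrite e oppr_lt0 => /gt_eqF ->.
have row i : tdet (d2 f i ord0 y0) (d1 f ord0 y0) (d1 f ord_max y0) * tan0 y0
  + tdet (d2 f i ord_max y0) (d1 f ord0 y0) (d1 f ord_max y0) * tan1 y0 = 0.
  have := crit i; rewrite derive_gram derive_tvol.
  move=> /(etrans (esym (support_critical_identity (f y0) (d1 f ord0 y0) (d1 f ord_max y0) (d2 f i ord0 y0) (d2 f i ord_max y0)))) /eqP.
  by rewrite mulf_eq0 oppr_eq0 pnatr_eq0 /= => /eqP.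
have r0 := row ord0; have r1 := row ord_max; rewrite (d2_sym sf ord_max ord0) in r1.
have [c0 c1] := symmetric_kernel d0 r0 r1.
apply: (etrans (tvol_sqr y0)).
by rewrite /tangential c0 c1 !mulr0 !addr0.
Qed.

End support.


(** * Metrics of radial graphs *)

Section polar_metric.
Context {R : realType}.
Local Notation E := 'rV[R]_2.
Local Notation M3 := 'rV[R]_3.

Lemma derive_hyp_orthogonal (x v : E) : lor (hyperboloid x) ('D_v (@hyperboloid R) x) = 0.
Proof.
have dh := Ck_derivable (v := v) (Ck_hyp 1) (I : setT x).
have [_ h] := is_derive_lor dh dh.
have : 'D_v (fun y : E => lor (hyperboloid y) (hyperboloid y)) x = 0.
  have -> : (fun y : E => lor (hyperboloid y) (hyperboloid y)) = cst (-1).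
    by apply/funext => y; exact: lor_hyp.
  exact: derive_cst.
move=> /(etrans (esym h)); rewrite (lorC ('D_v _ _)) -mulr2n => /eqP.
by rewrite mulrn_eq0 /= => /eqP.
Qed.

Lemma qform_hyp (x v : E) :
  qform (hyp_metric x) v = lor ('D_v (@hyperboloid R) x) ('D_v (@hyperboloid R) x).
Proof. by apply: qform_pullback; apply: Ck1_differentiable_mx openT (Ck_hyp 1) I. Qed.

Lemma graph_metric_bounds (x0 x1 z v0 v1 d n : R) : z * z = 1 + x0 * x0 + x1 * x1 -> 0 < z ->
  x0 * v0 + x1 * v1 - z * d = 0 -> `|v0| <= n -> `|v1| <= n ->
  0 <= v0 * v0 + v1 * v1 - d * d <= 2 * n * n.
Proof.
move=> hz z0 e b0 b1.
have n0 : 0 <= n by exact: le_trans (normr_ge0 _) b0.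
have sq (a : R) : `|a| <= n -> a * a <= n * n.
  by move=> h; rewrite -[a * a]ger0_norm -?expr2 ?sqr_ge0 // normrX lerXn2r // ?nnegrE.
have zd : z * d = x0 * v0 + x1 * v1 by apply/eqP; rewrite eq_sym -subr_eq0 e.
apply/andP; split; last first.
  have := sq _ b0; have := sq _ b1; have := sqr_ge0 d; rewrite expr2; lra.
have zz : 0 < z * z by rewrite mulr_gt0.
have -> : v0 * v0 + v1 * v1 - d * d = (z * z * (v0 * v0 + v1 * v1) - z * d * (z * d)) / (z * z).
  by field; rewrite gt_eqF.
rewrite pmulr_lge0 ?invr_gt0 //.
rewrite zd hz (_ : _ - _ = v0 ^+ 2 + v1 ^+ 2 + (x0 * v1 - x1 * v0) ^+ 2); last by ring.
by rewrite !addr_ge0 // sqr_ge0.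
Qed.

(** In the chart the hyperbolic metric is the Euclidean one minus the square of the
    differential of the height [hz]. The norm is the maximum of the coordinates, whence the
    factor 2. *)
Lemma hyp_metric_bounds (x v : E) :
  0 <= qform (hyp_metric x) v <= 2 * `|v| * `|v|.
Proof.
have dh := Ck_derivable (v := v) (Ck_hyp 1) (I : setT x).
have dc i := derive_coord x v i.
have c0 : 'D_v (@hyperboloid R) x 0 ord0 = v 0 ord0.
  apply: (etrans (derive_entry 0 ord0 dh)); apply: (etrans _ (dc ord0)).
  by congr ('D_v _ _); apply/funext => y; exact: hyp0.
have c1 : 'D_v (@hyperboloid R) x 0 i1 = v 0 ord_max.
  apply: (etrans (derive_entry 0 i1 dh)); apply: (etrans _ (dc ord_max)).
  by congr ('D_v _ _); apply/funext => y; exact: hyp1.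
have := derive_hyp_orthogonal x v; rewrite qform_hyp /lor c0 c1 hyp0 hyp1 hyp2.
move=> o; exact: graph_metric_bounds (hz_sqr x) (hz_gt0 x) o (ler_mx_entry v 0 ord0) (ler_mx_entry v 0 ord_max).
Qed.

Lemma derive_scaled (r : E -> R) (p : E -> M3) x v : derivable r x v -> derivable p x v ->
  'D_v (fun y => r y *: p y) x = 'D_v r x *: p x + r x *: 'D_v p x.
Proof.
move=> dr dp.
have h j := is_deriveM (DeriveDef dr erefl) (is_derive_entry j dp).
have E1 j : (fun y => (r y *: p y) 0 j) = r * (fun y => p y 0 j).
  by apply/funext => y; rewrite mxE.
have dm : derivable (fun y => r y *: p y) x v.
  by apply/derivable_mxP => i j; rewrite (ord1 i) E1; case: (h j).
apply/rowP => j; rewrite derive_entry // E1.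
have [_ k] := h j; apply: (etrans k).
rewrite !mxE /GRing.scale /= addrC; congr (_ + _); exact: mulrC.
Qed.

(** Gronwall: [r (x + t *: v) * expR (- (k * `|v|) * t)] is nonincreasing in [t]. *)
Lemma log_derivative_bound (r : E -> R) k x y : (forall z, 0 < r z) -> Ck 1 setT r ->
  (forall z v, 'D_v r z <= k * `|v| * r z) -> r y <= r x * expR (k * `|y - x|).
Proof.
move=> r0 cr hd; set v := y - x; pose F (t : R) := r (x + t *: v) * expR (- (k * `|v|) * t).
pose F' (t : R) := r (x + t *: v) * (expR (- (k * `|v|) * t) * - (k * `|v|)) + expR (- (k * `|v|) * t) * 'D_v r (x + t *: v).
have dF (t : R) : is_derive t 1 F (F' t).
  have d1 : is_derive t 1 (fun s : R => r (x + s *: v)) ('D_v r (x + t *: v)).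
    by apply: DeriveDef; [apply/derivable_line; exact: Ck_derivable cr I|exact: derive_line].
  have d2 : is_derive t 1 (fun s : R => - (k * `|v|) * s) (- (k * `|v|)).
    by apply: is_derive_eq; rewrite ?scaler0 ?addr0 ?mulr1 // /GRing.scale /= mulr1.
  have d3 := is_derive1_comp (is_derive_expR (- (k * `|v|) * t)) d2.
  exact: is_deriveM d1 d3.
have cF : {within `[0 : R, 1], continuous F}.
  by apply: derivable_within_continuous => s _; case: (dF s).
have [c _] := MVT_segment ler01 (fun s _ => dF s) cF.
rewrite subr0 mulr1 => e.
have : F 1 <= F 0.
  rewrite -subr_le0 e /F'.
  rewrite (_ : _ + _ = expR (- (k * `|v|) * c) * ('D_v r (x + c *: v) - k * `|v| * r (x + c *: v))); last by ring.
  by rewrite pmulr_rle0 ?expR_gt0 // subr_le0.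
rewrite /F scale1r scale0r addr0 mulr1 mulr0 expR0 mulr1 addrC subrK expRN.
by rewrite ler_pdivrMr ?expR_gt0.
Qed.

Lemma lor_polar_tangent (p q : M3) (a b : R) : lor p p = -1 -> lor p q = 0 ->
  lor (a *: p + b *: q) (a *: p + b *: q) = b * b * lor q q - a * a.
Proof. by move=> h1 h2; rewrite !(lorDl, lorDr, lorZl, lorZr) (lorC q p) h1 h2; ring. Qed.

Lemma lor_polar_position (p q : M3) (a b : R) : lor p p = -1 -> lor p q = 0 ->
  lor (b *: p) (a *: p + b *: q) = - (b * a).
Proof. by move=> h1 h2; rewrite !(lorDl, lorDr, lorZl, lorZr) h1 h2; ring. Qed.

Lemma slope_bound (r d h M G : R) : 0 < G ->
  - (r * d) * - (r * d) * G <= (M - r * r) * G * (r * r * h - d * d) ->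
  r * r * (r * r) * h <= M * (r * r * h - d * d).
Proof.
move=> G0; rewrite [leRHS]mulrAC ler_pM2r // => k.
by rewrite -subr_ge0 in k; rewrite -subr_ge0; apply: le_trans k _; rewrite le_eqVlt; apply/orP; left; apply/eqP; ring.
Qed.

End polar_metric.

Section comparison.
Context {R : realType}.
Local Notation E := 'rV[R]_2.
Local Notation M3 := 'rV[R]_3.
Variables (f : E -> M3) (psi : E -> E) (r : E -> R).
Hypotheses (sf : smooth_on setT f)
  (pos : forall x v, v != 0 -> 0 < lor ('D_v f x) ('D_v f x))
  (spsi : smooth_on setT psi) (r0 : forall x, 0 < r x) (cr : Ck 1 setT r)
  (polar : forall x, f (psi x) = r x *: hyperboloid x).
Let g : E -> 'M[R]_2 := pullback f (fun=> eta R).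

Lemma lor_tangent_ge0 x v : 0 <= lor ('D_v f x) ('D_v f x).
Proof.
have [->|/(pos x)/ltW//] := eqVneq v 0.
rewrite derive_pd; last exact: Ck1_differentiable_mx openT (sf 1) I.
by rewrite !mxE !scale0r addr0 /lor !mxE !mul0r !addr0 subr0.
Qed.

Lemma polar_tangent x v :
  'D_('D_v psi x) f (psi x) = 'D_v r x *: hyperboloid x + r x *: 'D_v (@hyperboloid R) x.
Proof.
have df : differentiable f (psi x) by exact: Ck1_differentiable_mx openT (sf 1) I.
have dp : differentiable psi x by exact: Ck1_differentiable_mx openT (spsi 1) I.
rewrite -(derive_chain v dp df).
have -> : (fun y => f (psi y)) = (fun y => r y *: hyperboloid y) by exact/funext.
apply: derive_scaled; first exact: Ck_derivable cr I.
exact: Ck_derivable (Ck_hyp 1) I.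
Qed.

Lemma qform_lifted x v :
  qform (pullback psi g x) v = lor ('D_('D_v psi x) f (psi x)) ('D_('D_v psi x) f (psi x)).
Proof.
have df : differentiable f (psi x) by exact: Ck1_differentiable_mx openT (sf 1) I.
have dp : differentiable psi x by exact: Ck1_differentiable_mx openT (spsi 1) I.
exact: etrans (qform_pullback_comp g v dp) (qform_pullback ('D_v psi x) df).
Qed.

(** In polar coordinates the Lorentzian metric is [- dr^2 + r^2 h]. *)
Lemma polar_metric x v : qform (pullback psi g x) v =
  r x * r x * qform (hyp_metric x) v - 'D_v r x * 'D_v r x.
Proof.
rewrite qform_lifted polar_tangent qform_hyp.
exact: lor_polar_tangent (lor_hyp x) (derive_hyp_orthogonal x v).
Qed.

Lemma lor_position_tangent x v : lor (f (psi x)) ('D_('D_v psi x) f (psi x)) = - (r x * 'D_v r x).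
Proof.
rewrite polar_tangent polar.
exact: lor_polar_position (lor_hyp x) (derive_hyp_orthogonal x v).
Qed.

Lemma polar_metric_ge0 x v : 0 <= qform (pullback psi g x) v.
Proof. rewrite qform_lifted; exact: lor_tangent_ge0. Qed.

Lemma polar_metric_le x v : qform (pullback psi g x) v <= r x * r x * qform (hyp_metric x) v.
Proof. by rewrite polar_metric gerBl -expr2 sqr_ge0. Qed.

(** Spacelike graphs are not steep: [dr^2 <= r^2 h] because [- dr^2 + r^2 h] is
    positive. *)
Lemma radius_log_derivative x v : 'D_v r x <= 2 * `|v| * r x.
Proof.
have := polar_metric_ge0 x v; rewrite polar_metric subr_ge0 => h.
have /andP[_ b] := hyp_metric_bounds x v.
have rx := r0 x.
have k : 'D_v r x ^+ 2 <= (2 * `|v| * r x) ^+ 2.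
  rewrite [leLHS]expr2; apply: le_trans h _.
  apply: (@le_trans _ _ (r x * r x * (2 * `|v| * `|v|))).
    by rewrite ler_pM2l // mulr_gt0.
  rewrite -subr_ge0 (_ : _ - _ = 2 * (r x * `|v|) ^+ 2); last by ring.
  by rewrite mulr_ge0 // sqr_ge0.
have := k; rewrite -ler_sqrt ?sqr_ge0 // !sqrtr_sqr => k'.
apply: le_trans (ler_norm _) _; apply: le_trans k' _.
by rewrite ger0_norm // !mulr_ge0 // ltW.
Qed.

Lemma radius_oscillation x y : r y <= r x * expR (2 * `|y - x|).
Proof. exact: log_derivative_bound r0 cr radius_log_derivative. Qed.

(** [- (r * 'D_v r x)] is the product of the position vector with a tangent vector,
    and the square of the tangential component of the position vector is at most
    [M - r ^+ 2]. Cauchy-Schwarz then bounds the slope: [r^2 dr^2 <= (M - r^2) g]. *)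
Lemma polar_metric_lower M x v : (forall y, tangent_plane_dist f y <= M) ->
  r x * r x * (r x * r x) * qform (hyp_metric x) v <= M * qform (pullback psi g x) v.
Proof.
move=> hM.
have G0 := gram_gt0 sf pos (psi x).
have k1 : tangential f (psi x) <= (M - r x * r x) * gram f (psi x).
  have := hM (psi x); rewrite ler_pdivrMr // tvol_sqr polar lorZl lorZr lor_hyp.
  by rewrite !mulrN1 mulrN opprK mulrBl lerBrDl.
have := radial_tangent sf (psi x) ('D_v psi x).
rewrite lor_position_tangent -qform_lifted polar_metric => k2.
apply: (slope_bound (G := gram f (psi x))) G0 _.
rewrite -polar_metric; have := polar_metric_ge0 x v; rewrite polar_metric => q0.
apply: le_trans k2 _; exact: ler_wpM2r q0 _ _ k1.
Qed.

End comparison.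


(** * Comparison with the hyperbolic metric *)

Section ratios.
Context {R : realType}.

Lemma ratio_lower (r m c h t : R) : 0 < r -> 0 < m -> m <= r * c -> 0 <= h ->
  r * r * (r * r) * h <= m * m * t -> (c ^+ 4 + 1)^-1 * h <= (m * m)^-1 * t.
Proof.
move=> r0 m0 mc h0 lo.
have c4 : 0 < c ^+ 4 + 1.
  by rewrite ltr_wpDl // -[4%N]/(2 * 2)%N exprM sqr_ge0.
have mm : 0 < m * m by rewrite mulr_gt0.
rewrite mulrC ler_pdivrMr // -mulrA mulrC ler_pdivlMr // .
have k : m ^+ 4 <= (r * c) ^+ 4 by rewrite lerXn2r // nnegrE; [exact: ltW|exact: le_trans (ltW m0) mc].
rewrite -(ler_pM2l mm).
have e1 : m * m * (h * (m * m)) = m ^+ 4 * h by ring.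
have e2 : m * m * (t * (c ^+ 4 + 1)) = (m * m * t) * (c ^+ 4 + 1) by ring.
rewrite e1 e2; apply: (@le_trans _ _ (r * r * (r * r) * h * (c ^+ 4 + 1))); last by rewrite ler_pM2r.
rewrite (_ : _ * (c ^+ 4 + 1) = ((r * c) ^+ 4 + r ^+ 4) * h); last by ring.
by rewrite ler_wpM2r // (le_trans k) // lerDl exprn_ge0 // ltW.
Qed.

Lemma ratio_upper (r m c h t : R) : 0 < r -> 0 < m -> r <= m -> 0 < c -> 0 <= h ->
  t <= r * r * h -> (m * m)^-1 * t <= (c ^+ 4 + 1) * h.
Proof.
move=> r0 m0 rm c0 h0 up.
have mm : 0 < m * m by rewrite mulr_gt0.
rewrite mulrC ler_pdivrMr //; apply: le_trans up _.
apply: (@le_trans _ _ (m * m * h)); first by rewrite ler_wpM2r // ler_pM // ltW.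
by rewrite [leRHS]mulrC ler_pM2l // mulrDl mul1r lerDr mulr_ge0 // exprn_ge0 // ltW.
Qed.

End ratios.

Section conclusion.
Context {R : realType}.
Local Notation E := 'rV[R]_2.
Local Notation M3 := 'rV[R]_3.
Variables (Gamma : set 'M[R]_3) (K : set E).
Hypotheses (subG : is_subgroup Gamma) (GSO : Gamma `<=` @SO21_id R)
  (isoG : Gamma `<=` isolated Gamma) (cK : compact K)
  (hK : forall x : E, exists2 A, Gamma A & K (act A x))
  (freeA : acts_freely Gamma).

Lemma fundamental_domain_bound : exists2 L, 0 <= L & forall x, K x -> `|x| <= L.
Proof.
have K0 : K !=set0 by have [A _ KA] := hK 0; exists (act A 0).
have [|c _ cmax] := @EVT_max_rV R 2 (fun x => `|x|) K K0 cK.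
  by apply: continuous_in_subspaceT => y _; exact: norm_continuous.
by exists `|c| => // x Kx; apply: cmax; rewrite inE.
Qed.

Variable F : E -> set M3.
Hypotheses (F_inv : forall A x, Gamma A -> F (act A x) = F x)
  (F_loc : forall x, exists U f, U x /\ local_lift Gamma F U f)
  (F_inj : forall x y, F x = F y -> same_orbit Gamma x y).
Variable f : E -> M3.
Hypotheses (sf : smooth_on setT f)
  (hf : forall x, timelike_cone (f x) /\ F x = Defs.orbit Gamma (f x))
  (pos : forall x v, v != 0 -> 0 < lor ('D_v f x) ('D_v f x))
  (Kneg : forall y, gauss_curvature (pullback f (fun=> eta R)) y < 0).

(** [tangent_plane_dist f] is Gamma-invariant and Gamma is cocompact. *)
Lemma tangent_plane_dist_max : exists y0, forall y, tangent_plane_dist f y <= tangent_plane_dist f y0.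
Proof.
have K0 : K !=set0 by have [A _ KA] := hK 0; exists (act A 0).
have [|c _ cmax] := @EVT_max_rV R 2 (tangent_plane_dist f) K K0 cK.
  by apply: continuous_in_subspaceT => y _; exact: tangent_plane_dist_continuous.
exists c => y; have [A gA KA] := hK y.
have [B gB e] := lift_equivariant subG GSO isoG freeA F_inv F_loc sf hf gA.
rewrite -(tangent_plane_dist_equivariant sf pos y (Gamma_SO GSO gB) _ e).
  by apply: cmax; rewrite inE.
by move=> k; exact: Ck_act.
Qed.

(** The maximum is attained where the position vector is normal; there the
    distance to the tangent plane is the distance to the point itself. *)
Lemma tangent_plane_dist_le m : (forall y, - lor (f y) (f y) <= m) -> forall y, tangent_plane_dist f y <= m.
Proof.
move=> hm y; have [y0 h0] := tangent_plane_dist_max.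
apply: le_trans (h0 y) _; apply: le_trans (hm y0).
have [c0 _] := hf y0.
by rewrite ler_pdivrMr ?gram_gt0 // (position_normal_at_max sf pos Kneg c0 h0).
Qed.

Variable psi : E -> E.
Hypotheses (spsi : smooth_on setT psi) (psiK : cancel psi (phi f)) (phiK : cancel (phi f) psi).
Let r := polar_radius f psi.

(** Both points can be moved into [K], whose diameter is at most [2 * L]. *)
Lemma radius_ratio L x y : (forall x, K x -> `|x| <= L) -> r y <= r x * expR (4 * L).
Proof.
move=> hL; have [A gA KA] := hK x; have [B gB KB] := hK y.
have inv := radius_invariant subG GSO isoG cK hK freeA F_inv F_loc F_inj sf hf spsi psiK phiK.
rewrite /r -(inv _ x gA) -(inv _ y gB) -/r.
have h := radius_oscillation sf pos spsi (radius_gt0 hf psi) (Ck_radius sf hf spsi 1) (lift_polar hf psiK) (act A x) (act B y).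
apply: le_trans h _; rewrite ler_pM2l ?(radius_gt0 hf) // ler_expR.
have n : `|act B y - act A x| <= L + L by rewrite (le_trans (ler_normB _ _)) // lerD // hL.
lra.
Qed.

(** The factor [expR (4 * L)] bounds the ratio of the maximum of the polar_radius to any
    of its values, and the fourth power of this ratio comes from [polar_metric_lower].
    Adding 1 makes the constant larger than 1. *)
Lemma graph_comparison L (C := expR (4 * L) ^+ 4 + 1) : (forall x, K x -> `|x| <= L) ->
  exists2 lambda : R, 0 < lambda &
    metric_le (fun x => C^-1 *: hyp_metric x) (fun x => lambda *: pullback psi (pullback f (fun=> eta R)) x) /\
    metric_le (fun x => lambda *: pullback psi (pullback f (fun=> eta R)) x) (fun x => C *: hyp_metric x).
Proof.
move=> hL.
have [x0 hx0] := radius_max subG GSO isoG cK hK freeA F_inv F_loc sf hf phiK.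
have r0 x : 0 < r x := radius_gt0 hf psi x.
have pol := lift_polar hf psiK.
have cr := Ck_radius sf hf spsi 1.
set m := r x0; have m0 : 0 < m := r0 x0.
have hm y : - lor (f y) (f y) <= m * m.
  rewrite -{1 2}(phiK y) pol lorZl lorZr lor_hyp !mulrN1 mulrN opprK.
  by apply: ler_pM; rewrite ?(ltW (r0 _)) //; exact: hx0.
have hM := tangent_plane_dist_le hm.
have qZ (c : R) (b : 'M[R]_2) (v : E) : qform (c *: b) v = c * qform b v.
  by rewrite /qform -scalemxAr -scalemxAl mxE.
exists (m * m)^-1; first by rewrite invr_gt0 mulr_gt0.
split=> x v; rewrite !qZ; have /andP[h0 _] := hyp_metric_bounds x v.
  have lo := polar_metric_lower sf pos spsi cr pol x v hM.
  exact: ratio_lower (r0 x) m0 (radius_ratio x x0 hL) h0 lo.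
have up := polar_metric_le sf spsi cr pol x v.
exact: ratio_upper (r0 x) m0 (hx0 x) (expR_gt0 _) h0 up.
Qed.

End conclusion.

Theorem theorem1p4 (R : realType) (n : nat) (hn : (2 <= n)%N)
    (Gamma : set 'M[R]_3)
    (lattice_Gamma : cocompact_lattice Gamma)
    (free_Gamma : acts_freely Gamma)
    (iso_Gamma : iso_surface_group n Gamma) :
  exists2 C : R, 1 < C &
    forall g : 'rV[R]_2 -> 'M[R]_2, Btilde Gamma g ->
    forall F, smooth_embedding Gamma F -> isometric Gamma g F ->
    exists psi,
      [/\ surface_diffeo Gamma psi,
          central_parametrization Gamma F psi &
          exists2 lambda : R, 0 < lambda &
            metric_le (fun x => C^-1 *: hyp_metric x)
                      (fun x => lambda *: pullback psi g x) /\
            metric_le (fun x => lambda *: pullback psi g x)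
                      (fun x => C *: hyp_metric x)].
Proof.
case: lattice_Gamma => subG GSO isoG [K cK hK].
have [L L0 hL] := fundamental_domain_bound cK hK.
exists (expR (4 * L) ^+ 4 + 1); first by rewrite ltrDr exprn_gt0 // expR_gt0.
move=> g [[_ _ gpos _] Kneg _] F [[F_inv F_loc] F_inj _] iso.
have [f [sf hf]] := exists_lift subG GSO isoG free_Gamma F_loc.
have eg : g = pullback f (fun=> eta R).
  apply/funext => x; apply: esym; apply: (iso setT f x) => //.
  by split; [exact: openT|exact: sf|move=> y _; exact: hf].
have pos x v : v != 0 -> 0 < lor ('D_v f x) ('D_v f x).
  move=> v0; have := gpos x v v0; rewrite eg qform_pullback //.
  by apply: Ck1_differentiable_mx openT (sf 1) I.
rewrite eg in Kneg *.
have [psi [spsi psiK phiK]] := global_inverse subG GSO isoG cK hK free_Gamma F_inv F_loc sf hf pos.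
exists psi; split.
- exact (psi_surface_diffeo subG GSO isoG cK hK free_Gamma F_inv F_loc F_inj sf hf spsi psiK phiK).
- exact (psi_central hf psiK).
- exact (graph_comparison subG GSO isoG cK hK free_Gamma F_inv F_loc F_inj sf hf pos Kneg spsi psiK phiK hL).
Qed.
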